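(* Let $\mathcal{D}\subset\mathbb{R}^d$ and assume that the location set $\chi=\{s_1,\ldots,s_n\}\subset\mathcal{D}$ satisfies the infill condition $$\max_{s\in\mathcal{D}}\min_{1\le i\le n}|s-s_i|\asymp n^{-1/d}.$$ Let $\mathbb{P}_0$ be the probability distribution of the Matérn model with parameters $(\sigma_0^2,\phi_0,\tau_0^2)$, which generates the data $y=(y(s_1),\ldots,y(s_n))^{T}$. Fix $\phi>0$ and $\delta^2>0$, and consider the posterior distributions $p(\sigma^2\mid y,\phi,\delta^2)$ of $\sigma^2$ and $p(\tau^2\mid y,\phi,\delta^2)$ of $\tau^2=\delta^2\sigma^2$ in the conjugate Bayesian model $$y\mid\sigma^2,\phi,\delta^2\sim\mathcal{N}\big(0,\sigma^2(R_\phi(\chi)+\delta^2I_n)\big),\qquad \sigma^2\sim\mathrm{IG}(a_\sigma,b_\sigma).$$ Then, under the true data generating distribution $\mathbb{P}_0$, $$\lim_{n\to\infty}p(\sigma^2\mid y,\phi,\delta^2)=\mathrm{Dirac}(\tau_0^2/\delta^2)\quad\text{and}\quad \lim_{n\to\infty}p(\tau^2\mid y,\phi,\delta^2)=\mathrm{Dirac}(\tau_0^2),$$ where $\mathrm{Dirac}(c)$ denotes the Dirac point mass at $c$.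
   Context: Matérn model with parameters $(\sigma^2,\phi,\tau^2)$: $y(s)=z(s)+\varepsilon(s)$, $s\in\mathcal{D}\subset\mathbb{R}^d$, where $z$ is a zero-mean Gaussian process with covariance $\sigma^2R_\phi(s,s')$, $\varepsilon$ is a white noise process with $\varepsilon(s)\sim\mathcal{N}(0,\tau^2)$, independent of $z$, and $$R_\phi(s,s')=\frac{(\phi|s-s'|)^{\nu}}{\Gamma(\nu)2^{\nu-1}}K_\nu(\phi|s-s'|),\qquad R_\phi(s,s)=1,$$ with $\phi$ the decay parameter, $K_\nu$ the modified Bessel function of the second kind of order $\nu$, and $\nu>0$ a fixed smoothness parameter (the same in the data-generating distribution and in the fitted model). $R_\phi(\chi)=(R_\phi(s_i,s_j))_{1\le i,j\le n}$. $\delta^2=\tau^2/\sigma^2$ is the (prefixed) noise-to-spatial variance ratio. $\mathrm{IG}(a,b)$ is the inverse-gamma distribution with density proportional to $x^{-a-1}e^{-b/x}$ on $(0,\infty)$; $a_\sigma,b_\sigma$ are fixed hyper-parameters. $a_n\asymp b_n$ means that $a_n/b_n$ is bounded above and below by positive constants independent of $n$. *)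

(* Defs.v *)
From HB Require Import structures.
From mathcomp Require Import all_boot all_order all_algebra.
From mathcomp Require Import all_classical all_reals all_analysis.
From mathcomp Require Import measurable_realfun.

Set Implicit Arguments.
Unset Strict Implicit.
Unset Printing Implicit Defensive.

Import Order.TTheory GRing.Theory Num.Theory.
Import numFieldNormedType.Exports.

Local Open Scope classical_set_scope.
Local Open Scope ring_scope.

Section special_functions.
Context {R : realType}.
Implicit Types nu x : R.

Definition Gamma x : R :=
  \int[lebesgue_measure]_(t in `]0, +oo[) (t `^ (x - 1) * expR (- t)).

Definition coshR x : R := (expR x + expR (- x)) / 2.

(* Modified Bessel function of the second kind, for 0 < x:
   K_nu(x) = int_0^oo exp(-x cosh t) cosh(nu t) dt (DLMF 10.32.9). *)
Definition besselK nu x : R :=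
  \int[lebesgue_measure]_(t in `]0, +oo[) (expR (- (x * coshR t)) * coshR (nu * t)).

End special_functions.

Section matern_covariance.
Context {R : realType} {d : nat}.
Implicit Types s t : 'rV[R]_d.

(* Euclidean distance: the library norm on 'rV[R]_d is the sup norm. *)
Definition dist s t : R := Num.sqrt (\sum_(i < d) (s 0 i - t 0 i) ^+ 2).

Definition matern (nu phi : R) s t : R :=
  if s == t then 1 else
    (phi * dist s t) `^ nu / (Gamma nu * 2 `^ (nu - 1))
    * besselK nu (phi * dist s t).

Definition matern_mx n (nu phi : R) (chi : 'I_n -> 'rV[R]_d) : 'M[R]_n :=
  \matrix_(i, j) matern nu phi (chi i) (chi j).

(* sup over s in D of min over i of |s - s_i|, for 0 < n.  As a real-valued sup
   it is 0 when D is unbounded, which [asymp] below rules out. *)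
Definition fill_distance (D : set 'rV[R]_d) n (chi : 'I_n -> 'rV[R]_d) : R :=
  sup [set inf [set dist s (chi i) | i in [set: 'I_n]] | s in D].

End matern_covariance.

Definition asymp {R : realType} (a b : nat -> R) : Prop :=
  exists c C : R, [/\ 0 < c, 0 < C &
    forall n, (0 < n)%N -> c <= a n / b n <= C].

Section matern_model.
Context {R : realType} {d : nat} {disp : measure_display}
  {T : measurableType disp} (P : probability T R).

(* Centred normal law with variance v; [normal_prob] is not the point mass at 0
   when its standard deviation is 0. *)
Definition gauss (v : R) : set R -> \bar R :=
  if v == 0 then \d_(0 : R) else normal_prob 0 (Num.sqrt v).

Definition gaussian_process (D : set 'rV[R]_d) (z : 'rV[R]_d -> {RV P >-> R})
    (cov : 'rV[R]_d -> 'rV[R]_d -> R) : Prop :=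
  forall k (s : 'I_k -> 'rV[R]_d) (a : 'I_k -> R), (forall i, D (s i)) ->
  forall A : set R, measurable A ->
    P ((fun w => \sum_(i < k) a i * z (s i) w) @^-1` A) =
    gauss (\sum_(i < k) \sum_(j < k) a i * a j * cov (s i) (s j)) A.

Definition white_noise (D : set 'rV[R]_d) (eps : 'rV[R]_d -> {RV P >-> R})
    (tau2 : R) : Prop :=
  (forall s, D s -> forall A : set R, measurable A ->
     P (eps s @^-1` A) = gauss tau2 A) /\
  (forall k (s : 'I_k -> 'rV[R]_d) (A : 'I_k -> set R),
     (forall i, D (s i)) -> injective s -> (forall i, measurable (A i)) ->
     P (\bigcap_i (eps (s i) @^-1` A i)) =
     (\prod_(i < k) P (eps (s i) @^-1` A i))%E).

Definition independent_processes (D : set 'rV[R]_d)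
    (z eps : 'rV[R]_d -> {RV P >-> R}) : Prop :=
  forall k l (s : 'I_k -> 'rV[R]_d) (t : 'I_l -> 'rV[R]_d)
    (A : 'I_k -> set R) (B : 'I_l -> set R),
    (forall i, D (s i)) -> (forall j, D (t j)) ->
    (forall i, measurable (A i)) -> (forall j, measurable (B j)) ->
    P (\bigcap_i (z (s i) @^-1` A i) `&` \bigcap_j (eps (t j) @^-1` B j)) =
    (P (\bigcap_i (z (s i) @^-1` A i)) *
     P (\bigcap_j (eps (t j) @^-1` B j)))%E.

Definition matern_model (D : set 'rV[R]_d) (nu sigma2 phi tau2 : R)
    (y : 'rV[R]_d -> {RV P >-> R}) : Prop :=
  exists z eps : 'rV[R]_d -> {RV P >-> R},
  [/\ gaussian_process D z (fun s t => sigma2 * matern nu phi s t),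
      white_noise D eps tau2,
      independent_processes D z eps &
      forall s, D s -> forall w, y s w = z s w + eps s w].

End matern_model.

Definition mvnormal_pdf {R : realType} n (S : 'M[R]_n) (y : 'cV[R]_n) : R :=
  (Num.sqrt ((2 * pi) ^+ n * \det S))^-1
  * expR (- (y^T *m invmx S *m y) 0 0 / 2).

Definition inv_gamma_pdf {R : realType} (a b x : R) : R :=
  if 0 < x then b `^ a / Gamma a * x `^ (- a - 1) * expR (- (b / x)) else 0.

(* Density in (y, sigma^2) of y | sigma^2 ~ N(0, sigma^2 V), sigma^2 ~ IG(a, b). *)
Definition joint_pdf {R : realType} n (V : 'M[R]_n) (a b : R) (y : 'cV[R]_n)
    (sigma2 : R) : R :=
  mvnormal_pdf (sigma2 *: V) y * inv_gamma_pdf a b sigma2.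

Section joint_pdf_facts.
Context {R : realType} (n : nat) (V : 'M[R]_n) (a b : R) (y : 'cV[R]_n).

Lemma joint_pdf_ge0 x : 0 <= joint_pdf V a b y x.
Proof.
rewrite /joint_pdf /mvnormal_pdf /inv_gamma_pdf; apply: mulr_ge0.
  by rewrite mulr_ge0 ?invr_ge0 ?sqrtr_ge0 ?expR_ge0.
case: ifP => // _; rewrite !mulr_ge0 ?powR_ge0 ?expR_ge0// invr_ge0.
by apply: Rintegral_ge0 => t _; rewrite mulr_ge0 ?powR_ge0 ?expR_ge0.
Qed.

Let sqrtVM (p q r : R) : 0 <= q ->
  (Num.sqrt (p * (q * r)))^-1 = (Num.sqrt q)^-1 * (Num.sqrt (p * r))^-1.
Proof. by move=> q0; rewrite mulrCA sqrtrM// invfM. Qed.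

Lemma measurable_joint_pdf : measurable_fun setT (joint_pdf V a b y).
Proof.
pose q (x : R) : R := if V \in unitmx then x `^ (-1) * (y^T *m invmx V *m y) 0 0
                      else x * (y^T *m V *m y) 0 0.
pose c : R := (Num.sqrt ((2 * pi) ^+ n * \det V))^-1.
have -> : joint_pdf V a b y = fun x => if 0 < x then
    ((x ^+ n) `^ 2^-1) `^ (-1) * c * expR (- q x * 2^-1) *
    (b `^ a / Gamma a * x `^ (- a - 1) * expR (- (b * x `^ (-1)))) else 0.
  apply/funext => x; rewrite /joint_pdf /inv_gamma_pdf.
  case: ifPn => [x0|_]; last by rewrite mulr0.
  have xn0 : 0 <= x ^+ n by rewrite exprn_ge0 ?ltW.
  have ux : x \is a GRing.unit by rewrite unitfE gt_eqF.
  have qE : (y^T *m invmx (x *: V) *m y) 0 0 = q x.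
    rewrite /q (powR_inv1 (ltW x0)); case: ifPn => uV.
      by rewrite invmxZ ?unitmxZ// -scalemxAr -scalemxAl mxE.
    by rewrite /invmx unitmxZ// (negbTE uV) -scalemxAr -scalemxAl mxE.
  rewrite /mvnormal_pdf detZ qE sqrtVM// (powR_inv1 (ltW x0)).
  by rewrite (powR12_sqrt xn0) (powR_inv1 (sqrtr_ge0 _)).
have mpow p : measurable_fun setT (fun x : R => x `^ p) by exact: measurable_powR.
have mN (f : R -> R) : measurable_fun setT f -> measurable_fun setT (fun x => - f x).
  by move=> mf; exact: (measurableT_comp (@oppr_measurable R setT) mf).
have mE (f : R -> R) : measurable_fun setT f -> measurable_fun setT (fun x => expR (f x)).
  by move=> mf; exact: (measurableT_comp (@measurable_expR R) mf).
have mid : measurable_fun setT (fun x : R => x) by exact: measurable_id.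
have mcst (k : R) : measurable_fun setT (fun _ : R => k) by exact: measurable_cst.
have mq : measurable_fun setT q.
  by rewrite /q; case: (V \in unitmx); exact: measurable_funM.
have mxn : measurable_fun setT (fun x : R => ((x ^+ n) `^ 2^-1) `^ (-1)).
  apply: (measurableT_comp (mpow _)); apply: (measurableT_comp (mpow _)).
  exact: measurable_funX.
apply: measurable_fun_ifT; last exact: mcst.
  exact: measurable_fun_ltr.
apply: measurable_funM.
  apply: measurable_funM; first exact: measurable_funM.
  by apply: mE; apply: measurable_funM => //; exact: mN.
apply: measurable_funM; first exact: measurable_funM.
by apply: mE; apply: mN; exact: measurable_funM.
Qed.

End joint_pdf_facts.

Definition scale_by {R : realType} (c : R) : R -> R := fun x => c * x.

HB.instance Definition _ {R : realType} (c : R) :=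
  isMeasurableFun.Build _ _ _ _ (scale_by c)
    (measurable_funM (@measurable_cst _ _ R R setT c) (@measurable_id _ R setT)).

Section posterior.
Local Open Scope ereal_scope.
Context {R : realType} (n : nat) (V : 'M[R]_n) (a b : R) (y : 'cV[R]_n).

Definition joint_measure : set R -> \bar R :=
  fun A => \int[lebesgue_measure]_(x in A) (joint_pdf V a b y x)%:E.

Let joint_measure0 : joint_measure set0 = 0.
Proof. by rewrite /joint_measure integral_set0. Qed.

Let joint_measure_ge0 A : 0 <= joint_measure A.
Proof. by apply: integral_ge0 => x _; rewrite lee_fin joint_pdf_ge0. Qed.

Let joint_measure_sigma_additive : semi_sigma_additive joint_measure.
Proof.
move=> /= F mF tF mUF; rewrite /joint_measure; apply: cvg_toP.
  apply: ereal_nondecreasing_is_cvgn => k l kl.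
  apply: lee_sum_nneg_natr => // m _ _; apply: integral_ge0 => x _.
  by rewrite lee_fin joint_pdf_ge0.
rewrite ge0_integral_bigcup//=.
- apply/measurable_funTS/measurableT_comp => //.
  exact: measurable_joint_pdf.
- by move=> x _; rewrite lee_fin joint_pdf_ge0.
Qed.

HB.instance Definition _ := isMeasure.Build _ _ _
  joint_measure joint_measure0 joint_measure_ge0 joint_measure_sigma_additive.

(* Bayes' rule.  [\d_1] is the value [mnormalize] takes when the evidence is 0
   or infinite, which does not happen for V positive definite and a, b > 0. *)
Definition posterior_sigma2 : probability R R :=
  mnormalize joint_measure \d_(1%R : R).

(* Posterior law of tau^2 = delta2 * sigma^2. *)
Definition posterior_tau2 (delta2 : R) : probability R R :=
  distribution posterior_sigma2 (scale_by delta2).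

End posterior.

Definition weak_cvg {R : realType} (mu : nat -> probability R R)
    (nu : probability R R) : Prop :=
  forall f : R -> R, continuous f -> (exists M, forall x, `|f x| <= M) ->
    (\int[mu n]_x (f x)%:E @[n --> \oo] --> \int[nu]_x (f x)%:E)%E.

(* Main.v *)
(* Write [V = R_phi(chi) + delta2 I] and [Q_n = y^T V^-1 y].  By conjugacy the
   posterior of sigma^2 is IG(a + n/2, b + Q_n/2), which concentrates at the limit
   of Q_n / n as soon as that limit exists, so it is enough to show that
   Q_n / n -> tau0^2 / delta2 almost surely.

   The infill condition forces D to be bounded.  Covering D by finitely many small
   cells, on which the kernel is nearly 1, shows that for every k > 0 the
   eigenvalues m_i of R_phi(chi) satisfy sum_i m_i / (m_i + k) = o(n).

   Noise: eps^T V^-1 eps = |eps|^2 / delta2 - B with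
   delta2 B = sum_i m_i / (m_i + delta2) (U^T eps)_i^2, whose mean is o(n).

   Process: R_phi is a Gaussian scale mixture, which yields
   R_phi0(chi) <= C R_phi(chi) in the Loewner order with C independent of n.  Since
   inversion is antitone, z^T V^-1 z <= C z^T (R_phi0(chi) + C delta2 I)^-1 z, and
   the right-hand side has mean O(sum_i m0_i / (m0_i + C delta2)) = o(n).

   Exponential Chernoff bounds and Borel-Cantelli turn these means into almost sure
   limits.  The cross term of z and eps is absorbed by the inequality
   2 |z^T V^-1 eps| <= t^-1 z^T V^-1 z + t eps^T V^-1 eps. *)

Require Import Defs.
From mathcomp Require Import all_boot all_order all_algebra.
From mathcomp Require Import all_classical all_reals all_analysis.
From mathcomp Require Import measurable_realfun ring lra.
From mathcomp.real_closed Require Import complex.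

Import Order.TTheory GRing.Theory Num.Theory.
Import numFieldNormedType.Exports.

Local Open Scope classical_set_scope.
Local Open Scope ring_scope.

Set Implicit Arguments.
Unset Strict Implicit.
Unset Printing Implicit Defensive.

(** * Gaussian integrals *)

Section integration.
Context {R : realType}.
Notation mu := (@lebesgue_measure R).

(** No asymptotics of individual eigenvalues enter, only the sums of m_i / (m_i + k). They suffice
    because, for a nonnegative Gaussian quadratic form whose weights times variances are at most
    1/2, the expectation of exp(form / 2) is at most exp(mean). A mean that is o(n) then yields
    P(form >= t n) <= exp(-g n) directly, without any variance estimate; this is why the forms below
    are divided by twice the noise or process variance. The sums are o(n) because almost the whole
    trace n of R_phi(chi) lies on the span of the cell indicators, whose dimension stays bounded.
    The Loewner comparison relates two matrices that need not commute. It is reduced to dimension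
    one: a wide Gaussian kernel is an average of translated narrow ones, and a symmetric pair of
    translations can only lower the quadratic form. Both this and positivity come from writing
    exp(-c (x - y)^2) as an L^2 inner product of two Gaussians. *)

Lemma lebesgue_measure_shift (a : R) (A : set R) : measurable A ->
  pushforward mu ((fun x => x + a) : measurableTypeR R -> measurableTypeR R) A = mu A.
Proof.
move=> mA; apply/esym/lebesgue_measure_unique => //=.
  exact: measurable_funD.
move=> msh X [[x y]] _ <-.
rewrite /pushforward [X in _ = mu X](_ : _ = `]x - a, y - a]%classic); last first.
  by apply/seteqP; split => z /=; rewrite !in_itv/= => /andP[]; lra.
rewrite !lebesgue_measure_itv/= !lte_fin ltrBlDr subrK.
by case: ifPn => // _; rewrite -!EFinB; congr EFin; ring.
Qed.

Lemma ge0_integral_shift (a : R) (f : R -> R) :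
  measurable_fun setT f -> (forall x, 0 <= f x) ->
  (\int[mu]_x (f (x + a))%:E = \int[mu]_x (f x)%:E)%E.
Proof.
move=> mf f0.
have := @ge0_integral_pushforward _ _ (measurableTypeR R) (measurableTypeR R) R
   (fun x => x + a) (measurable_funD (@measurable_id _ _ setT) (@measurable_cst _ _ _ _ setT a))
   mu setT (EFin \o f) measurableT.
rewrite preimage_setT => <- //; last 2 first.
  exact/measurable_EFinP.
  by move=> x _; rewrite /= lee_fin.
apply: eq_measure_integral => //=; first exact: measurable_funD.
by move=> ? A mA _; exact: lebesgue_measure_shift.
Qed.

Lemma Rintegral_sum (I : Type) (r : seq I) (F : I -> R -> R) :
  (forall i, mu.-integrable setT (EFin \o F i)) ->
  mu.-integrable setT (EFin \o (fun x => \sum_(i <- r) F i x)) /\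
  \int[mu]_x (\sum_(i <- r) F i x) = \sum_(i <- r) \int[mu]_x F i x.
Proof.
move=> iF; elim: r => [|i r [IH1 IH2]].
  rewrite big_nil; split; last first.
    under eq_Rintegral do rewrite big_nil.
    by rewrite Rintegral_cst// mul0r.
  apply: (eq_integrable _ _ _ _ (integrable0 _ _)) => // x _ /=.
  by rewrite big_nil.
have E : (fun x => \sum_(j <- i :: r) F j x) =
    (fun x => F i x + \sum_(j <- r) F j x).
  by apply/funext => x; rewrite big_cons.
rewrite E big_cons RintegralD// -IH2; split => //.
exact: (@integrableD _ _ _ mu _ measurableT (EFin \o F i)
  (EFin \o (fun x => \sum_(j <- r) F j x)) (iF i) IH1).
Qed.

Lemma integrable_Rmul (k : R) (f : R -> R) : mu.-integrable setT (EFin \o f) ->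
  mu.-integrable setT (EFin \o (fun x => k * f x)).
Proof.
move=> If; rewrite [X in _.-integrable _ X](_ : _ = (fun x => k%:E * (EFin \o f) x))%E//.
exact: integrableZl.
Qed.

Lemma Rintegral_quadform n (F : 'I_n -> 'I_n -> R -> R) (c : 'I_n -> 'I_n -> R) :
  (forall i j, mu.-integrable setT (EFin \o F i j)) ->
  mu.-integrable setT (EFin \o (fun x => \sum_i \sum_j c i j * F i j x)) /\
  \sum_i \sum_j c i j * \int[mu]_x F i j x =
  \int[mu]_x (\sum_i \sum_j c i j * F i j x).
Proof.
move=> iF.
have iG i j : mu.-integrable setT (EFin \o (fun x => c i j * F i j x)).
  exact: integrable_Rmul.
have H i := @Rintegral_sum _ (index_enum 'I_n) (fun j x => c i j * F i j x) (iG i).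
have [H1 H2] := @Rintegral_sum _ (index_enum 'I_n)
  (fun i x => \sum_j c i j * F i j x) (fun i => (H i).1).
split => //; rewrite H2; apply: eq_bigr => i _; rewrite (H i).2.
by apply: eq_bigr => j _; rewrite RintegralZl.
Qed.

(** The integral of exp(-b x^2) over the real line. *)
Definition gaussint (b : R) : R := Num.sqrt (pi / b).

Lemma gaussint_gt0 b : 0 < b -> 0 < gaussint b.
Proof. by move=> b0; rewrite sqrtr_gt0 divr_gt0// pi_gt0. Qed.

Lemma integral_gaussian (b m : R) : 0 < b ->
  (\int[mu]_x (expR (- (b * (x - m) ^+ 2)))%:E = (gaussint b)%:E)%E.
Proof.
move=> b0; pose s := Num.sqrt (2 * b)^-1.
have s2 : s ^+ 2 = (2 * b)^-1 by rewrite sqr_sqrtr// invr_ge0; lra.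
have s0 : s != 0 by rewrite gt_eqF// sqrtr_gt0 invr_gt0; lra.
have pE : normal_peak s = (gaussint b)^-1.
  by rewrite /normal_peak s2 /gaussint; congr (Num.sqrt _)^-1; field; lra.
have := @integral_normal_pdf R m s; rewrite normal_pdfE// pE.
under eq_integral do rewrite EFinM.
rewrite integralZl//; last first.
  have := @integrable_normal_pdf R m s; rewrite normal_pdfE// => H.
  rewrite [X in _.-integrable _ X](_ : _ = (fun x => ((normal_peak s)^-1)%:E *
    (normal_peak s * normal_fun m s x)%:E))%E; last first.
    apply/funext => x; rewrite -EFinM mulKf// gt_eqF//; exact: normal_peak_gt0.
  exact: integrableZl.
move=> H.
have g0 := gaussint_gt0 b0.
rewrite -[RHS]mule1 -H muleA -EFinM divff ?gt_eqF// mul1e.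
apply: eq_integral => x _; rewrite /normal_fun s2; congr (expR _)%:E.
by field; lra.
Qed.

Lemma integrable_gaussian (b m : R) : 0 < b ->
  mu.-integrable setT (EFin \o (fun x => expR (- (b * (x - m) ^+ 2)))).
Proof.
move=> b0; apply/integrableP; split.
  apply/measurable_EFinP; apply: measurableT_comp => //.
  apply: measurableT_comp => //; apply: measurable_funM => //.
  by apply: measurable_funX; exact: measurable_funB.
under eq_integral do rewrite /= ger0_norm ?expR_ge0//.
by rewrite integral_gaussian// ltry.
Qed.

Lemma Rintegral_gaussian (b m : R) : 0 < b ->
  \int[mu]_x (expR (- (b * (x - m) ^+ 2))) = gaussint b.
Proof. by move=> b0; rewrite /Rintegral integral_gaussian. Qed.

End integration.

(** * Positive semidefinite kernels and the comparison of Gaussian kernels *)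

Section kernels.
Context {R : realType}.
Notation mu := (@lebesgue_measure R).

Definition quadform n (M : 'I_n -> 'I_n -> R) (a : 'I_n -> R) : R :=
  \sum_i \sum_j a i * a j * M i j.

Definition psd n (M : 'I_n -> 'I_n -> R) := forall a, 0 <= quadform M a.

(** Schur product with a Gram matrix: for each fixed [u] the integrand is the form of [M] at the
    vector [a i * g i u]. *)
Lemma quadform_gram_psd n (M : 'I_n -> 'I_n -> R) (g : 'I_n -> R -> R)
    (a : 'I_n -> R) : psd M ->
  (forall i j, mu.-integrable setT (EFin \o (fun u => g i u * g j u))) ->
  0 <= quadform (fun i j => M i j * \int[mu]_u (g i u * g j u)) a.
Proof.
move=> pM ig; rewrite /quadform.
have [_] := @Rintegral_quadform R n (fun i j u => g i u * g j u)
  (fun i j => a i * a j * M i j) ig.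
under eq_bigr do under eq_bigr do rewrite -mulrA.
move=> ->; apply: Rintegral_ge0 => u _.
have := pM (fun i => a i * g i u); rewrite /quadform.
by congr (0 <= _); apply: eq_bigr => i _; apply: eq_bigr => j _; ring.
Qed.

(** Parallelogram identity around the midpoint. Integrated in [u], it exhibits exp(-c (x - y)^2) as
    a Gram matrix. *)
Lemma gauss_prod (c x y u : R) :
  expR (- (2 * c * (x - u) ^+ 2)) * expR (- (2 * c * (y - u) ^+ 2)) =
  expR (- (c * (x - y) ^+ 2)) * expR (- (4 * c * (u - (x + y) / 2) ^+ 2)).
Proof. by rewrite -!expRD; congr expR; field. Qed.

Lemma integrable_gauss_prod (c x y : R) : 0 < c ->
  mu.-integrable setT (EFin \o (fun u =>
    expR (- (2 * c * (x - u) ^+ 2)) * expR (- (2 * c * (y - u) ^+ 2)))).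
Proof.
move=> c0; under eq_fun do rewrite gauss_prod.
by apply: integrable_Rmul; apply: integrable_gaussian; rewrite mulr_gt0.
Qed.

Lemma Rintegral_gauss_prod (c x y : R) : 0 < c ->
  \int[mu]_u (expR (- (2 * c * (x - u) ^+ 2)) * expR (- (2 * c * (y - u) ^+ 2)))
  = gaussint (4 * c) * expR (- (c * (x - y) ^+ 2)).
Proof.
move=> c0; under eq_Rintegral do rewrite gauss_prod.
have c40 : 0 < 4 * c by rewrite mulr_gt0.
by rewrite RintegralZl//; [rewrite Rintegral_gaussian// mulrC|exact: integrable_gaussian].
Qed.

Lemma quadformZ n (M : 'I_n -> 'I_n -> R) (k : R) a :
  quadform (fun i j => k * M i j) a = k * quadform M a.
Proof.
rewrite /quadform mulr_sumr; apply: eq_bigr => i _.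
by rewrite mulr_sumr; apply: eq_bigr => j _; ring.
Qed.

Lemma quadformD n (M N : 'I_n -> 'I_n -> R) a :
  quadform (fun i j => M i j + N i j) a = quadform M a + quadform N a.
Proof.
rewrite /quadform -big_split; apply: eq_bigr => i _ /=.
by rewrite -big_split; apply: eq_bigr => j _ /=; ring.
Qed.

Lemma quadformB n (M N : 'I_n -> 'I_n -> R) a :
  quadform (fun i j => M i j - N i j) a = quadform M a - quadform N a.
Proof.
rewrite -[in RHS]mulN1r -quadformZ -quadformD /quadform.
by apply: eq_bigr => i _; apply: eq_bigr => j _; rewrite mulN1r.
Qed.

Lemma eq_quadform n (M N : 'I_n -> 'I_n -> R) a :
  (forall i j, M i j = N i j) -> quadform M a = quadform N a.
Proof. by move=> MN; apply: eq_bigr => i _; apply: eq_bigr => j _; rewrite MN. Qed.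

Lemma psd_gaussM n (M : 'I_n -> 'I_n -> R) (c : R) (x : 'I_n -> R) :
  psd M -> 0 < c ->
  psd (fun i j => expR (- (c * (x i - x j) ^+ 2)) * M i j).
Proof.
move=> pM c0 a; have c40 : 0 < 4 * c by rewrite mulr_gt0.
have := @quadform_gram_psd n M (fun i u => expR (- (2 * c * (x i - u) ^+ 2))) a pM
  (fun i j => integrable_gauss_prod _ _ c0).
move=> H; rewrite -(pmulr_rge0 _ (gaussint_gt0 c40)) -quadformZ; move: H.
congr (0 <= _); apply: eq_quadform => i j; rewrite Rintegral_gauss_prod//; ring.
Qed.

(** The Gram matrix of the differences h(x_i) - h(x_i + v) is, up to a positive factor, twice the
    centred kernel minus the two translated ones, so its Schur product with [M] is nonnegative. *)
Lemma quadform_gauss_shift n (M : 'I_n -> 'I_n -> R) (c v : R) (x : 'I_n -> R) a :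
  psd M -> 0 < c ->
  quadform (fun i j => expR (- (c * ((x i - x j) - v) ^+ 2)) * M i j) a +
  quadform (fun i j => expR (- (c * ((x i - x j) + v) ^+ 2)) * M i j) a <=
  2 * quadform (fun i j => expR (- (c * (x i - x j) ^+ 2)) * M i j) a.
Proof.
move=> pM c0; have c40 : 0 < 4 * c by rewrite mulr_gt0.
pose h (p u : R) := expR (- (2 * c * (p - u) ^+ 2)).
have ih p q : mu.-integrable setT (EFin \o (fun u => h p u * h q u)).
  exact: integrable_gauss_prod.
have E i j : (fun u => (h (x i) u - h (x i + v) u) * (h (x j) u - h (x j + v) u)) =
   (fun u => (h (x i) u * h (x j) u + h (x i + v) u * h (x j + v) u) -
     (h (x i) u * h (x j + v) u + h (x i + v) u * h (x j) u)).
  by apply/funext => u; ring.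
have iD p q r s : mu.-integrable setT
   (EFin \o (fun u => h p u * h q u + h r u * h s u)).
  exact: (integrableD _ (ih p q) (ih r s)).
have := @quadform_gram_psd n M (fun i u => h (x i) u - h (x i + v) u) a pM.
have I i j : mu.-integrable setT (EFin \o (fun u =>
    (h (x i) u - h (x i + v) u) * (h (x j) u - h (x j + v) u))).
  by rewrite E; exact: (integrableB _ (iD _ _ _ _) (iD _ _ _ _)).
move=> /(_ I).
have G := gaussint_gt0 c40.
move=> H; rewrite -subr_ge0 -(pmulr_rge0 _ G); move: H.
rewrite -quadformZ -quadformD -quadformB -quadformZ.
congr (0 <= _); apply: eq_quadform => i j.
rewrite E RintegralB// !RintegralD// !Rintegral_gauss_prod//.
have -> : x i + v - (x j + v) = x i - x j by ring.
have -> : x i - (x j + v) = x i - x j - v by ring.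
have -> : x i + v - x j = x i - x j + v by ring.
ring.
Qed.

(** The wide kernel of rate [c] is a Gaussian average over [v] of the narrow kernel of rate [c']
    translated by [v] and by [- v]; [quadform_gauss_shift] bounds each such pair by twice the
    centred form. *)
Lemma quadform_gauss_le n (M : 'I_n -> 'I_n -> R) (c c' : R) (x : 'I_n -> R) a :
  psd M -> 0 < c -> c <= c' ->
  quadform (fun i j => expR (- (c * (x i - x j) ^+ 2)) * M i j) a <=
  Num.sqrt (c' / c) * quadform (fun i j => expR (- (c' * (x i - x j) ^+ 2)) * M i j) a.
Proof.
move=> pM c0; rewrite le_eqVlt => /predU1P[<-|cc'].
  by rewrite divff ?gt_eqF// sqrtr1 mul1r.
have c'0 : 0 < c' by exact: lt_trans cc'.
(* Chosen so that 1 / c = 1 / al + 1 / c': variances add under convolution. *)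
pose al := c * c' / (c' - c).
have al0 : 0 < al by rewrite divr_gt0 ?mulr_gt0// subr_gt0.
have ca : c' - c != 0 by rewrite gt_eqF// subr_gt0.
have b0 : 0 < al + c' by rewrite addr_gt0.
have bE : al + c' = c' * c' / (c' - c) by rewrite /al; field.
pose f (h v : R) := expR (- (al * (v - 0) ^+ 2)) *
  (expR (- (c' * (h - v) ^+ 2)) + expR (- (c' * (h + v) ^+ 2))).
have fE h v : f h v = expR (- (c * h ^+ 2)) *
    (expR (- ((al + c') * (v - (c' / (al + c') * h)) ^+ 2)) +
     expR (- ((al + c') * (v - (- (c' / (al + c') * h))) ^+ 2))).
  rewrite /f !mulrDr -!expRD bE /al; congr (expR _ + expR _); field; rewrite ca ?gt_eqF//.
pose g (h v : R) := expR (- ((al + c') * (v - (c' / (al + c') * h)) ^+ 2)) +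
     expR (- ((al + c') * (v - (- (c' / (al + c') * h))) ^+ 2)).
have ig h : mu.-integrable setT (EFin \o g h).
  exact: (integrableD _ (integrable_gaussian _ b0) (integrable_gaussian _ b0)).
have If h : mu.-integrable setT (EFin \o f h).
  rewrite (_ : f h = fun v => expR (- (c * h ^+ 2)) * g h v); last exact/funext.
  exact: integrable_Rmul.
have intf h : \int[mu]_v f h v = 2 * gaussint (al + c') * expR (- (c * h ^+ 2)).
  rewrite (_ : f h = fun v => expR (- (c * h ^+ 2)) * g h v); last exact/funext.
  rewrite RintegralZl// RintegralD//; try exact: integrable_gaussian.
  by rewrite !Rintegral_gaussian//; ring.
have [iQ] := @Rintegral_quadform R n (fun i j => f (x i - x j))
  (fun i j => a i * a j * M i j) (fun i j => If _).
have -> : \sum_i \sum_j a i * a j * M i j * \int[mu]_v f (x i - x j) v =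
   2 * gaussint (al + c') *
   quadform (fun i j => expR (- (c * (x i - x j) ^+ 2)) * M i j) a.
  rewrite -quadformZ; apply: eq_bigr => i _; apply: eq_bigr => j _.
  by rewrite intf; ring.
pose Q := quadform (fun i j => expR (- (c' * (x i - x j) ^+ 2)) * M i j) a.
have iR : mu.-integrable setT (EFin \o (fun v : R => (2 * Q) * expR (- (al * (v - 0) ^+ 2)))).
  by apply: integrable_Rmul; exact: integrable_gaussian.
have leQ v : \sum_i \sum_j a i * a j * M i j * f (x i - x j) v <=
    (2 * Q) * expR (- (al * (v - 0) ^+ 2)).
  have := quadform_gauss_shift v x a pM c'0; rewrite -/Q => H.
  apply: le_trans (_ : expR (- (al * (v - 0) ^+ 2)) *
     (quadform (fun i j => expR (- (c' * ((x i - x j) - v) ^+ 2)) * M i j) a +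
      quadform (fun i j => expR (- (c' * ((x i - x j) + v) ^+ 2)) * M i j) a) <= _).
    rewrite -quadformD -quadformZ le_eqVlt; apply/orP; left; apply/eqP.
    by apply: eq_bigr => i _; apply: eq_bigr => j _; rewrite /f; ring.
  by rewrite mulrC ler_wpM2r// expR_ge0.
move=> E; have := le_Rintegral measurableT iQ iR (fun v _ => leQ v).
rewrite -E RintegralZl//; last exact: integrable_gaussian.
rewrite Rintegral_gaussian// -/Q.
have Gb := gaussint_gt0 b0.
have -> : gaussint al = Num.sqrt (c' / c) * gaussint (al + c').
  rewrite /gaussint -sqrtrM ?divr_ge0 ?ltW//; congr Num.sqrt.
  by rewrite bE /al; field; rewrite ca !gt_eqF.
rewrite (_ : 2 * Q * _ = 2 * gaussint (al + c') * (Num.sqrt (c' / c) * Q)); last by ring.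
by rewrite ler_pM2l// mulr_gt0.
Qed.

(* Isotropic kernels are products of one-dimensional ones, peeled off one coordinate at a time. *)
Lemma psd_cst1 n : psd (fun _ _ : 'I_n => 1 : R).
Proof.
move=> a; rewrite /quadform.
under eq_bigr do under eq_bigr do rewrite mulr1.
under eq_bigr do rewrite -mulr_sumr.
by rewrite -mulr_suml -expr2 sqr_ge0.
Qed.

(** Both claims are carried through one induction: the comparison in the new coordinate takes the
    positivity of the remaining product as its weight matrix [M]. *)
Lemma gauss_kernel_seq n (I : Type) (r : seq I) (x : 'I_n -> I -> R) (c c' : R) :
  0 < c -> c <= c' ->
  psd (fun i j => expR (- (c * \sum_(k <- r) (x i k - x j k) ^+ 2))) /\
  forall a, quadform (fun i j => expR (- (c * \sum_(k <- r) (x i k - x j k) ^+ 2))) a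
    <= Num.sqrt (c' / c) ^+ size r *
       quadform (fun i j => expR (- (c' * \sum_(k <- r) (x i k - x j k) ^+ 2))) a.
Proof.
move=> c0 cc'; have c'0 : 0 < c' by exact: lt_le_trans cc'.
elim: r => [|k r [IHp IHle]].
  have E b i j : (fun i j : 'I_n => expR (- (b * \sum_(k <- [::]) (x i k - x j k) ^+ 2))) i j = 1.
    by rewrite /= big_nil mulr0 oppr0 expR0.
  split=> a; first by rewrite (eq_quadform a (E c)); exact: psd_cst1.
  by rewrite (eq_quadform a (E c)) (eq_quadform a (E c')) expr0 mul1r.
have E b i j : (fun i j : 'I_n => expR (- (b * \sum_(k <- k :: r) (x i k - x j k) ^+ 2))) i j =
    expR (- (b * (x i k - x j k) ^+ 2)) *
    expR (- (b * \sum_(k <- r) (x i k - x j k) ^+ 2)).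
  by rewrite /= big_cons mulrDr opprD expRD.
split=> a; first by rewrite (eq_quadform a (E c)); exact: (psd_gaussM (fun i => x i k)).
rewrite (eq_quadform a (E c)) (eq_quadform a (E c')).
apply: (le_trans (quadform_gauss_le (fun i => x i k) a IHp c0 cc')).
(* The new coordinate now has rate [c'] on both sides, so the gap is a Gaussian kernel times the gap
   of the induction hypothesis, itself positive semidefinite. *)
rewrite exprS -mulrA ler_wpM2l ?sqrtr_ge0// -subr_ge0 -quadformZ -quadformB.
set N := fun i j => _; suff: psd N by exact.
have -> : N = (fun i j => expR (- (c' * (x i k - x j k) ^+ 2)) *
   (Num.sqrt (c' / c) ^+ size r * expR (- (c' * \sum_(k <- r) (x i k - x j k) ^+ 2)) -
    expR (- (c * \sum_(k <- r) (x i k - x j k) ^+ 2)))).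
  by apply/funext => i; apply/funext => j; rewrite /N; ring.
apply: (psd_gaussM (fun i => x i k)) => // b.
by rewrite quadformB quadformZ subr_ge0.
Qed.

End kernels.

(** * The Matern kernel as a Gaussian scale mixture *)

Section matern_mixture.
Context {R : realType}.
Notation mu := (@lebesgue_measure R).

Lemma ge0_integral_opp (f : R -> R) :
  measurable_fun setT f -> (forall x, 0 <= f x) ->
  (\int[mu]_x (f (- x))%:E = \int[mu]_x (f x)%:E)%E.
Proof.
move=> mf f0.
have := @ge0_integral_pushforward _ _ (measurableTypeR R) (measurableTypeR R) R
   -%R (@oppr_measurable R setT) mu setT (EFin \o f) measurableT.
rewrite preimage_setT => <- //; last 2 first.
  exact/measurable_EFinP.
  by move=> x _; rewrite /= lee_fin.
by apply: eq_measure_integral => //= A mA _; exact: lebesgue_measureN.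
Qed.

Definition mixfun (nu p q w : R) : R :=
  expR (nu * w) * expR (- (p * expR w + q * expR (- w))).

(* = int_0^oo u^(nu-1) exp(-(p u + q/u)) du, after the substitution u = e^w. *)
Definition mixint (nu p q : R) : \bar R := (\int[mu]_w (mixfun nu p q w)%:E)%E.

Lemma mixfun_gt0 nu p q w : 0 < mixfun nu p q w.
Proof. by rewrite mulr_gt0 ?expR_gt0. Qed.

Lemma continuous_mixfun nu p q : continuous (mixfun nu p q).
Proof.
move=> w; apply: cvgM.
  apply: continuous_comp; last exact: continuous_expR.
  by apply: cvgM; [exact: cvg_cst|exact: cvg_id].
apply: continuous_comp; last exact: continuous_expR.
apply: cvgN; apply: cvgD; apply: cvgM; try exact: cvg_cst.
  exact: continuous_expR.
apply: (@continuous_comp R R R -%R expR); first exact: opp_continuous.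
exact: continuous_expR.
Qed.

Lemma measurable_mixfun nu p q : measurable_fun setT (mixfun nu p q).
Proof. exact: continuous_measurable_fun (@continuous_mixfun nu p q). Qed.

(** A translation of the logarithmic variable. It brings the symmetric parameters of [besselK] to
    [p = 1], and later moves the decay parameter from the Gaussian component to the mixing
    density. *)
Lemma mixint_scale nu p q r :
  mixint nu (p * expR r) (q * expR (- r)) = ((expR (- (nu * r)))%:E * mixint nu p q)%E.
Proof.
rewrite /mixint -[in RHS](@ge0_integral_shift _ r); last 2 first.
- exact: measurable_mixfun.
- by move=> w; exact/ltW/mixfun_gt0.
rewrite -ge0_integralZl//; last 2 first.
- apply/measurable_EFinP; apply: measurableT_comp; first exact: measurable_mixfun.
  exact: measurable_funD.
- by move=> w _; rewrite lee_fin; exact/ltW/mixfun_gt0.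
apply: eq_integral => w _; rewrite -EFinM; congr EFin.
rewrite /mixfun -!expRD; congr expR.
by rewrite [- (w + r)]opprD !expRD; ring.
Qed.

Lemma expR_ge_sqr (w : R) : 0 <= w -> w ^+ 2 / 2 <= expR w.
Proof.
move=> w0; have := expR_ge1Dxn 1 w0.
by rewrite (_ : 2`!%N = 2%N)//; lra.
Qed.

Lemma integrable_mixfun (nu p q : R) : 0 < nu -> 0 < p -> 0 <= q ->
  mu.-integrable setT (EFin \o mixfun nu p q).
Proof.
move=> nu0 p0 q0.
(* [h1] is exp(nu w - p w^2 / 2) with the square completed and dominates for w >= 0, where exp(w) >=
   w^2 / 2; [h2] is exp(nu w) for w <= 0, written as a reflected exponential density. *)
pose h1 (w : R) : R := expR (nu ^+ 2 / (2 * p)) * expR (- (p / 2 * (w - nu / p) ^+ 2)).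
pose h2 (w : R) : R := nu^-1 * exponential_pdf nu (- w).
have ih1 : mu.-integrable setT (EFin \o h1).
  by apply: integrable_Rmul; apply: integrable_gaussian; rewrite divr_gt0.
have ih2 : mu.-integrable setT (EFin \o h2).
  apply: integrable_Rmul.
  have me := @measurable_exponential_pdf R nu.
  apply/integrableP; split.
    by apply/measurable_EFinP; apply: measurableT_comp.
  under eq_integral do rewrite /= ger0_norm ?exponential_pdf_ge0 ?ltW//.
  rewrite ge0_integral_opp//; last by move=> x; rewrite exponential_pdf_ge0// ltW.
  by rewrite integral_exponential_pdf// ltry.
apply: (le_integrable measurableT _ _ (integrableD measurableT ih1 ih2)).
  by apply/measurable_EFinP; exact: measurable_mixfun.
move=> w _; rewrite /= lee_fin gtr0_norm ?mixfun_gt0//.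
have h1_ge0 : 0 <= h1 w by rewrite mulr_ge0 ?expR_ge0.
have h2_ge0 : 0 <= h2 w by rewrite mulr_ge0 ?invr_ge0 ?exponential_pdf_ge0 ?ltW.
rewrite ger0_norm ?addr_ge0//.
have qe : 0 <= q * expR (- w) by rewrite mulr_ge0 ?expR_ge0.
have [w0|w0] := leP 0 w.
  apply: le_trans (_ : h1 w <= _); last by rewrite lerDl.
  rewrite /mixfun /h1 -!expRD ler_expR.
  have := expR_ge_sqr w0 => /(ler_wpM2l (ltW p0)) H.
  rewrite (_ : nu ^+ 2 / (2 * p) - p / 2 * (w - nu / p) ^+ 2 = nu * w - p * (w ^+ 2 / 2)); last first.
    by field; rewrite gt_eqF.
  lra.
apply: le_trans (_ : h2 w <= _); last by rewrite lerDr.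
rewrite /mixfun /h2 exponential_pdfE; last by rewrite oppr_ge0 ltW.
rewrite mulKf ?gt_eqF// mulrNN ler_piMr ?expR_ge0// -expR0 ler_expR oppr_le0 addr_ge0//.
by rewrite mulr_ge0 ?expR_ge0 ?ltW.
Qed.

Lemma mixint_fin_num (nu p q : R) : 0 < nu -> 0 < p -> 0 <= q ->
  mixint nu p q \is a fin_num.
Proof.
by move=> nu0 p0 q0; apply: integrable_fin_num => //; exact: integrable_mixfun.
Qed.

Lemma mixint_gt0 (nu p q : R) : (0 < mixint nu p q)%E.
Proof.
have mm : measurable_fun setT (fun w => (mixfun nu p q w)%:E).
  by apply/measurable_EFinP; exact: measurable_mixfun.
rewrite lt_neqAle integral_ge0 ?andbT; last first.
  by move=> w _; rewrite lee_fin ltW// mixfun_gt0.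
apply/eqP => H.
have := (ae_eq_integral_abs mu measurableT mm).1.
rewrite /mixint in H.
under eq_integral do rewrite gee0_abs ?lee_fin ?(ltW (mixfun_gt0 _ _ _ _))//.
move=> /(_ (esym H)) [N [mN N0 sN]].
have : (mu setT <= mu N)%E.
  apply: le_outer_measure => x _; apply: sN => /= /(_ I) [] => /eqP.
  by rewrite gt_eqF// mixfun_gt0.
by rewrite N0 -set_itvNyy lebesgue_measure_itv.
Qed.

(** Substitution on the compact intervals [exp(-n), exp(n)], which exhaust the half-line, followed
    by monotone convergence on both sides. *)
Lemma integral_expR_subst (G : R -> R) : (forall x, 0 <= G x) ->
  (forall x, 0 < x -> {for x, continuous G}) ->
  (\int[mu]_(x in `]0%R, +oo[) (G x)%:E =
   \int[mu]_w (G (expR w) * expR w)%:E)%E.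
Proof.
move=> G0 cG.
pose E (n : nat) := `[expR (- n%:R) : R, expR n%:R]%classic.
pose F (n : nat) := `[- n%:R : R, n%:R]%classic.
have mG : measurable_fun `]0 : R, +oo[%classic G.
  apply: open_continuous_measurable_fun; first exact: interval_open.
  by move=> x; rewrite inE/= in_itv/= andbT; exact: cG.
have cGe : continuous (fun w => G (expR w) * expR w).
  move=> w; apply: cvgM; last exact: continuous_expR.
  apply: (@continuous_comp R R R expR G); first exact: continuous_expR.
  by apply: cG; exact: expR_gt0.
have sE n : E n `<=` `]0, +oo[.
  move=> x; rewrite /E /= !in_itv/= andbT => /andP[+ _].
  by apply: lt_le_trans; exact: expR_gt0.
have UE : \bigcup_n E n = `]0, +oo[%classic.
  apply/seteqP; split=> [x [n _]|x]; first exact: sE.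
  rewrite /= in_itv/= andbT => x0.
  have [n] : exists n : nat, `|ln x| < n%:R.
    exists (Num.bound `|ln x|); exact: (archi_boundP (normr_ge0 _)).
  rewrite ltr_norml => /andP[a b].
  exists n => //; rewrite /E /= in_itv/= -[x]lnK ?posrE// !ler_expR !ltW//.
have UF : \bigcup_n F n = [set: R].
  apply/seteqP; split=> // x _.
  exists (Num.bound `|x|) => //; rewrite /F/= in_itv/= -ler_norml.
  by apply/ltW; exact: (archi_boundP (normr_ge0 _)).
have ndE : nondecreasing_seq E.
  move=> m n mn; rewrite subsetEset => x; rewrite /E/= !in_itv/= => /andP[a b].
  rewrite (le_trans _ a) ?(le_trans b)// ler_expR ?lerN2 ler_nat//.
have ndF : nondecreasing_seq F.
  move=> m n mn; rewrite subsetEset => x; rewrite /F/= !in_itv/= => /andP[a b].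
  rewrite (le_trans _ a) ?(le_trans b)// ?lerN2 ler_nat//.
have H1 := @ge0_nondecreasing_set_cvg_integral _ (measurableTypeR R) R E (EFin \o G) mu ndE
  (fun i => measurable_itv _).
have H2 := @ge0_nondecreasing_set_cvg_integral _ (measurableTypeR R) R F
  (EFin \o (fun w => G (expR w) * expR w)) mu ndF (fun i => measurable_itv _).
rewrite -UE -UF.
pose S n := (\int[mu]_(x in E n) (G x)%:E)%E.
have H1' : S @ \oo --> (\int[mu]_(x in \bigcup_n E n) (G x)%:E)%E.
  apply: H1 => [i|i x _]; last by rewrite lee_fin.
  by apply/measurable_EFinP; apply: measurable_funS mG => //; exact: sE.
have H2' : S @ \oo --> (\int[mu]_(w in \bigcup_n F n) (G (expR w) * expR w)%:E)%E.
  rewrite (_ : S =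
    (fun n => \int[mu]_(x in F n) (G (expR x) * expR x)%:E)%E).
    apply: H2 => [i|i x _]; last by rewrite lee_fin mulr_ge0// expR_ge0.
    by apply/measurable_EFinP/measurable_funTS; exact: continuous_measurable_fun.
  apply/funext => n.
  have de : ((@expR R)^`())%classic = expR by apply/funext => x; rewrite derive1E; exact: derive_val.
  rewrite /S /E (@integration_by_substitution_increasing R expR G).
  + by rewrite de.
  + by rewrite lerNl (le_trans _ (ler0n _ _))// oppr_le0.
  + by move=> x y _ _; rewrite ltr_expR.
  + by rewrite de => x _; exact: continuous_expR.
  + by rewrite de; apply/cvg_ex; eexists; apply: cvg_at_right_filter; exact: continuous_expR.
  + by rewrite de; apply/cvg_ex; eexists; apply: cvg_at_left_filter; exact: continuous_expR.
  + split=> [x _||]; first exact: derivable_expR.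
      by apply: cvg_at_right_filter; exact: continuous_expR.
    by apply: cvg_at_left_filter; exact: continuous_expR.
  + apply: continuous_in_subspaceT => x; rewrite inE => /sE/=.
    by rewrite in_itv/= andbT; exact: cG.
by rewrite -(cvg_lim _ H1')// -(cvg_lim _ H2').
Qed.

Lemma Gamma_mixint (nu : R) : Gamma nu = fine (mixint nu 1 0).
Proof.
rewrite /Gamma /Rintegral integral_expR_subst.
- congr fine; apply: eq_integral => w _; congr EFin.
  rewrite /mixfun mul1r mul0r addr0 /powR gt_eqF ?expR_gt0// expRK.
  by rewrite -!expRD; congr expR; ring.
- by move=> x; rewrite mulr_ge0 ?powR_ge0 ?expR_ge0.
- move=> x x0; apply: cvgM.
    have : {for x, continuous (fun y : R => y `^ (nu - 1))}.
      apply/differentiable_continuous/derivable1_diffP.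
      by apply: derivable_powR; rewrite in_itv/= x0.
    exact.
  apply: (@continuous_comp R R R -%R expR); first exact: opp_continuous.
  exact: continuous_expR.
Qed.

(** Split cosh(nu t) into its two exponentials: one is the image of the other under t -> -t while
    cosh t is even, so the half-line integral unfolds to the whole line. *)
Lemma besselK_mixint (nu x : R) : 0 < nu -> 0 < x ->
  besselK nu x = fine (mixint nu (x / 2) (x / 2)) / 2.
Proof.
move=> nu0 x0; have x20 : 0 < x / 2 by rewrite divr_gt0.
pose h := mixfun nu (x / 2) (x / 2).
have mh D : measurable_fun D (EFin \o h).
  by apply/measurable_EFinP/measurable_funTS; exact: measurable_mixfun.
have mhN D : measurable_fun D (EFin \o (h \o -%R)).
  apply/measurable_EFinP/measurable_funTS; apply: measurableT_comp.
    exact: measurable_mixfun.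
  exact: oppr_measurable.
have h0 t : (0 <= (h t)%:E)%E by rewrite lee_fin ltW// mixfun_gt0.
rewrite /besselK /Rintegral.
have -> : (\int[mu]_(t in `]0%R, +oo[) (expR (- (x * coshR t)) * coshR (nu * t))%:E =
   (2^-1)%:E * mixint nu (x / 2) (x / 2))%E.
  transitivity (\int[mu]_(t in `]0%R, +oo[) ((2^-1)%:E * ((h t)%:E + (h (- t))%:E)))%E.
    apply: eq_integral => t _; rewrite -EFinD -EFinM; congr EFin.
    rewrite /h /mixfun opprK mulrN [x / 2 * expR (- t) + _]addrC -mulrDl.
    rewrite (_ : x * coshR t = x / 2 * expR t + x / 2 * expR (- t)); last first.
      by rewrite /coshR; field.
    by rewrite /coshR; field.
  rewrite ge0_integralZl//; last 2 first.
  - by apply: emeasurable_funD; [exact: mh|exact: mhN].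
  - by move=> t _; rewrite adde_ge0.
  congr (_ * _)%E; rewrite ge0_integralD//; last 2 first.
  - exact: mh.
  - exact: mhN.
  rewrite [X in (_ + X)%E]integral_itv_obnd_cbnd//.
  have := @ge0_integration_by_substitution0 R (EFin \o (h \o -%R)) (mhN _).
  move=> /(_ (fun r => h0 _)) /= ->.
  under [X in (_ + X)%E]eq_integral do rewrite opprK.
  rewrite addeC -ge0_integral_setU//; last 2 first.
  - exact: mh.
  - rewrite disj_set2E; apply/eqP; rewrite -subset0 => z/=.
    by rewrite !in_itv/= andbT => -[]; lra.
  rewrite (_ : `]-oo, 0] `|` `]0, +oo[ = setT)%classic//.
  apply/seteqP; split => // z _ /=; rewrite !in_itv/= andbT.
  by have [|] := leP z 0; [left|right].
rewrite fineM//; last by apply: mixint_fin_num => //; exact: ltW.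
by rewrite /= mulrC.
Qed.

(** With z = phi |s - t|, translating by ln(z / 2) turns the parameters (z/2, z/2) into (1, z^2/4),
    and the factor (z/2)^nu so produced cancels the normalization of [matern]. In the variable u =
    exp(w) this is a mixture of the kernels exp(-phi^2 |s - t|^2 / (4 u)), valid on the diagonal as
    well. *)
Lemma matern_mixint d (nu phi : R) (s t : 'rV[R]_d) : 0 < nu -> 0 < phi ->
  matern nu phi s t =
  fine (mixint nu 1 (phi ^+ 2 / 4 * \sum_(k < d) (s 0 k - t 0 k) ^+ 2)) /
  fine (mixint nu 1 0).
Proof.
move=> nu0 phi0.
have C0 : 0 < fine (mixint nu 1 0).
  by rewrite fine_gt0// mixint_gt0/= ltey_eq mixint_fin_num.
have S0 : 0 <= \sum_(k < d) (s 0 k - t 0 k) ^+ 2.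
  by apply: sumr_ge0 => k _; rewrite sqr_ge0.
rewrite /matern; case: eqVneq => [->|st].
  rewrite big1 ?mulr0 ?divff ?gt_eqF// => k _.
  by rewrite subrr expr0n.
have d0 : 0 < dist s t.
  rewrite sqrtr_gt0 lt_neqAle S0 andbT eq_sym; apply: contra st => /eqP H.
  apply/eqP/rowP => k; apply/eqP; rewrite -subr_eq0 -sqrf_eq0.
  have := psumr_eq0P (fun i _ => sqr_ge0 (s 0 i - t 0 i)) H.
  by move=> ->.
have z0 : 0 < phi * dist s t by rewrite mulr_gt0.
have z2 : 0 < phi * dist s t / 2 by rewrite divr_gt0.
set z := phi * dist s t in z0 z2 *.
have zE : phi ^+ 2 / 4 * \sum_(k < d) (s 0 k - t 0 k) ^+ 2 = z ^+ 2 / 4.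
  by rewrite /z exprMn /dist sqr_sqrtr//; field.
rewrite besselK_mixint// zE Gamma_mixint.
clearbody z; clear zE.
have e2 : expR (ln (z / 2)) = z / 2 by rewrite lnK.
have -> : mixint nu (z / 2) (z / 2) =
   mixint nu (1 * expR (ln (z / 2))) (z ^+ 2 / 4 * expR (- ln (z / 2))).
  rewrite expRN e2 mul1r (_ : z ^+ 2 / 4 * (z / 2)^-1 = z / 2)//.
  by field; rewrite gt_eqF.
rewrite mixint_scale fineM//; last first.
  by apply: mixint_fin_num => //; rewrite divr_ge0// sqr_ge0.
rewrite /= expRN (_ : expR (nu * ln (z / 2)) = (z / 2) `^ nu); last first.
  by rewrite /powR gt_eqF.
have zz : z `^ nu = (z / 2) `^ nu * 2 `^ nu.
  by rewrite -powRM ?ltW// divfK.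
rewrite zz powRB ?pnatr_eq0 ?implybT// powRr1//.
have P1 : (z / 2) `^ nu != 0 by rewrite gt_eqF// powR_gt0.
have P2 : (2 : R) `^ nu != 0 by rewrite gt_eqF// powR_gt0.
by field; rewrite P1 P2 gt_eqF.
Qed.

End matern_mixture.

(** * Positivity, comparison and continuity at distance zero of the Matern kernel *)

Section matern_kernel.
Context {R : realType}.
Notation mu := (@lebesgue_measure R).

Lemma mixfun_expR (nu p q w : R) :
  mixfun nu p q w = expR (nu * w) * expR (- (p * expR w)) * expR (- (expR (- w) * q)).
Proof. by rewrite /mixfun -!expRD; congr expR; ring. Qed.

Lemma mixint0_gt0 (nu : R) : 0 < nu -> 0 < fine (mixint nu 1 0).
Proof. by move=> nu0; rewrite fine_gt0// mixint_gt0/= ltey_eq mixint_fin_num. Qed.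

Lemma quadform_mixint n (nu p : R) (q : 'I_n -> 'I_n -> R) a :
  0 < nu -> 0 < p -> (forall i j, 0 <= q i j) ->
  mu.-integrable setT (EFin \o (fun w => quadform (fun i j => mixfun nu p (q i j) w) a)) /\
  quadform (fun i j => fine (mixint nu p (q i j))) a =
  \int[mu]_w (quadform (fun i j => mixfun nu p (q i j) w) a).
Proof.
move=> nu0 p0 q0; have := @Rintegral_quadform R n (fun i j => mixfun nu p (q i j))
  (fun i j => a i * a j).
by apply => i j; exact: integrable_mixfun.
Qed.

Definition sqdist d (s t : 'rV[R]_d) : R := \sum_(k < d) (s 0 k - t 0 k) ^+ 2.

Lemma sqdist_ge0 d (s t : 'rV[R]_d) : 0 <= sqdist s t.
Proof. by apply: sumr_ge0 => k _; rewrite sqr_ge0. Qed.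

Lemma quadform_mixfun n d (nu p c w : R) (s : 'I_n -> 'rV[R]_d) a :
  quadform (fun i j => mixfun nu p (c * sqdist (s i) (s j)) w) a =
  expR (nu * w) * expR (- (p * expR w)) *
  quadform (fun i j => expR (- (expR (- w) * c * sqdist (s i) (s j)))) a.
Proof.
by rewrite -quadformZ; apply: eq_quadform => i j; rewrite mixfun_expR mulrA.
Qed.

Lemma matern_psd n d (nu phi : R) (s : 'I_n -> 'rV[R]_d) : 0 < nu -> 0 < phi ->
  psd (fun i j => matern nu phi (s i) (s j)).
Proof.
move=> nu0 phi0 a; have C0 := mixint0_gt0 nu0.
have c0 : 0 < phi ^+ 2 / 4 by rewrite divr_gt0// exprn_gt0.
rewrite (@eq_quadform R n _ (fun i j => (fine (mixint nu 1 0))^-1 *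
  fine (mixint nu 1 (phi ^+ 2 / 4 * sqdist (s i) (s j))))); last first.
  by move=> i j; rewrite matern_mixint// mulrC.
rewrite quadformZ mulr_ge0 ?invr_ge0 ?(ltW C0)//.
have [_ ->] := @quadform_mixint n nu 1 (fun i j => phi ^+ 2 / 4 * sqdist (s i) (s j)) a
  nu0 ltr01 (fun i j => mulr_ge0 (ltW c0) (sqdist_ge0 _ _)).
apply: Rintegral_ge0 => w _; rewrite quadform_mixfun.
rewrite mulr_ge0// ?mulr_ge0 ?expR_ge0//.
have e0 : 0 < expR (- w) * (phi ^+ 2 / 4) by rewrite mulr_gt0 ?expR_gt0.
exact: (gauss_kernel_seq (index_enum 'I_d) (fun i k => s i 0 k) e0 (lexx _)).1.
Qed.

(* For [phi0 <= phi], compare the Gaussian components at equal mixing variable;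
   for [phi <= phi0], rescale the mixing variable by [phi ^+ 2] first, so that
   the components agree and only the mixing densities differ. *)
Lemma matern_le n d (nu phi0 phi : R) (s : 'I_n -> 'rV[R]_d) a :
  0 < nu -> 0 < phi0 -> 0 < phi ->
  quadform (fun i j => matern nu phi0 (s i) (s j)) a <=
  ((phi / phi0) ^+ d + (phi0 / phi) `^ (2 * nu)) *
  quadform (fun i j => matern nu phi (s i) (s j)) a.
Proof.
move=> nu0 p00 p0; have C0 := mixint0_gt0 nu0.
have P0 := @matern_psd n d nu phi s nu0 p0 a.
have K1 : 0 <= (phi / phi0) ^+ d by rewrite exprn_ge0// divr_ge0 ?ltW.
have K2 : 0 <= (phi0 / phi) `^ (2 * nu) by rewrite powR_ge0.
have c0 f : 0 < f -> 0 < f ^+ 2 / 4 :> R by move=> f0; rewrite divr_gt0// exprn_gt0.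
have E f : 0 < f -> quadform (fun i j => matern nu f (s i) (s j)) a =
   (fine (mixint nu 1 0))^-1 * quadform (fun i j =>
     fine (mixint nu 1 (f ^+ 2 / 4 * sqdist (s i) (s j)))) a.
  move=> f0; rewrite -quadformZ; apply: eq_quadform => i j.
  by rewrite matern_mixint// mulrC.
(* Each of the two orders of [phi0] and [phi] uses one summand of the constant; the other multiplies
   a nonnegative form and is dropped. *)
rewrite mulrDl.
have [le|/ltW le] := leP phi0 phi.
  apply: (@le_trans _ _ ((phi / phi0) ^+ d *
    quadform (fun i j => matern nu phi (s i) (s j)) a)); last first.
    by rewrite lerDl mulr_ge0.
  rewrite (E _ p00) (E _ p0) [leRHS]mulrCA ler_wpM2l ?invr_ge0 ?(ltW C0)//.
  have [i1 ->] := @quadform_mixint n nu 1 (fun i j => phi0 ^+ 2 / 4 * sqdist (s i) (s j)) a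
    nu0 ltr01 (fun i j => mulr_ge0 (ltW (c0 _ p00)) (sqdist_ge0 _ _)).
  have [i2 ->] := @quadform_mixint n nu 1 (fun i j => phi ^+ 2 / 4 * sqdist (s i) (s j)) a
    nu0 ltr01 (fun i j => mulr_ge0 (ltW (c0 _ p0)) (sqdist_ge0 _ _)).
  rewrite -RintegralZl//; apply: le_Rintegral => //; first exact: integrable_Rmul.
  move=> w _; rewrite !quadform_mixfun [leRHS]mulrCA ler_wpM2l ?mulr_ge0 ?expR_ge0//.
  have e0 : 0 < expR (- w) * (phi0 ^+ 2 / 4) by rewrite mulr_gt0 ?expR_gt0 ?c0.
  have ee : expR (- w) * (phi0 ^+ 2 / 4) <= expR (- w) * (phi ^+ 2 / 4).
    by rewrite ler_wpM2l ?expR_ge0// ler_wpM2r// ler_sqr// nnegrE ltW.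
  have := (gauss_kernel_seq (index_enum 'I_d) (fun i k => s i 0 k) e0 ee).2 a.
  rewrite (_ : size _ = d); last by rewrite -[RHS]card_ord cardT enumT.
  rewrite (_ : expR (- w) * (phi ^+ 2 / 4) / (expR (- w) * (phi0 ^+ 2 / 4)) =
    (phi / phi0) ^+ 2); last first.
    by field; rewrite !gt_eqF ?expR_gt0.
  by rewrite sqrtr_sqr ger0_norm// divr_ge0 ?ltW.
apply: (@le_trans _ _ ((phi0 / phi) `^ (2 * nu) *
  quadform (fun i j => matern nu phi (s i) (s j)) a)); last first.
  by rewrite lerDr mulr_ge0.
(* Translating by - ln(f^2) removes [f] from the Gaussian rate and puts it into the mixing density
   exp(-f^2 u), at the price of the factor f^(2 nu). *)
have resc f i j : 0 < f ->
   fine (mixint nu 1 (f ^+ 2 / 4 * sqdist (s i) (s j))) =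
   f `^ (2 * nu) * fine (mixint nu (f ^+ 2) (4^-1 * sqdist (s i) (s j))).
  move=> f0.
  have eE : expR (ln (f ^+ 2)) = f ^+ 2 by rewrite lnK// posrE exprn_gt0.
  have := @mixint_scale R nu (f ^+ 2) (4^-1 * sqdist (s i) (s j)) (- ln (f ^+ 2)).
  rewrite opprK expRN eE divff ?gt_eqF ?exprn_gt0//.
  rewrite (_ : 4^-1 * sqdist (s i) (s j) * f ^+ 2 = f ^+ 2 / 4 * sqdist (s i) (s j)); last by ring.
  move=> ->; rewrite fineM//; last first.
    by apply: mixint_fin_num; rewrite ?exprn_gt0// mulr_ge0 ?sqdist_ge0.
  rewrite mulrN opprK /= /powR gt_eqF//; congr (expR _ * _).
  by rewrite lnXn// -mulr_natr; ring.
have E' f : 0 < f -> quadform (fun i j => matern nu f (s i) (s j)) a =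
   (fine (mixint nu 1 0))^-1 * (f `^ (2 * nu) * quadform (fun i j =>
     fine (mixint nu (f ^+ 2) (4^-1 * sqdist (s i) (s j)))) a).
  move=> f0; rewrite E//; congr (_ * _); rewrite -quadformZ.
  by apply: eq_quadform => i j; rewrite resc.
rewrite (E' _ p00) (E' _ p0) [leRHS]mulrCA ler_wpM2l ?invr_ge0 ?(ltW C0)//.
rewrite mulrA -powRM; [|exact: divr_ge0 (ltW p00) (ltW p0)|exact: ltW].
rewrite divfK ?gt_eqF// ler_wpM2l ?powR_ge0//.
have f40 i j : 0 <= 4^-1 * sqdist (s i) (s j) by rewrite mulr_ge0 ?sqdist_ge0.
have [i1 ->] := @quadform_mixint n nu (phi0 ^+ 2) _ a nu0 (exprn_gt0 2 p00) f40.
have [i2 ->] := @quadform_mixint n nu (phi ^+ 2) _ a nu0 (exprn_gt0 2 p0) f40.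
apply: le_Rintegral => // w _; rewrite !quadform_mixfun.
have e0 : 0 < expR (- w) * 4^-1 :> R by rewrite mulr_gt0 ?expR_gt0.
rewrite ler_wpM2r//.
  exact: (gauss_kernel_seq (index_enum 'I_d) (fun i k => s i 0 k) e0 (lexx _)).1.
rewrite ler_wpM2l ?expR_ge0// ler_expR lerN2 ler_wpM2r ?expR_ge0//.
by rewrite ler_sqr// nnegrE ltW.
Qed.

(** [mixint nu 1 q] decreases in [q], so a single small [q] with value close to that at 0 is enough;
    dominated convergence along q = 1/(n+1) provides it. *)
Lemma matern_near1 d (nu phi e : R) : 0 < nu -> 0 < phi -> 0 < e ->
  exists2 r : R, 0 < r & forall s t : 'rV[R]_d, sqdist s t <= r ->
    1 - e <= matern nu phi s t.
Proof.
move=> nu0 p0 e0; have C0 := mixint0_gt0 nu0.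
have im := integrable_mixfun nu0 ltr01 (lexx (0 : R)).
have H : fine (mixint nu 1 (n.+1%:R^-1)) @[n --> \oo] --> fine (mixint nu 1 0).
  apply: fine_cvg; rewrite fineK ?mixint_fin_num//.
  apply: (@dominated_cvg _ (measurableTypeR R) R mu setT measurableT
    (fun n => EFin \o mixfun nu 1 n.+1%:R^-1) _ (EFin \o mixfun nu 1 0)) => //.
  - by move=> n; apply/measurable_EFinP; exact: measurable_mixfun.
  - move=> w _; apply: cvg_EFin; first exact: nearW.
    apply: cvgM; first exact: cvg_cst.
    apply: (@cvg_comp _ _ _ _ expR _ (nbhs (- (1 * expR w + 0 * expR (- w)))));
      last exact: continuous_expR.
    apply: cvgN; apply: cvgD; first exact: cvg_cst.
    by apply: cvgM; [exact: cvg_harmonic|exact: cvg_cst].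
  - move=> n w _; rewrite /= lee_fin gtr0_norm ?mixfun_gt0//.
    rewrite ler_wpM2l ?expR_ge0// ler_expR lerN2 lerD2l mul0r.
    by rewrite mulr_ge0 ?expR_ge0.
have : \forall n \near \oo, fine (mixint nu 1 0) * (1 - e) <= fine (mixint nu 1 (n.+1%:R^-1)).
  apply: (cvgr_ge (fine (mixint nu 1 0))) => //.
  by rewrite gtr_pMr// gtrBl.
move=> [N _ /(_ N (leqnn N))] HN.
(* The squared distance at which phi^2 / 4 times it equals 1/(N+1). *)
exists (4 / phi ^+ 2 * N.+1%:R^-1).
  by rewrite mulr_gt0 ?divr_gt0 ?exprn_gt0.
move=> s t st; rewrite matern_mixint// ler_pdivlMr; last exact: C0.
rewrite [(1 - e) * _]mulrC; apply: (le_trans HN).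
have q0 : 0 <= phi ^+ 2 / 4 * sqdist s t by rewrite mulr_ge0 ?divr_ge0 ?sqr_ge0 ?sqdist_ge0.
apply: le_Rintegral => //; [apply: integrable_mixfun => //|exact: integrable_mixfun|].
move=> w _; rewrite ler_wpM2l ?expR_ge0// ler_expR lerN2 lerD2l.
rewrite ler_wpM2r ?expR_ge0//.
apply: le_trans (_ : phi ^+ 2 / 4 * (4 / phi ^+ 2 * N.+1%:R^-1) <= _).
  by rewrite ler_wpM2l// divr_ge0 ?sqr_ge0.
rewrite le_eqVlt; apply/orP; left; apply/eqP; field.
by rewrite andbC gt_eqF//= gt_eqF// ltr_pwDl.
Qed.

End matern_kernel.

(** * Spectral theorem and ridge inverses *)

Section linear_algebra.
Context {R : realType}.

(** Over the complex numbers [S] is Hermitian, hence unitarily diagonalizable with real spectrum; a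
    real root of the complexified characteristic polynomial is a root of the original one. *)
Lemma symmetric_eigenvalue n (S : 'M[R]_n.+1) : S^T = S ->
  exists mu : R, eigenvalue S mu.
Proof.
move=> symS.
pose A := map_mx (real_complex R) S.
have symA : A \is hermsymmx.
  apply/is_hermitianmxP; rewrite expr0 scale1r; apply/matrixP => i j.
  rewrite !mxE -[in LHS]symS mxE; apply/esym/conj_Creal/complex_realP.
  by exists (S j i).
have dr := hermitian_spectral_diag_real symA.
have := hermitian_normalmx symA => /orthomx_spectralP eqA.
set P := spectralmx A in eqA; set D := spectral_diag A in eqA dr.
have uP : P \in unitmx by exact: spectral_unit.
have eA : eigenvalue A (D 0 0).
  apply/eigenvalueP; exists (row 0 P).
    rewrite eqA -row_mul mulmxA mulmxA mulmxV// mul1mx.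
    by rewrite row_mul row_diag_mx -scalemxAl -rowE.
  apply/eqP => r0; move: uP; rewrite -row_free_unit => /row_freeP[Q PQ].
  have := congr1 (row 0) PQ; rewrite row_mul r0 mul0mx => /rowP/(_ 0).
  by rewrite !mxE eqxx => /eqP; rewrite eq_sym oner_eq0.
have Dr : D 0 0 \is Num.real by move/mxOverP: dr; apply.
have [mu Dmu] : exists mu : R, D 0 0 = (real_complex R) mu.
  by move/complex_realP: Dr => [k ->]; exists k.
exists mu; move: eA; rewrite Dmu !eigenvalue_root_char.
by rewrite /A -map_char_poly fmorph_root.
Qed.


Definition orthogonal n (U : 'M[R]_n) := U *m U^T = 1%:M /\ U^T *m U = 1%:M.

Definition normsq n (v : 'rV[R]_n) : R := (v *m v^T) 0 0.

Lemma normsqE n (v : 'rV[R]_n) : normsq v = \sum_i v 0 i ^+ 2.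
Proof. by rewrite /normsq mxE; apply: eq_bigr => i _; rewrite mxE expr2. Qed.

Lemma normsq_gt0 n (v : 'rV[R]_n) : v != 0 -> 0 < normsq v.
Proof.
move=> v0; rewrite normsqE lt_neqAle sumr_ge0 ?andbT; last by move=> i _; rewrite sqr_ge0.
rewrite eq_sym; apply: contra v0 => /eqP H; apply/eqP/rowP => i; rewrite mxE.
apply/eqP; rewrite -sqrf_eq0.
by rewrite (psumr_eq0P (fun i _ => sqr_ge0 (v 0 i)) H).
Qed.

(* Householder reflection exchanging e_0 and v. *)
Lemma reflection_exists n (v : 'rV[R]_n.+1) : normsq v = 1 ->
  exists H : 'M[R]_n.+1, [/\ H^T = H, H *m H = 1%:M & delta_mx 0 0 *m H = v].
Proof.
move=> v1; pose e : 'rV[R]_n.+1 := delta_mx 0 0; pose w := v - e.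
have [w0|w0] := eqVneq w 0.
  exists 1%:M; rewrite trmx1 mulmx1; split=> //.
  by rewrite mulmx1; apply/eqP; rewrite eq_sym -subr_eq0; exact/eqP.
have N0 := normsq_gt0 w0; set N := normsq w in N0.
have wwE : w *m w^T = N%:M by rewrite [LHS]mx11_scalar.
pose H := 1%:M - (2 / N) *: (w^T *m w).
have HT : H^T = H.
  by rewrite /H linearB/= trmx1 linearZ/= trmx_mul trmxK.
have ww2 : w^T *m w *m (w^T *m w) = N *: (w^T *m w).
  by rewrite mulmxA -(mulmxA w^T) wwE mul_mx_scalar -scalemxAl.
exists H; split=> //.
  have inv (G : 'M[R]_n.+1) : G *m G = N *: G ->
      (1%:M - (2 / N) *: G) *m (1%:M - (2 / N) *: G) = 1%:M.
    move=> GG; rewrite mulmxBl mul1mx mulmxBr mulmx1 -scalemxAl -scalemxAr GG.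
    apply/matrixP => i j; rewrite !mxE; field.
    by rewrite gt_eqF.
  exact: inv.
have ev : (e *m v^T) 0 0 = v 0 0.
  by rewrite -rowE !mxE.
have ve : (v *m e^T) 0 0 = v 0 0.
  by rewrite -[v *m _]trmxK trmx_mul trmxK mxE ev.
have ee : (e *m e^T) 0 0 = 1.
  by rewrite -rowE !mxE !eqxx.
have NE : N = 2 - 2 * v 0 0.
  rewrite /N /normsq /w linearB/= mulmxBr !mulmxBl.
  move: v1; rewrite /normsq => v1.
  have mxB (A B : 'M[R]_1) : (A - B) 0 0 = A 0 0 - B 0 0 by rewrite !mxE.
  by rewrite !mxB v1 ve ev ee; ring.
have ew : e *m w^T = (- (N / 2))%:M.
  rewrite [LHS]mx11_scalar; congr _%:M; rewrite /w linearB/= mulmxBr.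
  by rewrite mxE ev [X in _ + X]mxE ee NE; field.
rewrite -/e /H mulmxBr mulmx1 -scalemxAr mulmxA ew mul_scalar_mx scalerA.
rewrite (_ : 2 / N * - (N / 2) = -1); last by field; rewrite gt_eqF.
by rewrite scaleN1r opprK /w addrC subrK.
Qed.

(** Deflation: conjugating by the reflection that exchanges e_0 and a unit eigenvector makes the
    first row [mu] times e_0, hence by symmetry the matrix block diagonal, and the lower block goes
    to the induction hypothesis. *)
Lemma symmetric_spectral n (S : 'M[R]_n) : S^T = S ->
  exists (U : 'M[R]_n) (m : 'rV[R]_n), orthogonal U /\ S = U *m diag_mx m *m U^T.
Proof.
elim: n S => [|n IH] S symS.
  exists 1%:M, 0; split; last by apply/matrixP => -[].
  by split; apply/matrixP => -[].
have [mu /eigenvalueP[v0 v0S v00]] := symmetric_eigenvalue symS.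
have N0 := normsq_gt0 v00.
pose v := (Num.sqrt (normsq v0))^-1 *: v0.
have vS : v *m S = mu *: v by rewrite /v -scalemxAl v0S !scalerA mulrC.
have v1 : normsq v = 1.
  rewrite normsqE; under eq_bigr do rewrite mxE exprMn.
  rewrite -mulr_sumr -normsqE exprVn sqr_sqrtr ?ltW//.
  by rewrite mulVf// gt_eqF.
have [H [HT HH eH]] := reflection_exists v1.
pose e : 'rV[R]_n.+1 := delta_mx 0 0.
have [S' S'def] : exists S' : 'M[R]_(1 + n), S' = H *m S *m H by exists (H *m S *m H).
have S'T : S'^T = S' by rewrite S'def !trmx_mul HT symS mulmxA.
have vH : v *m H = e by rewrite -eH -mulmxA HH mulmx1.
have eS' : e *m S' = mu *: e.
  by rewrite S'def !mulmxA eH vS -scalemxAl vH.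
have row0 j : S' 0 j = mu * (j == 0)%:R.
  have /rowP/(_ j) := eS'; rewrite -rowE !mxE eqxx/= => ->.
  by rewrite eq_sym.
pose S2 := @drsubmx R 1 n 1 n S'.
have S2T : S2^T = S2.
  by apply/matrixP => i j; rewrite !mxE -[in LHS]S'T mxE.
have S'E : S' = block_mx mu%:M 0 0 S2.
  rewrite -[LHS](@submxK R 1 n 1 n); congr block_mx.
  - apply/matrixP => i j; rewrite !ord1 !mxE.
    by rewrite (_ : lshift n 0 = 0) ?row0 ?eqxx ?mulr1//; exact/val_inj.
  - apply/matrixP => i j; rewrite !ord1 !mxE.
    by rewrite (_ : lshift n 0 = 0) ?row0 ?mulr0//; exact/val_inj.
  - apply/matrixP => i j; rewrite !ord1 !mxE -S'T mxE.
    by rewrite (_ : lshift n 0 = 0) ?row0 ?mulr0//; exact/val_inj.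
have [U2 [m2 [[U2a U2b] S2E]]] := IH S2 S2T.
pose B : 'M[R]_(1 + n) := block_mx 1%:M 0 0 U2.
have BT : B^T = block_mx 1%:M 0 0 U2^T by rewrite /B tr_block_mx !trmx0 trmx1.
have BB : B *m B^T = 1%:M.
  rewrite BT /B mulmx_block !mul0mx !mulmx0 !addr0 !add0r mulmx1 U2a.
  by rewrite -scalar_mx_block.
have BB' : B^T *m B = 1%:M.
  rewrite BT /B mulmx_block !mul0mx !mulmx0 !addr0 !add0r mulmx1 U2b.
  by rewrite -scalar_mx_block.
pose m : 'rV[R]_(1 + n) := row_mx mu%:M m2.
have S'B : S' = B *m diag_mx m *m B^T.
  rewrite S'E BT /B /m diag_mx_row mulmx_block !mul0mx !mulmx0 !addr0 !add0r.
  rewrite mulmx_block !mul0mx !mulmx0 !addr0 !add0r mulmx1 mul1mx -S2E.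
  congr block_mx; apply/matrixP => i j; rewrite !ord1 !mxE.
  by rewrite !eqxx.
exists (H *m B), m; split.
  split; rewrite trmx_mul HT.
    by rewrite mulmxA -(mulmxA H B) BB mulmx1 HH.
  by rewrite mulmxA -(mulmxA _ H H) HH mulmx1 BB'.
rewrite trmx_mul HT !mulmxA -(mulmxA H B) -(mulmxA H _ B^T) -S'B S'def.
by rewrite !mulmxA HH mul1mx -mulmxA HH mulmx1.
Qed.

Lemma quadform_mx n (S : 'M[R]_n) (x : 'cV[R]_n) :
  (x^T *m S *m x) 0 0 = quadform (fun i j => S i j) (fun i => x i 0).
Proof.
rewrite /quadform mxE exchange_big/=; apply: eq_bigr => j _.
rewrite mxE mulr_suml; apply: eq_bigr => i _; rewrite mxE; ring.
Qed.

Section diagonalized.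
Variables (n : nat) (U : 'M[R]_n) (m : 'rV[R]_n).
Hypothesis oU : orthogonal U.

Lemma diagonalized_quad (x : 'cV[R]_n) :
  (x^T *m (U *m diag_mx m *m U^T) *m x) 0 0 = \sum_i m 0 i * (U^T *m x) i 0 ^+ 2.
Proof.
rewrite !mulmxA -(mulmxA _ U^T x) -(trmxK U) -trmx_mul trmxK.
set z := U^T *m x; rewrite mxE; apply: eq_bigr => i _.
by rewrite mul_mx_diag !mxE; ring.
Qed.

Lemma orthogonal_normsq (x : 'cV[R]_n) :
  \sum_i (U^T *m x) i 0 ^+ 2 = \sum_i x i 0 ^+ 2.
Proof.
have sq (z : 'cV[R]_n) : \sum_i z i 0 ^+ 2 = (z^T *m z) 0 0.
  by rewrite mxE; apply: eq_bigr => i _; rewrite mxE expr2.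
by rewrite !sq trmx_mul trmxK mulmxA -(mulmxA x^T) oU.1 mulmx1.
Qed.

Lemma diagonalizedD (k : R) :
  U *m diag_mx m *m U^T + k%:M = U *m diag_mx (m + const_mx k) *m U^T.
Proof.
rewrite linearD/= mulmxDr mulmxDl; congr (_ + _).
by rewrite diag_const_mx mul_mx_scalar -scalemxAl oU.1 scalemx1.
Qed.

Lemma diagonalized_inv : (forall i, m 0 i != 0) ->
  (U *m diag_mx m *m U^T) \in unitmx /\
  invmx (U *m diag_mx m *m U^T) = U *m diag_mx (\row_i (m 0 i)^-1) *m U^T.
Proof.
move=> m0; set A := U *m diag_mx m *m U^T; set B := U *m diag_mx _ *m U^T.
have AB : A *m B = 1%:M.
  rewrite /A /B !mulmxA -(mulmxA _ U^T U) oU.2 mulmx1 -(mulmxA U).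
  rewrite mulmx_diag (_ : \row_j _ = const_mx 1) ?diag_const_mx ?mulmx1 ?oU.1//.
  by apply/rowP => i; rewrite !mxE divff.
have [uA uB] := mulmx1_unit AB.
by split=> //; rewrite -[LHS]mulmx1 -AB mulKmx.
Qed.

Lemma diagonalized_psd_ge0 i :
  psd (fun i j => (U *m diag_mx m *m U^T) i j) -> 0 <= m 0 i.
Proof.
pose x : 'cV[R]_n := U *m delta_mx i 0.
move=> pS; have := pS (fun k => x k 0).
rewrite -quadform_mx diagonalized_quad mulmxA oU.2 mul1mx.
rewrite (bigD1 i)//= big1 ?mxE ?eqxx ?expr1n ?mulr1 ?addr0// => j ji.
by rewrite mxE (negbTE ji) expr0n mulr0.
Qed.

End diagonalized.

Lemma inv_shift_quad n (U : 'M[R]_n) (m : 'rV[R]_n) (k : R) (x : 'cV[R]_n) :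
  orthogonal U -> 0 < k -> (forall i, 0 <= m 0 i) ->
  let V := U *m diag_mx m *m U^T + k%:M in
  V \in unitmx /\
  (x^T *m invmx V *m x) 0 0 = \sum_i (U^T *m x) i 0 ^+ 2 / (m 0 i + k).
Proof.
move=> oU k0 m0 V; rewrite /V diagonalizedD//.
have [|uV ->] := @diagonalized_inv n U (m + const_mx k) oU.
  by move=> i; rewrite !mxE gt_eqF// ltr_wpDl.
split=> //; rewrite diagonalized_quad; apply: eq_bigr => i _.
by rewrite !mxE mulrC.
Qed.

Lemma bilinear_sub n (M : 'M[R]_n) (b q : 'cV[R]_n) (C : R) :
  ((C *: b - q)^T *m M *m (C *: b - q)) 0 0 =
  C ^+ 2 * (b^T *m M *m b) 0 0 - C * (b^T *m M *m q) 0 0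
  - C * (q^T *m M *m b) 0 0 + (q^T *m M *m q) 0 0.
Proof.
have mxB (A B : 'M[R]_1) : (A - B) 0 0 = A 0 0 - B 0 0 by rewrite !mxE.
have mxZ (A : 'M[R]_1) : (C *: A) 0 0 = C * A 0 0 by rewrite !mxE.
have -> : (C *: b - q)^T = C *: b^T - q^T by apply/matrixP => i j; rewrite !mxE.
by rewrite !(mulmxBl, mulmxBr) -!(scalemxAl, scalemxAr) !(mxB, mxZ); ring.
Qed.

(* Completing the square: [x^T V^-1 x = max_p (2 p.x - p^T V p)]. *)
Lemma inv_shift_antitone n (S0 S : 'M[R]_n) (C k : R) (x : 'cV[R]_n) :
  S0^T = S0 -> S^T = S ->
  psd (fun i j => S0 i j) -> psd (fun i j => S i j) -> 0 < C -> 0 < k ->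
  (forall a, quadform (fun i j => S0 i j) a <= C * quadform (fun i j => S i j) a) ->
  (x^T *m invmx (S + k%:M) *m x) 0 0 <=
  C * (x^T *m invmx (S0 + (C * k)%:M) *m x) 0 0.
Proof.
move=> sS0 sS p0 p C0 k0 le.
have [U0 [m0 [oU0 E0]]] := symmetric_spectral sS0.
have [U [m [oU E]]] := symmetric_spectral sS.
have m0_ge0 i : 0 <= m0 0 i.
  by apply: (diagonalized_psd_ge0 oU0); rewrite -E0.
have m_ge0 i : 0 <= m 0 i by apply: (diagonalized_psd_ge0 oU); rewrite -E.
have Ck0 : 0 < C * k by rewrite mulr_gt0.
have [uV _] := inv_shift_quad 0 oU k0 m_ge0; rewrite -E in uV.
have [uB _] := inv_shift_quad 0 oU0 Ck0 m0_ge0; rewrite -E0 in uB.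
set V := S + k%:M in uV *; set B := S0 + (C * k)%:M in uB *.
have VT : V^T = V by rewrite /V linearD/= sS tr_scalar_mx.
have BT : B^T = B by rewrite /B linearD/= sS0 tr_scalar_mx.
have qk (l : R) (z : 'cV[R]_n) : (z^T *m l%:M *m z) 0 0 = l * (z^T *m z) 0 0.
  by rewrite mul_mx_scalar -scalemxAl mxE.
have BV (z : 'cV[R]_n) : (z^T *m B *m z) 0 0 <= C * (z^T *m V *m z) 0 0.
  rewrite /B /V !mulmxDr !mulmxDl [X in X <= _]mxE [X in _ <= _ * X]mxE !qk.
  by rewrite mulrDr mulrA lerD2r !quadform_mx le.
have B0 (z : 'cV[R]_n) : 0 <= (z^T *m B *m z) 0 0.
  rewrite /B mulmxDr mulmxDl mxE qk addr_ge0//.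
    by rewrite quadform_mx; exact: p0.
  rewrite mulr_ge0 ?(ltW Ck0)// mxE sumr_ge0// => i _; rewrite mxE -expr2.
  exact: sqr_ge0.
have [q xq] : exists q, x = V *m q by exists (invmx V *m x); rewrite mulKVmx.
have [b xb] : exists b, x = B *m b by exists (invmx B *m x); rewrite mulKVmx.
have -> : (x^T *m invmx V *m x) 0 0 = (q^T *m V *m q) 0 0.
  by rewrite xq trmx_mul VT -mulmxA mulKmx.
have -> : (x^T *m invmx B *m x) 0 0 = (b^T *m B *m b) 0 0.
  by rewrite xb trmx_mul BT -mulmxA mulKmx.
have cross : (b^T *m B *m q) 0 0 = (q^T *m V *m q) 0 0.
  by rewrite -[in LHS]BT -trmx_mul -xb [in LHS]xq trmx_mul VT.
have cross' : (q^T *m B *m b) 0 0 = (q^T *m V *m q) 0 0.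
  have tr00 (A : 'M[R]_1) : A 0 0 = A^T 0 0 by rewrite mxE.
  by rewrite -cross [LHS]tr00 !trmx_mul trmxK BT mulmxA.
(* In the notation set below, this positivity reads C^2 t - 2 C u + r >= 0, and [BV] gives r <= C u;
   dividing by [C] leaves u <= C t. *)
have := B0 (C *: b - q).
have -> : ((C *: b - q)^T *m B *m (C *: b - q)) 0 0 =
    C ^+ 2 * (b^T *m B *m b) 0 0 - 2 * C * (q^T *m V *m q) 0 0 + (q^T *m B *m q) 0 0.
  by rewrite bilinear_sub cross cross'; ring.
have := BV q; set u := (q^T *m V *m q) 0 0; set t := (b^T *m B *m b) 0 0.
set r := (q^T *m B *m q) 0 0 => ru H.
by rewrite -(ler_pM2l C0); lra.
Qed.

(** Let [Pi] be the projection that averages over cells, of rank at most [N]. It captures at least n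
    (1 - w) of the trace n of [S]. If p_i in [0, 1] are the diagonal entries of [Pi] in the
    eigenbasis, then m_i / (m_i + k) <= p_i + m_i (1 - p_i) / k, and the two sums are at most N and
    n w / k. *)
Lemma cell_trace_bound n N (S U : 'M[R]_n) (m : 'rV[R]_n) (c : 'I_n -> 'I_N)
    (w k : R) :
  orthogonal U -> S = U *m diag_mx m *m U^T -> (forall i, 0 <= m 0 i) -> 0 < k ->
  (forall i, S i i = 1) -> (forall i j, c i = c j -> 1 - w <= S i j) ->
  \sum_i m 0 i / (m 0 i + k) <= N%:R + n%:R * w / k.
Proof.
move=> oU SE m0 k0 S1 Sw.
pose z i : R := #|[pred j | c j == c i]|%:R.
have z0 i : 0 < z i.
  by rewrite ltr0n; apply/card_gt0P; exists i; rewrite inE.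
pose Pi : 'M[R]_n := \matrix_(i, j) ((c j == c i)%:R / z i).
have zc i j : c j = c i -> z j = z i by rewrite /z => ->.
have PiT : Pi^T = Pi.
  apply/matrixP => i j; rewrite !mxE eq_sym.
  by case: eqP => [/zc->|]; rewrite ?mul0r.
have sumz i : \sum_j (c j == c i)%:R = z i.
  by rewrite /z -sum1_card natr_sum [RHS]big_mkcond/=; apply: eq_bigr => j _; rewrite inE; case: ifP.
have rowPi i : \sum_j Pi i j = 1.
  under eq_bigr do rewrite mxE.
  by rewrite -mulr_suml sumz divff// gt_eqF.
have PiPi : Pi *m Pi = Pi.
  apply/matrixP => i j; rewrite mxE.
  rewrite (eq_bigr (fun l => Pi i l * Pi i j)).
    by rewrite -mulr_suml rowPi mul1r.
  move=> l _; rewrite !mxE; case: (eqVneq (c l) (c i)) => [e|]; last by rewrite !mul0r.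
  by rewrite e (zc _ _ e).
have [P PE] : exists P, P = U^T *m Pi *m U by exists (U^T *m Pi *m U).
have PT : P^T = P by rewrite PE !trmx_mul trmxK PiT mulmxA.
have PP : P *m P = P.
  by rewrite PE !mulmxA -(mulmxA _ U U^T) oU.1 mulmx1 -(mulmxA _ Pi Pi) PiPi.
(* For a symmetric idempotent, each diagonal entry is the sum of the squares of its row, hence at
   least its own square. *)
have P01 i : 0 <= P i i <= 1.
  have E : P i i = \sum_j P i j ^+ 2.
    rewrite -[in LHS]PP mxE; apply: eq_bigr => j _.
    by rewrite -[in X in _ * X]PT mxE expr2.
  have P2 : P i i ^+ 2 <= P i i.
    rewrite [leRHS]E (bigD1 i)//= lerDl sumr_ge0// => j _; exact: sqr_ge0.
  have P0 : 0 <= P i i by apply: le_trans P2; exact: sqr_ge0.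
  rewrite P0 leNgt; apply/negP => P1.
  by have := P2; rewrite expr2; nra.
(* Every nonempty cell contributes exactly 1 to the trace of [Pi]. *)
have trP : \sum_i P i i <= N%:R.
  rewrite -/(\tr P) PE mxtrace_mulC mulmxA oU.1 mul1mx /mxtrace.
  rewrite (partition_big c xpredT)//=.
  have -> : N%:R = \sum_(l < N) (1 : R) by rewrite sumr_const card_ord.
  apply: ler_sum => l _.
  case: (pickP (fun i => c i == l)) => [i /eqP ci|H]; last first.
    by rewrite big_pred0.
  rewrite (eq_bigr (fun=> (z i)^-1)).
    rewrite sumr_const -[_ *+ _]mulr_natl (_ : #|_|%:R = z i) ?divff ?gt_eqF//.
    by congr _%:R; apply: eq_card => j; rewrite !inE ci.
  by move=> j /eqP cj; rewrite mxE eqxx mul1r (zc i j)// cj.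
have trS : \sum_i m 0 i = n%:R.
  have -> : \sum_i m 0 i = \tr S.
    rewrite SE mxtrace_mulC mulmxA oU.2 mul1mx mxtrace_diag.
    by [].
  rewrite /mxtrace; under eq_bigr do rewrite S1.
  by rewrite sumr_const card_ord.
have trPS : n%:R * (1 - w) <= \sum_i m 0 i * P i i.
  have -> : \sum_i m 0 i * P i i = \tr (S *m Pi).
    have -> : \sum_i m 0 i * P i i = \tr (diag_mx m *m P).
      by apply: eq_bigr => i _; rewrite mul_diag_mx mxE.
    by rewrite PE SE !mulmxA mxtrace_mulC !mulmxA.
  have -> : n%:R * (1 - w) = \sum_(i < n) (1 - w).
    by rewrite sumr_const card_ord mulr_natl.
  apply: ler_sum => i _; rewrite mxE -[leLHS]mulr1 -[X in _ * X <= _](rowPi i) mulr_sumr.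
  apply: ler_sum => j _; rewrite -[in leRHS]PiT [X in _ <= _ * X]mxE mxE.
  case: eqP => [cc|]; last by rewrite mul0r !mulr0.
  by rewrite ler_wpM2r ?mul1r ?invr_ge0 ?(ltW (z0 _))// Sw.
apply: (@le_trans _ _ (\sum_i (P i i + (m 0 i - m 0 i * P i i) / k))).
  apply: ler_sum => i _; have /andP[P0 P1] := P01 i.
  have mk : 0 < m 0 i + k by rewrite ltr_wpDl.
  rewrite ler_pdivrMr// -subr_ge0.
  rewrite (_ : _ - _ = P i i * k + m 0 i ^+ 2 * (1 - P i i) / k); last first.
    by field; rewrite gt_eqF.
  by apply: addr_ge0; rewrite ?divr_ge0 ?mulr_ge0 ?sqr_ge0 ?subr_ge0 ?(ltW k0).
rewrite big_split/= -mulr_suml sumrB trS; apply: lerD => //.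
by rewrite ler_pM2r ?invr_gt0//; lra.
Qed.

End linear_algebra.

(** * Gaussian moment generating functions *)

Section integral_extension.
Context {R : realType}.
Import HBNNSimple.

(* Extends an identity between integrals from indicators to nonnegative
   functions; covers both densities and independence. *)
Lemma ge0_integral_indic_ext d1 d2 d3 (T1 : measurableType d1)
    (T2 : measurableType d2) (S : measurableType d3)
    (m1 : {measure set T1 -> \bar R}) (m2 : {measure set T2 -> \bar R})
    (X1 : T1 -> S) (X2 : T2 -> S) (Y1 : T1 -> R) (Y2 : T2 -> R) (f : S -> R) :
  measurable_fun setT X1 -> measurable_fun setT X2 ->
  measurable_fun setT Y1 -> measurable_fun setT Y2 ->
  (forall x, 0 <= Y1 x) -> (forall x, 0 <= Y2 x) ->
  (forall A, measurable A ->
    (\int[m1]_x (\1_A (X1 x) * Y1 x)%:E = \int[m2]_x (\1_A (X2 x) * Y2 x)%:E)%E) ->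
  measurable_fun setT f -> (forall x, 0 <= f x) ->
  (\int[m1]_x (f (X1 x) * Y1 x)%:E = \int[m2]_x (f (X2 x) * Y2 x)%:E)%E.
Proof.
move=> mX1 mX2 mY1 mY2 Y10 Y20 H mf f0.
have mfE : measurable_fun setT (EFin \o f) by exact/measurable_EFinP.
pose fn := nnsfun_approx measurableT mfE.
have key d (T : measurableType d) (m : {measure set T -> \bar R}) (X : T -> S) (Y : T -> R) :
    measurable_fun setT X -> measurable_fun setT Y -> (forall x, 0 <= Y x) ->
    (\int[m]_x (f (X x) * Y x)%:E =
     limn (fun n => \sum_(k \in range (fn n))
       k%:E * \int[m]_x (\1_(fn n @^-1` [set k]) (X x) * Y x)%:E))%E.
  move=> mX mY Y0.
  transitivity (limn (fun n => \int[m]_x (fn n (X x) * Y x)%:E)%E).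
    rewrite -monotone_convergence//.
    - apply: eq_integral => x _; apply/esym/cvg_lim => //.
      under eq_fun do rewrite EFinM; rewrite EFinM; apply: cvgeZr => //.
      apply: (cvg_nnsfun_approx measurableT mfE) => //= y _.
      by rewrite lee_fin.
    - move=> n; apply/measurable_EFinP; apply: measurable_funM => //.
      by apply: measurableT_comp => //; exact: measurable_funP.
    - by move=> n x _; rewrite lee_fin mulr_ge0.
    - move=> x _ a b ab; rewrite lee_fin ler_wpM2r//.
      exact/lefP/nd_nnsfun_approx.
  congr (limn _); apply/funext => n.
  have mI k : measurable_fun setT (fun x => \1_(fn n @^-1` [set k]) (X x) * Y x).
    by apply: measurable_funM => //; apply: measurableT_comp.
  transitivity (\int[m]_x (\sum_(k \in range (fn n))
      (k * (\1_(fn n @^-1` [set k]) (X x) * Y x))%:E)%E)%E.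
    apply: eq_integral => x _; rewrite fsumEFin//; congr EFin.
    rewrite [in LHS]fimfunE !fsbig_finite//= mulr_suml; apply: eq_bigr => k _.
    by rewrite mulrA.
  rewrite ge0_integral_fsum//; last 2 first.
  - by move=> k; apply/measurable_EFinP; apply: measurable_funM.
  - move=> k x _; rewrite lee_fin mulrA mulr_ge0//.
    exact: nnfun_muleindic_ge0.
  apply: eq_fsbigr => k; rewrite inE => -[z _ <-].
  under eq_integral do rewrite EFinM.
  rewrite ge0_integralZl; [by []|exact: measurableT| | |]; last first.
  - by rewrite lee_fin.
  - by move=> x _; rewrite lee_fin mulr_ge0.
  - by apply/measurable_EFinP; exact: mI.
rewrite !key//; congr (limn _); apply/funext => n.
by apply: eq_fsbigr => k _; rewrite H.
Qed.

End integral_extension.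

Section gaussian_moments.
Context {R : realType} {disp : measure_display} {T : measurableType disp}
  (P : probability T R).
Notation mu := (@lebesgue_measure R).

Let measurable_expR_lin (c : R) : measurable_fun setT (fun x : R => expR (c * x)).
Proof. by apply: measurableT_comp => //; exact: measurable_funM. Qed.

Let measurable_expR_sq (b m : R) :
  measurable_fun setT (fun x : R => expR (- (b * (x - m) ^+ 2))).
Proof.
apply: measurableT_comp => //; apply: measurableT_comp => //.
apply: measurable_funM => //; apply: measurable_funX.
exact: measurable_funB.
Qed.

Let measurable_expR_sq0 (b : R) :
  measurable_fun setT (fun x : R => expR (- (b * x ^+ 2))).
Proof. by have := measurable_expR_sq b 0; under eq_fun do rewrite subr0. Qed.

Lemma gaussint_scale (a b : R) : 0 < a -> 0 < b ->
  gaussint b = Num.sqrt (a / b) * gaussint a.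
Proof.
move=> a0 b0; rewrite /gaussint -sqrtrM ?divr_ge0 ?ltW//; congr Num.sqrt.
by field; rewrite !gt_eqF.
Qed.

Lemma integral_expR_gaussian (c b : R) : 0 < b ->
  (\int[mu]_x (expR (c * x) * expR (- (b * x ^+ 2)))%:E =
   (gaussint b * expR (c ^+ 2 / (4 * b)))%:E)%E.
Proof.
move=> b0.
transitivity (\int[mu]_x ((expR (c ^+ 2 / (4 * b)))%:E *
    (expR (- (b * (x - c / (2 * b)) ^+ 2)))%:E))%E.
  apply: eq_integral => x _; rewrite -EFinM -!expRD; congr (expR _)%:E.
  by field; rewrite gt_eqF.
rewrite ge0_integralZl//; last first.
  by apply/measurable_EFinP; exact: measurable_expR_sq.
by rewrite integral_gaussian// -EFinM mulrC.
Qed.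

Lemma probability_indic_integral (X : T -> R) A : measurable_fun setT X ->
  measurable A -> (\int[P]_x (\1_A (X x))%:E = P (X @^-1` A))%E.
Proof.
move=> mX mA; rewrite (_ : (fun x => _) = EFin \o \1_(X @^-1` A)).
  by rewrite integral_indic ?setIT// -[_ @^-1` _]setTI; exact: mX.
by apply/funext.
Qed.

Lemma gauss_integral_comp (X : T -> R) (v : R) (f : R -> R) :
  measurable_fun setT X -> (forall A, measurable A -> P (X @^-1` A) = gauss v A) ->
  0 < v -> measurable_fun setT f -> (forall x, 0 <= f x) ->
  (\int[P]_w (f (X w))%:E =
   \int[mu]_x ((gaussint (2 * v)^-1)^-1 * (f x * expR (- ((2 * v)^-1 * x ^+ 2))))%:E)%E.
Proof.
move=> mX lX v0 mf f0.
have s0 : Num.sqrt v != 0 by rewrite gt_eqF// sqrtr_gt0.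
have pE x : normal_pdf 0 (Num.sqrt v) x =
    (gaussint (2 * v)^-1)^-1 * expR (- ((2 * v)^-1 * x ^+ 2)).
  rewrite normal_pdfE// /normal_peak /normal_fun sqr_sqrtr ?ltW// subr0.
  congr (_ * _); first by rewrite /gaussint; congr (Num.sqrt _)^-1; field; rewrite gt_eqF.
  by congr expR; field; rewrite gt_eqF.
have := @ge0_integral_indic_ext R _ _ _ T (measurableTypeR R) (measurableTypeR R)
  P mu X id (fun=> 1) (normal_pdf 0 (Num.sqrt v)) f mX (@measurable_id _ _ _)
  (@measurable_cst _ _ _ _ _ _) (measurable_normal_pdf _ _).
move=> /(_ (fun=> ler01) (normal_pdf_ge0 _ _)).
have H A : measurable A -> (\int[P]_x (\1_A (X x) * 1)%:E =
     \int[mu]_x (\1_A (id x) * normal_pdf 0 (Num.sqrt v) x)%:E)%E.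
  move=> mA; under eq_integral do rewrite mulr1.
  rewrite probability_indic_integral// lX// /gauss gt_eqF//.
  rewrite /normal_prob [LHS]integral_mkcond; apply: eq_integral => x _.
  rewrite patchE indicE; case: ifPn => _; by rewrite ?mul1r ?mul0r.
move=> /(_ H mf f0).
under eq_integral do rewrite mulr1.
move=> ->; apply: eq_integral => x _; rewrite pE; congr EFin; ring.
Qed.

Lemma gauss_mgf (X : T -> R) (v c : R) :
  measurable_fun setT X -> (forall A, measurable A -> P (X @^-1` A) = gauss v A) ->
  0 <= v -> (\int[P]_w (expR (c * X w))%:E = (expR (c ^+ 2 * v / 2))%:E)%E.
Proof.
move=> mX lX; have me : measurable_fun setT (fun x : R => expR (c * x)).
  by apply: measurableT_comp => //; exact: measurable_funM.
(* A linear combination may be degenerate; for variance 0 the law is a point mass and has no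
   density. *)
rewrite le_eqVlt => /predU1P[v0|v0].
  have := @ge0_integral_indic_ext R _ _ _ T (measurableTypeR R) (measurableTypeR R)
    P (\d_(0 : measurableTypeR R)) X id (fun=> 1) (fun=> 1) (fun x => expR (c * x)) mX (@measurable_id _ _ _)
    (@measurable_cst _ _ _ _ _ _) (@measurable_cst _ _ _ _ _ _).
  move=> /(_ (fun=> ler01) (fun=> ler01)).
  have H A : measurable A -> (\int[P]_x (\1_A (X x) * 1)%:E =
      \int[\d_(0%R : measurableTypeR R)]_x (\1_A (id x) * 1)%:E)%E.
    move=> mA; under eq_integral do rewrite mulr1.
    under [RHS]eq_integral do rewrite mulr1.
    rewrite probability_indic_integral// lX// /gauss -v0 eqxx.
    by rewrite integral_indic ?setIT.
  move=> /(_ H me (fun=> expR_ge0 _)).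
  under eq_integral do rewrite mulr1.
  move=> ->; under eq_integral do rewrite mulr1.
  rewrite integral_dirac//; last exact/measurable_EFinP.
  by rewrite diracT mul1e -v0 !mulr0 mul0r expR0.
rewrite (@gauss_integral_comp X v (fun x => expR (c * x)))//.
  under eq_integral do rewrite EFinM.
  have b0 : 0 < (2 * v)^-1 by rewrite invr_gt0 mulr_gt0.
  have G0 := gaussint_gt0 b0.
  rewrite ge0_integralZl//; last 2 first.
  - apply/measurable_EFinP; apply: measurable_funM; last exact: measurable_expR_sq0.
    exact: measurable_expR_lin.
  - by rewrite lee_fin invr_ge0 ltW.
  rewrite integral_expR_gaussian// -EFinM mulKf ?gt_eqF//.
  by congr (expR _)%:E; field; rewrite gt_eqF.
Qed.

(** The weight exp(c x^2) lowers the Gaussian rate from 1/(2v) to 1/(2v) - c, which stays positive,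
    so the value is a ratio of two Gaussian integrals. *)
Lemma gauss_sq_mgf (X : T -> R) (v c : R) :
  measurable_fun setT X -> (forall A, measurable A -> P (X @^-1` A) = gauss v A) ->
  0 < v -> 2 * c * v < 1 ->
  (\int[P]_w (expR (c * X w ^+ 2))%:E = ((Num.sqrt (1 - 2 * c * v))^-1)%:E)%E.
Proof.
move=> mX lX v0 cv.
have me : measurable_fun setT (fun x : R => expR (c * x ^+ 2)).
  by apply: measurableT_comp => //; apply: measurable_funM => //; exact: measurable_funX.
have b0 : 0 < (2 * v)^-1 by rewrite invr_gt0 mulr_gt0.
have G0 := gaussint_gt0 b0.
have bc0 : 0 < (2 * v)^-1 - c.
  rewrite subr_gt0 -(ltr_pM2r v0) (_ : (2 * v)^-1 * v = 1 / 2); last by field; rewrite gt_eqF.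
  lra.
rewrite (@gauss_integral_comp X v (fun x => expR (c * x ^+ 2)))//.
transitivity (\int[mu]_x ((gaussint (2 * v)^-1)^-1%:E *
    (expR (- (((2 * v)^-1 - c) * (x - 0) ^+ 2)))%:E))%E.
  apply: eq_integral => x _; rewrite -EFinM -expRD; congr (_ * expR _)%:E; ring.
rewrite ge0_integralZl//; last 2 first.
- by apply/measurable_EFinP; exact: measurable_expR_sq.
- by rewrite lee_fin invr_ge0 ltW.
rewrite integral_gaussian// -EFinM; congr EFin.
rewrite (gaussint_scale b0 bc0) mulrCA mulVf ?gt_eqF// mulr1.
have cv0 : 1 - 2 * c * v != 0 by rewrite gt_eqF// subr_gt0.
rewrite -sqrtrV ?subr_ge0 ?(ltW cv)//; congr Num.sqrt.
by field; rewrite cv0 gt_eqF.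
Qed.

(* Hubbard-Stratonovich: each square is linearized by an auxiliary Gaussian,
   and Tonelli moves the expectation inside. *)
Lemma quadratic_mgf n (X : 'I_n -> T -> R) (m w : 'I_n -> R) :
  (forall i, measurable_fun setT (X i)) ->
  (forall i, 0 <= w i) -> (forall i, w i * m i < 1) ->
  (forall a : 'I_n -> R, (\int[P]_t (expR (\sum_i a i * X i t))%:E =
     (expR ((\sum_i m i * a i ^+ 2) / 2))%:E)%E) ->
  (\int[P]_t (expR ((\sum_i w i * X i t ^+ 2) / 2))%:E =
   (\prod_i (Num.sqrt (1 - w i * m i))^-1)%:E)%E.
Proof.
move=> mX w0 wm1 mgf.
(* Generalized for the induction: squares over [r] together with a linear term supported off [r],
   which absorbs the squares already linearized. *)
suff H (r : seq 'I_n) (a : 'I_n -> R) : uniq r -> (forall i, i \in r -> a i = 0) ->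
    (\int[P]_t (expR ((\sum_(i <- r) w i * X i t ^+ 2) / 2) *
       expR (\sum_i a i * X i t))%:E =
     (\prod_(i <- r) (Num.sqrt (1 - w i * m i))^-1 *
       expR ((\sum_i m i * a i ^+ 2) / 2))%:E)%E.
  have := H (index_enum 'I_n) (fun=> 0) (index_enum_uniq _) (fun _ _ => erefl).
  rewrite [X in expR (X / 2)]big1; last by move=> i _; rewrite expr0n mulr0.
  rewrite mul0r expR0 mulr1 => <-; apply: eq_integral => t _.
  by rewrite [X in _ * expR X]big1 ?expR0 ?mulr1// => i _; rewrite mul0r.
elim: r a => [|i r IH] a.
  move=> _ _; rewrite big_nil mul1r -mgf; apply: eq_integral => t _.
  by rewrite big_nil mul0r expR0 mul1r.
rewrite cons_uniq => /andP[ir ur] a0.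
have b0 : 0 < 2^-1 :> R by rewrite invr_gt0.
have G0 := gaussint_gt0 b0.
pose Y t := expR ((\sum_(i <- r) w i * X i t ^+ 2) / 2) * expR (\sum_i a i * X i t).
have mE (h : T -> R) : measurable_fun setT h -> measurable_fun setT (fun t => expR (h t)).
  by move=> mh; exact: measurableT_comp.
have mY : measurable_fun setT Y.
  apply: measurable_funM; apply: mE.
    apply: measurable_funM => //; apply: measurable_sum => j.
    by apply: measurable_funM => //; exact: measurable_funX.
  by apply: measurable_sum => j; exact: measurable_funM.
have Y0 t : 0 <= Y t by rewrite mulr_ge0 ?expR_ge0.
(* Integrating the standard Gaussian variable [z.2] out of [F] gives back exp(w_i X_i^2 / 2). *)
pose F (z : T * R) : R := (gaussint 2^-1)^-1 * (Y z.1 *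
   (expR (Num.sqrt (w i) * X i z.1 * z.2) * expR (- (2^-1 * z.2 ^+ 2)))).
have mF : measurable_fun setT (EFin \o F).
  apply/measurable_EFinP; apply: measurable_funM => //; apply: measurable_funM.
    by apply: measurableT_comp => //; exact: measurable_fst.
  have m1 : measurable_fun setT (fun z : T * R => X i z.1).
    by apply: measurableT_comp => //; exact: measurable_fst.
  have m2 : measurable_fun setT (fun z : T * R => z.2) by exact: measurable_snd.
  apply: measurable_funM; apply: measurableT_comp => //.
    by apply: measurable_funM => //; exact: measurable_funM.
  apply: measurableT_comp => //; apply: measurable_funM => //.
  exact: measurable_funX.
have F0 z : (0 <= (EFin \o F) z)%E.
  by rewrite lee_fin !mulr_ge0 ?invr_ge0 ?expR_ge0 ?(ltW G0).
have Yi t : (\int[mu]_g (F (t, g))%:E)%E =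
    (expR ((\sum_(j <- i :: r) w j * X j t ^+ 2) / 2) * expR (\sum_j a j * X j t))%:E.
  transitivity (\int[mu]_g (((gaussint 2^-1)^-1 * Y t)%:E *
      (expR (Num.sqrt (w i) * X i t * g) * expR (- (2^-1 * g ^+ 2)))%:E))%E.
    by apply: eq_integral => g _; rewrite -EFinM /F/=; congr EFin; ring.
  rewrite ge0_integralZl//; last 2 first.
  - apply/measurable_EFinP; apply: measurable_funM; last exact: measurable_expR_sq0.
    exact: measurable_expR_lin.
  - by rewrite lee_fin mulr_ge0 ?invr_ge0 ?(ltW G0).
  rewrite integral_expR_gaussian// -EFinM; congr EFin.
  rewrite exprMn sqr_sqrtr// (_ : w i * X i t ^+ 2 / (4 / 2) = w i * X i t ^+ 2 / 2); last by field.
  transitivity (Y t * expR (w i * X i t ^+ 2 / 2)).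
    by field; rewrite gt_eqF.
  by rewrite /Y big_cons mulrDl expRD; ring.
transitivity (\int[P]_t \int[mu]_g (F (t, g))%:E)%E.
  by apply: eq_integral => t _; rewrite Yi.
rewrite (@fubini_tonelli _ _ T (measurableTypeR R) R P mu (EFin \o F))//.
have ai : a i = 0 by apply: a0; rewrite mem_head.
have inner g : (\int[P]_t (F (t, g))%:E)%E =
   ((gaussint 2^-1)^-1 * (\prod_(i <- r) (Num.sqrt (1 - w i * m i))^-1 *
       expR ((\sum_i m i * a i ^+ 2) / 2)) *
     expR (- ((1 - w i * m i) / 2 * (g - 0) ^+ 2)))%:E.
  (* As [a i = 0], the new coefficient enters the quadratic exponent without a cross term, and what
     remains is a Gaussian integral in [g] of rate (1 - w_i m_i) / 2. *)
  pose a' j := a j + (j == i)%:R * (Num.sqrt (w i) * g).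
  have a'r j : j \in r -> a' j = 0.
    move=> jr; rewrite /a' a0 ?inE ?jr ?orbT// (_ : (j == i) = false) ?mul0r ?addr0//.
    by apply/negbTE; apply: contraNneq ir => <-.
  have lin t : \sum_j a' j * X j t = \sum_j a j * X j t + Num.sqrt (w i) * X i t * g.
    rewrite /a'; under eq_bigr do rewrite mulrDl.
    rewrite big_split/=; congr (_ + _).
    rewrite (bigD1 i)//= eqxx mul1r big1 ?addr0; first by ring.
    by move=> j /negbTE ->; rewrite !mul0r.
  have quad : \sum_j m j * a' j ^+ 2 = \sum_j m j * a j ^+ 2 + w i * m i * g ^+ 2.
    rewrite (bigD1 i)//= [in RHS](bigD1 i)//= /a' ai eqxx mul1r add0r exprMn sqr_sqrtr//.
    rewrite expr0n mulr0 add0r addrC; congr (_ + _); last by ring.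
    by apply: eq_bigr => j /negbTE ->; rewrite mul0r addr0.
  have := IH a' ur a'r; rewrite quad => Ha'.
  transitivity (\int[P]_t (((gaussint 2^-1)^-1 * expR (- (2^-1 * g ^+ 2)))%:E *
     (expR ((\sum_(i0 <- r) w i0 * X i0 t ^+ 2) / 2) * expR (\sum_i0 a' i0 * X i0 t))%:E))%E.
    apply: eq_integral => t _; rewrite -EFinM lin expRD /F /Y/=; congr EFin; ring.
  rewrite ge0_integralZl//; last 2 first.
  - apply/measurable_EFinP; apply: measurable_funM; apply: mE.
      apply: measurable_funM => //; apply: measurable_sum => j.
      by apply: measurable_funM => //; exact: measurable_funX.
    by apply: measurable_sum => j; exact: measurable_funM.
  - by rewrite lee_fin mulr_ge0 ?invr_ge0 ?(ltW G0) ?expR_ge0.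
  rewrite Ha' -EFinM; congr EFin.
  rewrite (_ : (\sum_j m j * a j ^+ 2 + w i * m i * g ^+ 2) / 2 =
    (\sum_j m j * a j ^+ 2) / 2 + w i * m i * g ^+ 2 / 2); last by ring.
  rewrite (_ : - ((1 - w i * m i) / 2 * (g - 0) ^+ 2) =
    w i * m i * g ^+ 2 / 2 + - (2^-1 * g ^+ 2)); last by field.
  rewrite !expRD; ring.
under eq_integral do rewrite inner EFinM.
have bi : 0 < (1 - w i * m i) / 2 by rewrite divr_gt0// subr_gt0.
have pr0 : 0 <= \prod_(i <- r) (Num.sqrt (1 - w i * m i))^-1.
  by apply: prodr_ge0 => j _; rewrite invr_ge0 sqrtr_ge0.
rewrite ge0_integralZl//; last 2 first.
- by apply/measurable_EFinP; exact: measurable_expR_sq.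
- by rewrite lee_fin !mulr_ge0 ?invr_ge0 ?(ltW G0) ?expR_ge0.
rewrite integral_gaussian// -EFinM; congr EFin.
rewrite big_cons -!mulrA; rewrite [RHS]mulrCA [LHS]mulrCA; congr (_ * _).
rewrite mulrCA [RHS]mulrC; congr (_ * _).
rewrite (gaussint_scale b0 bi) mulrCA mulVf ?gt_eqF// mulr1.
rewrite -sqrtrV ?subr_ge0 ?(ltW (wm1 i))//; congr Num.sqrt; field.
by rewrite gt_eqF// subr_gt0.
Qed.

End gaussian_moments.

(** * Concentration of inverse-gamma laws *)

Section independence.
Context {R : realType} {disp : measure_display} {T : measurableType disp}
  (P : probability T R).

Lemma prod_indic_bigcap k (X : 'I_k -> T -> R) (A : 'I_k -> set R) w :
  \prod_i \1_(A i) (X i w) = \1_(\bigcap_i (X i @^-1` A i)) w :> R.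
Proof.
have [H|H] := pselect (forall i, A i (X i w)).
  rewrite big1 ?indicE ?mem_set//; first by move=> i _; exact: H.
  by move=> i _; rewrite indicE mem_set.
have /existsNP[i Ai] := H.
rewrite (bigD1 i)//= indicE memNset// mul0r indicE memNset//.
by move=> /(_ i I).
Qed.

Lemma independent_prod_integral k (X : 'I_k -> T -> R) (h : 'I_k -> R -> R)
    (e : 'I_k -> R) :
  (forall i, measurable_fun setT (X i)) ->
  (forall A : 'I_k -> set R, (forall i, measurable (A i)) ->
    P (\bigcap_i (X i @^-1` A i)) = (\prod_(i < k) P (X i @^-1` A i))%E) ->
  (forall i, measurable_fun setT (h i)) -> (forall i x, 0 <= h i x) ->
  (forall i, \int[P]_w (h i (X i w))%:E = (e i)%:E)%E ->
  (\int[P]_w (\prod_i h i (X i w))%:E = (\prod_i e i)%:E)%E.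
Proof.
move=> mX ind.
(* All functions of index at least [j] are indicators: [j = 0] is the independence of events,
   [j = k] is no restriction, and each step frees one coordinate through
   [ge0_integral_indic_ext]. *)
suff H j (h' : 'I_k -> R -> R) (e' : 'I_k -> R) :
    (forall i, measurable_fun setT (h' i)) -> (forall i x, 0 <= h' i x) ->
    (forall i, \int[P]_w (h' i (X i w))%:E = (e' i)%:E)%E ->
    (forall i : 'I_k, (j <= i)%N -> exists2 A, measurable A & h' i = \1_A) ->
    (\int[P]_w (\prod_i h' i (X i w))%:E = (\prod_i e' i)%:E)%E.
  move=> mh h0 he; apply: (H k) => // i; by rewrite leqNgt ltn_ord.
elim: j h' e' => [|j IH] h' e' mh h0 he hA.
  have /choice[A HA] : forall i, exists A : set R, measurable A /\ h' i = \1_A.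
    by move=> i; have [A mA ->] := hA i isT; exists A.
  have mXA i : measurable (X i @^-1` A i).
    by rewrite -[_ @^-1` _]setTI; apply: mX => //; exact: (HA i).1.
  have eE i : (e' i)%:E = P (X i @^-1` A i).
    by rewrite -he (HA i).2 probability_indic_integral//; exact: (HA i).1.
  rewrite (eq_integral (fun w => (\1_(\bigcap_i (X i @^-1` A i)) w)%:E)); last first.
    move=> w _; rewrite -prod_indic_bigcap; congr EFin; apply: eq_bigr => i _.
    by rewrite (HA i).2.
  rewrite integral_indic// ?setIT; last first.
    by apply: fin_bigcap_measurable => // i _; exact: mXA.
  apply: (etrans (ind A (fun i => (HA i).1))).
  rewrite (eq_bigr (fun i => (e' i)%:E)); last by move=> i _; rewrite eE.
  by rewrite prodEFin.
have [kj|jk] := leqP k j.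
  apply: IH => // i ji; have := leq_trans kj ji.
  by rewrite leqNgt ltn_ord.
pose i0 := Ordinal jk.
pose Y w := \prod_(i | i != i0) h' i (X i w).
pose c := \prod_(i | i != i0) e' i.
have e0 i : 0 <= e' i.
  by rewrite -lee_fin -he; apply: integral_ge0 => w _; rewrite lee_fin.
have c0 : 0 <= c by apply: prodr_ge0.
have mY : measurable_fun setT Y.
  rewrite /Y; elim: (index_enum _) => [|i r IHr].
    by under eq_fun do rewrite big_nil; exact: measurable_cst.
  under eq_fun do rewrite big_cons.
  case: (i != i0) => //; apply: measurable_funM => //; exact: measurableT_comp.
have Y0 w : 0 <= Y w by apply: prodr_ge0.
have H A : measurable A ->
  (\int[P]_w (\1_A (X i0 w) * Y w)%:E = \int[P]_w (\1_A (X i0 w) * c)%:E)%E.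
  move=> mA; pose h2 i := if i == i0 then \1_A else h' i.
  pose e2 i := if i == i0 then fine (P (X i0 @^-1` A)) else e' i.
  have mXA : measurable (X i0 @^-1` A) by rewrite -[_ @^-1` _]setTI; exact: mX.
  have := IH h2 e2.
  have E1 : \prod_i e2 i = fine (P (X i0 @^-1` A)) * c.
    rewrite (bigD1 i0)//= /e2 eqxx; congr (_ * _).
    by apply: eq_bigr => i /negbTE ->.
  have E2 w : \prod_i h2 i (X i w) = \1_A (X i0 w) * Y w.
    rewrite (bigD1 i0)//= /h2 eqxx; congr (_ * _).
    by apply: eq_bigr => i /negbTE ->.
  under eq_integral do rewrite E2.
  rewrite E1 => ->.
  - under eq_integral do rewrite mulrC EFinM.
    rewrite ge0_integralZl//.
    + by rewrite probability_indic_integral// EFinM fineK ?fin_num_measure// muleC.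
    + by apply/measurable_EFinP; apply: measurableT_comp.
  - by move=> i; rewrite /h2; case: ifP.
  - by move=> i x; rewrite /h2; case: ifP.
  - move=> i; rewrite /h2 /e2; case: eqP => [->|_]; last exact: he.
    by rewrite probability_indic_integral// fineK ?fin_num_measure.
  - move=> i ji; rewrite /h2; case: eqP => [_|/eqP ii]; first by exists A.
    apply: hA; rewrite ltn_neqAle ji andbT.
    by apply: contra ii => /eqP ji'; apply/eqP/val_inj.
have := @ge0_integral_indic_ext R _ _ _ T T (measurableTypeR R) P P (X i0) (X i0)
  Y (fun=> c) (h' i0) (mX i0) (mX i0) mY (@measurable_cst _ _ _ _ _ _) Y0 (fun=> c0) H
  (mh i0) (h0 i0).
rewrite (bigD1 i0)//= -/c => E.
transitivity (\int[P]_w (h' i0 (X i0 w) * Y w)%:E)%E.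
  by apply: eq_integral => w _; rewrite (bigD1 i0).
rewrite E; under eq_integral do rewrite mulrC EFinM.
rewrite ge0_integralZl//.
- by rewrite he -EFinM mulrC.
- by apply/measurable_EFinP; apply: measurableT_comp.
- by move=> x _; rewrite lee_fin.
Qed.

End independence.

(** * Laplace bounds for the inverse-gamma posterior *)

Section posterior_concentration.
Context {R : realType}.
Notation mu := (@lebesgue_measure R).

(** The inverse-gamma density without its normalizing constant. *)
Definition igfun (al be x : R) : R :=
  if 0 < x then x `^ (- al - 1) * expR (- (be / x)) else 0.

Lemma igfun_ge0 al be x : 0 <= igfun al be x.
Proof. by rewrite /igfun; case: ifP => // _; rewrite mulr_ge0 ?powR_ge0 ?expR_ge0. Qed.

Lemma ln_le_sub1 (u : R) : 0 < u -> ln u <= u - 1.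
Proof.
move=> u0; have := @le_ln1Dx R (u - 1); rewrite [1 + _]addrC subrK; apply.
by rewrite ltrBrDr addrC subrr.
Qed.

(** The exponential rate of the inverse-gamma law (see [igfunE]); nonnegative, zero at t = 1. *)
Definition rate (t : R) : R := t - 1 - ln t.

(** With s = sqrt t, the bound ln s <= s - 1 gives rate t >= (s - 1)^2, and (s + 1)^2 <= 2 (s^2 +
    1). *)
Lemma rate_ge (t : R) : 0 < t -> (t - 1) ^+ 2 / (2 * (t + 1)) <= rate t.
Proof.
move=> t0; pose s := Num.sqrt t.
have s0 : 0 < s by rewrite sqrtr_gt0.
have tE : t = s ^+ 2 by rewrite sqr_sqrtr// ltW.
have := ln_le_sub1 s0.
rewrite /rate tE lnXn// => ls.
apply: (@le_trans _ _ ((s - 1) ^+ 2)); last by rewrite -mulr_natl; nra.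
rewrite ler_pdivrMr; last by nra.
rewrite (_ : s ^+ 2 - 1 = (s - 1) * (s + 1)); last by ring.
rewrite exprMn ler_wpM2l ?sqr_ge0//; have := sqr_ge0 (s - 1); nra.
Qed.

Lemma rate_ge0 (t : R) : 0 < t -> 0 <= rate t.
Proof. by move=> t0; rewrite /rate subr_ge0 ln_le_sub1. Qed.

Lemma rate_le (t : R) : 0 < t -> rate t <= (t - 1) ^+ 2 / t.
Proof.
move=> t0; rewrite /rate.
have : ln t^-1 <= t^-1 - 1 by apply: ln_le_sub1; rewrite invr_gt0.
rewrite lnV// => H.
rewrite (_ : (t - 1) ^+ 2 / t = t - 2 + t^-1); last by field; rewrite gt_eqF.
lra.
Qed.

(** Laplace form: when the scale is [al * r], all dependence on [x] at speed [al] sits in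
    [rate (r / x)], which vanishes at x = r. *)
Lemma igfunE (al r x : R) : 0 < x -> 0 < r ->
  igfun al (al * r) x =
  expR (- (al * (ln r + 1))) * x^-1 * expR (- (al * rate (r / x))).
Proof.
move=> x0 r0; rewrite /igfun x0 /powR gt_eqF// -[x^-1]lnK ?posrE ?invr_gt0// lnV//.
rewrite -!expRD; congr expR; rewrite /rate lnM ?posrE ?expR_gt0// expRK.
ring.
Qed.

(** Of the exponent [al], the part [al - 1] pays for the decay in [c]; the remaining unit makes the
    function integrable, by comparison with 1 / (1 + x^2). The 2 comes from u^2 exp(-u) <= 2. *)
Lemma igfun_dominated (al r c x : R) : 0 < r -> 1 <= al -> 0 <= c ->
  (0 < x -> c <= rate (r / x)) ->
  igfun al (al * r) x <=
  expR (- (al * (ln r + 1))) * expR (- ((al - 1) * c)) * expR 1 * (r + 2 / r)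
   * (oneDsqr x)^-1.
Proof.
move=> r0 al1 c0 H.
have P1 : 0 < oneDsqr x by rewrite (lt_le_trans ltr01)// oneDsqr_ge1.
have [x0|x0] := ltP 0 x; last first.
  rewrite /igfun ltNge x0/= !mulr_ge0 ?expR_ge0 ?invr_ge0 ?(ltW P1)//.
  by rewrite addr_ge0 ?divr_ge0 ?ltW.
rewrite igfunE//.
set L := expR (- (al * (ln r + 1))).
have L0 : 0 < L by exact: expR_gt0.
rewrite -!mulrA ler_pM2l//.
have -> : expR (- (al * rate (r / x))) =
    expR (- ((al - 1) * rate (r / x))) * expR (- rate (r / x)).
  by rewrite -expRD; congr expR; ring.
rewrite mulrCA; apply: ler_pM.
- exact: expR_ge0.
- by rewrite mulr_ge0 ?invr_ge0 ?expR_ge0 ?ltW.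
- by rewrite ler_expR lerN2 ler_wpM2l ?H// subr_ge0.
have -> : expR (- rate (r / x)) = expR 1 * (r / x) * expR (- (r / x)).
  have -> : - rate (r / x) = 1 + ln (r / x) + - (r / x) by rewrite /rate; ring.
  by rewrite !expRD lnK// posrE divr_gt0.
rewrite -!mulrA mulrCA ler_pM2l ?expR_gt0//.
have u0 : 0 < r / x by rewrite divr_gt0.
set u := r / x in u0 *.
have xE : x = r / u by rewrite /u; field; rewrite !gt_eqF.
have eu := expR_ge_sqr (ltW u0).
have eu1 : expR (- u) * u ^+ 2 <= 2.
  rewrite expRN mulrC ler_pdivrMr ?expR_gt0//; lra.
have eu2 : expR (- u) <= 1 by rewrite -expR0 ler_expR oppr_le0 ltW.
rewrite ler_pdivlMr//.
rewrite (_ : x^-1 * (r * (x^-1 * expR (- u))) * oneDsqr x =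
   r * expR (- u) + r^-1 * (expR (- u) * u ^+ 2)); last first.
  by rewrite /oneDsqr xE; field; rewrite !gt_eqF.
apply: lerD; first by rewrite ler_piMr// ltW.
by rewrite mulrC ler_wpM2r// invr_ge0 ltW.
Qed.

Lemma measurable_igfun al be : measurable_fun setT (igfun al be).
Proof.
have -> : igfun al be = fun x => if 0 < x then
    x `^ (- al - 1) * expR (- (be * x `^ (-1))) else 0.
  apply/funext => x; rewrite /igfun; case: ifP => // x0.
  by rewrite powR_inv1// ltW.
apply: measurable_fun_ifT => //; first exact: measurable_fun_ltr.
apply: measurable_funM; first exact: measurable_powR.
apply: measurableT_comp => //; apply: measurableT_comp => //.
by apply: measurable_funM => //; exact: measurable_powR.
Qed.

Lemma integral_igfun_le (al r c : R) (B : set R) : measurable B ->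
  0 < r -> 1 <= al -> 0 <= c ->
  (forall x, B x -> 0 < x -> c <= rate (r / x)) ->
  (\int[mu]_(x in B) (igfun al (al * r) x)%:E <=
   (expR (- (al * (ln r + 1))) * expR (- ((al - 1) * c)) * expR 1 * (r + 2 / r)
     * (pi / 2))%:E)%E.
Proof.
move=> mB r0 al1 c0 H.
set K := _ * (r + 2 / r).
have K0 : 0 <= K.
  by rewrite !mulr_ge0 ?expR_ge0// addr_ge0 ?divr_ge0 ?ltW.
have mo : measurable_fun setT (fun x : R => (oneDsqr x)^-1).
  exact: continuous_measurable_fun (@continuous_oneDsqrV R).
have o0 x : 0 <= (oneDsqr x)^-1 :> R.
  by rewrite invr_ge0 (le_trans ler01)// oneDsqr_ge1.
apply: (@le_trans _ _ (\int[mu]_(x in B `&` `[0%R, +oo[) (K * (oneDsqr x)^-1)%:E)%E).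
  rewrite integral_mkcond [leRHS]integral_mkcond; apply: ge0_le_integral => //.
  - by move=> x _; rewrite erestrict_ge0// => y _; rewrite lee_fin igfun_ge0.
  - apply/(measurable_restrictT _ _).1 => //.
    by apply/measurable_EFinP/measurable_funTS; exact: measurable_igfun.
  - apply/(measurable_restrictT _ _).1 => //; first exact: measurableI.
    by apply/measurable_EFinP/measurable_funTS; exact: measurable_funM.
  - move=> x _; rewrite !patchE in_setI.
    case: (boolP (x \in B)) => [/set_mem Bx|_]/=; last first.
      by [].
    case: (boolP (x \in _)) => [_|/negP x0].
      by rewrite lee_fin; apply: igfun_dominated => //; exact: H.
    rewrite /igfun ltNge (_ : x <= 0)//= leNgt; apply/negP => x0'.
    by apply: x0; rewrite inE/= in_itv/= andbT ltW.
apply: (@le_trans _ _ (\int[mu]_(x in `[0%R, +oo[) (K * (oneDsqr x)^-1)%:E)%E).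
  apply: ge0_subset_integral => //.
  - exact: measurableI.
  - by apply/measurable_EFinP/measurable_funTS; exact: measurable_funM.
  - by move=> x _; rewrite lee_fin mulr_ge0.
under eq_integral do rewrite EFinM.
rewrite ge0_integralZl//; last first.
  by apply/measurable_EFinP/measurable_funTS.
by rewrite integral0y_oneDsqr -EFinM.
Qed.

Lemma integral_igfun_ge (al r c m rho : R) : 0 < r -> 0 <= al -> 0 < m -> 0 < rho ->
  rho <= m -> (forall x, m <= x <= m + rho -> rate (r / x) <= c) ->
  ((expR (- (al * (ln r + 1))) * (2 * m)^-1 * expR (- (al * c)) * rho)%:E <=
   \int[mu]_x (igfun al (al * r) x)%:E)%E.
Proof.
move=> r0 al0 m0 rho0 rhom H.
apply: (@le_trans _ _ (\int[mu]_(x in `[m, (m + rho)%R]) (igfun al (al * r) x)%:E)%E).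
  rewrite EFinM.
  have -> : rho%:E = mu `[m, (m + rho)%R]%classic.
    by rewrite lebesgue_measure_itv/= lte_fin ltrDl rho0 -EFinD addrC addKr.
  rewrite -integral_cst//; apply: ge0_le_integral => //.
  - by move=> x _; rewrite lee_fin !mulr_ge0 ?expR_ge0 ?invr_ge0 ?ltW// mulr_gt0.
  - by apply/measurable_EFinP/measurable_funTS; exact: measurable_igfun.
  - move=> x /=; rewrite in_itv/= => /andP[mx xm].
    have x0 : 0 < x by exact: lt_le_trans mx.
    rewrite lee_fin igfunE//; apply: ler_pM; rewrite ?mulr_ge0 ?expR_ge0 ?invr_ge0 ?mulr_ge0 ?(ltW m0)//.
      rewrite ler_wpM2l ?expR_ge0// lef_pV2 ?posrE ?mulr_gt0//; lra.
    by rewrite ler_expR lerN2 ler_wpM2l// H// mx.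
apply: ge0_subset_integral => //.
- by apply/measurable_EFinP; exact: measurable_igfun.
- by move=> x _; rewrite lee_fin igfun_ge0.
Qed.

Definition far (m eps : R) : set R := [set x | eps <= `|x - m|].

Lemma measurable_far m eps : measurable (far m eps).
Proof.
have mf : measurable_fun setT (fun x : R => `|x - m|).
  by apply: measurableT_comp => //; exact: measurable_funB.
have -> : far m eps = setT `&` (fun x : R => `|x - m|) @^-1` `[eps, +oo[%classic.
  by rewrite setTI; apply/seteqP; split => x; rewrite /far/= in_itv/= andbT.
exact: mf.
Qed.

(** Away from [m] the rate is at least [c], on a short interval next to [m] at most [c / 2]; the
    ratio of the two integrals is thus of order exp(-al c / 2), uniformly in [r] close to [m]. *)
Lemma igfun_concentration (m eps eta : R) : 0 < m -> 0 < eps -> 0 < eta ->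
  exists rho A : R, 0 < rho /\ forall al r : R, A <= al -> `|r - m| <= rho ->
  [/\ 0 < r, (0 < \int[mu]_x (igfun al (al * r) x)%:E)%E,
    (\int[mu]_x (igfun al (al * r) x)%:E < +oo)%E &
    (\int[mu]_(x in far m eps) (igfun al (al * r) x)%:E <=
     eta%:E * \int[mu]_x (igfun al (al * r) x)%:E)%E].
Proof.
move=> m0 eps0 eta0.
have d0 : 0 < 8 * m + 2 * eps by rewrite addr_gt0 ?mulr_gt0.
(* A lower bound of D / (4 m + D) for every D >= eps / 2. With D = |x - r|, [rate_ge] then yields a
   rate of at least q^2 / 2 on the far set. *)
pose q := eps / (8 * m + 2 * eps).
have q0 : 0 < q by rewrite divr_gt0.
have q1 : q < 1 by rewrite ltr_pdivrMr//; lra.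
have [c cE] : exists c, c = 2^-1 * q ^+ 2 by eexists.
have c0 : 0 < c by rewrite cE mulr_gt0 ?exprn_gt0 ?invr_gt0.
have c1 : c <= 2^-1 by rewrite cE; nra.
(* The first bound keeps far points at distance eps / 2 from [r]; the second keeps the rate below c
   / 2 on [m, m + rho]. *)
pose rho := Num.min (eps / 2) (m * c / 4).
have rho0 : 0 < rho.
  rewrite lt_min; apply/andP; split; first by rewrite divr_gt0.
  by apply: divr_gt0; [apply: mulr_gt0|].
have rho1 : rho <= eps / 2 by rewrite ge_min lexx.
have rho2 : rho <= m * c / 4 by rewrite ge_min lexx orbT.
clearbody rho.
(* The quotient of the upper and lower bounds is at most K exp(-al c / 2); the threshold on [al]
   makes it at most [eta] because exp(u) >= u. *)
have [K KE] : exists K, K = expR (c + 1) * (2 * m + 4 / m) * pi * m / rho by eexists.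
have K0 : 0 < K.
  by rewrite KE !mulr_gt0 ?invr_gt0 ?expR_gt0 ?pi_gt0// addr_gt0 ?divr_gt0 ?mulr_gt0.
exists rho, (Num.max 1 (2 * K / (c * eta))); split=> // al r.
rewrite ge_max => /andP[al1 alK] rm.
have al0 : 0 < al by exact: lt_le_trans al1.
have rhom : rho <= m / 2 by nra.
have [r1 r2] : m / 2 <= r /\ r <= 2 * m.
  by move: rm; rewrite ler_norml => /andP[]; split; lra.
have r0 : 0 < r by apply: lt_le_trans r1; rewrite divr_gt0.
have near x : m <= x <= m + rho -> rate (r / x) <= c / 2.
  move=> /andP[x1 x2]; have x0 : 0 < x by exact: lt_le_trans x1.
  apply: (le_trans (rate_le (divr_gt0 r0 x0))).
  rewrite (_ : (r / x - 1) ^+ 2 / (r / x) = (r - x) ^+ 2 / (r * x)); last by field; rewrite !gt_eqF.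
  rewrite ler_pdivrMr ?mulr_gt0//.
  have [ra rb] : - rho <= r - m /\ r - m <= rho by move: rm; rewrite ler_norml => /andP[].
  have h1 : (r - x) ^+ 2 <= 4 * rho ^+ 2.
    have : 0 <= (2 * rho - (r - x)) * (2 * rho + (r - x)) by apply: mulr_ge0; lra.
    have -> : (2 * rho - (r - x)) * (2 * rho + (r - x)) = 4 * rho ^+ 2 - (r - x) ^+ 2 by ring.
    by rewrite subr_ge0.
  have h2 : rho ^+ 2 <= (m * c / 4) ^+ 2.
    by rewrite ler_sqr// nnegrE ?(ltW rho0)// divr_ge0// mulr_ge0 ?(ltW m0) ?(ltW c0).
  have h3 : m / 2 * m <= r * x by apply: ler_pM => //; rewrite ?divr_ge0 ?(ltW m0).
  have h4 : m ^+ 2 * c * c <= m ^+ 2 * c * 2^-1.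
    by rewrite ler_wpM2l// mulr_ge0 ?sqr_ge0 ?(ltW c0).
  have h5 : c / 2 * (m / 2 * m) <= c / 2 * (r * x).
    by rewrite ler_wpM2l// divr_ge0 ?(ltW c0).
  apply: (le_trans h1); apply: le_trans h5.
  apply: (@le_trans _ _ (4 * (m * c / 4) ^+ 2)); first by rewrite ler_pM2l.
  rewrite (_ : 4 * (m * c / 4) ^+ 2 = m ^+ 2 * c * c / 4); last by field.
  rewrite (_ : c / 2 * (m / 2 * m) = m ^+ 2 * c * 2^-1 / 2); last by field.
  have : 0 <= m ^+ 2 * c * 2^-1.
    by apply: mulr_ge0; [apply: mulr_ge0; [exact: sqr_ge0|exact: ltW]|rewrite invr_ge0].
  lra.
have farc x : far m eps x -> 0 < x -> c <= rate (r / x).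
  rewrite /far/= => xm x0.
  apply: le_trans (rate_ge (divr_gt0 r0 x0)).
  rewrite (_ : (r / x - 1) ^+ 2 / (2 * (r / x + 1)) =
    (x - r) ^+ 2 / (2 * (x * (r + x)))); last first.
    by field; rewrite !gt_eqF// addr_gt0.
  rewrite ler_pdivlMr ?mulr_gt0 ?addr_gt0// -[(x - r) ^+ 2]real_normK ?num_real//.
  set D := `|x - r|.
  have D1 : eps / 2 <= D.
    have : `|x - m| <= D + `|r - m|.
      by rewrite (_ : x - m = (x - r) + (r - m)) ?ler_normD//; ring.
    by move: xm rm; lra.
  have xD : x <= r + D by have := ler_norm (x - r); rewrite -/D; lra.
  have D0 : 0 < D by apply: lt_le_trans D1; rewrite divr_gt0.
  have h1 : x * (r + x) <= (4 * m + D) * (4 * m + D).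
    by apply: ler_pM; rewrite ?addr_ge0 ?(ltW x0) ?(ltW r0)//; lra.
  have h2 : q * (4 * m + D) <= D.
    rewrite /q mulrAC ler_pdivrMr//.
    have : 0 <= (D - eps / 2) * (8 * m) by rewrite mulr_ge0 ?mulr_ge0 ?(ltW m0)//; lra.
    have : 0 <= eps * D by rewrite mulr_ge0 ?(ltW eps0) ?(ltW D0).
    nra.
  rewrite (_ : c * (2 * (x * (r + x))) = q ^+ 2 * (x * (r + x))); last by rewrite cE; field.
  apply: (@le_trans _ _ (q ^+ 2 * ((4 * m + D) * (4 * m + D)))).
    by rewrite ler_wpM2l// sqr_ge0.
  rewrite (_ : q ^+ 2 * _ = (q * (4 * m + D)) ^+ 2); last by ring.
  by rewrite ler_sqr// nnegrE ?(ltW D0)// mulr_ge0 ?(ltW q0)// addr_ge0 ?(ltW D0)// mulr_ge0 ?(ltW m0).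
have rho_m : rho <= m by nra.
have Zge := integral_igfun_ge r0 (ltW al0) m0 rho0 rho_m near.
have Zle := integral_igfun_le measurableT r0 al1 (lexx 0)
  (fun x _ x0 => rate_ge0 (divr_gt0 r0 x0)).
have Ble := integral_igfun_le (measurable_far m eps) r0 al1 (ltW c0) farc.
split=> //.
- apply: lt_le_trans Zge; rewrite lte_fin !mulr_gt0 ?expR_gt0 ?invr_gt0 ?mulr_gt0//.
- exact: le_lt_trans Zle (ltry _).
apply: (le_trans Ble); apply: (@le_trans _ _ (eta%:E *
  (expR (- (al * (ln r + 1))) * (2 * m)^-1 * expR (- (al * (c / 2))) * rho)%:E)%E); last first.
  by rewrite lee_wpmul2l// lee_fin ltW.
rewrite -EFinM lee_fin; set L := expR (- (al * (ln r + 1))).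
have L0 : 0 < L by exact: expR_gt0.
pose E := expR (- (al * (c / 2))).
have E0 : 0 < E by exact: expR_gt0.
have -> : expR (- ((al - 1) * c)) = E * E * expR c.
  by rewrite /E -!expRD; congr expR; field.
have EK : E * K <= eta.
  have u0 : 0 < al * (c / 2) by rewrite mulr_gt0 ?divr_gt0.
  have eu := expR_ge1Dx (al * (c / 2)).
  have alK' : 2 * K <= al * (c * eta) by rewrite -ler_pdivrMr ?mulr_gt0.
  have h : al * (c / 2) * eta <= expR (al * (c / 2)) * eta.
    by rewrite ler_wpM2r ?(ltW eta0)//; lra.
  rewrite /E expRN mulrC ler_pdivrMr ?expR_gt0// mulrC.
  by apply: le_trans h; rewrite (_ : al * (c / 2) * eta = al * (c * eta) / 2); [lra|field].
have rr : r + 2 / r <= 2 * m + 4 / m.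
  apply: lerD => //; rewrite ler_pdivrMr// mulrAC ler_pdivlMr//; lra.
have p0 := pi_gt0 R.
apply: (@le_trans _ _ (L * (E * E * expR c) * expR 1 * (2 * m + 4 / m) * (pi / 2))).
  rewrite ler_wpM2r ?divr_ge0 ?(ltW p0)// ler_wpM2l// !mulr_ge0 ?expR_ge0 ?(ltW L0) ?(ltW E0)//.
rewrite -/E (_ : L * (E * E * expR c) * expR 1 * (2 * m + 4 / m) * (pi / 2) =
   (E * K) * (L * (2 * m)^-1 * E * rho)); last first.
  by rewrite KE expRD; field; rewrite !gt_eqF.
by rewrite ler_wpM2r// !mulr_ge0 ?invr_ge0 ?mulr_ge0 ?(ltW L0) ?(ltW E0) ?(ltW m0) ?(ltW rho0).
Qed.

Lemma joint_pdf_igfun n (V : 'M[R]_n) (a b : R) (y : 'cV[R]_n) :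
  V \in unitmx -> 0 < \det V -> 0 < a -> 0 < b ->
  exists2 K : R, 0 < K & forall x, joint_pdf V a b y x =
    K * igfun (a + n%:R / 2) (b + (y^T *m invmx V *m y) 0 0 / 2) x.
Proof.
move=> uV dV a0 b0; set q := (y^T *m invmx V *m y) 0 0.
have G0 : 0 < Gamma a by rewrite Gamma_mixint fine_gt0// mixint_gt0/= ltey_eq mixint_fin_num.
have p0 := pi_gt0 R.
have c0 : 0 < (2 * pi) ^+ n * \det V by rewrite mulr_gt0// exprn_gt0// mulr_gt0.
exists ((Num.sqrt ((2 * pi) ^+ n * \det V))^-1 * (b `^ a / Gamma a)).
  by rewrite mulr_gt0 ?invr_gt0 ?sqrtr_gt0// divr_gt0 ?powR_gt0.
move=> x; rewrite /joint_pdf /inv_gamma_pdf /igfun; case: ifP => x0; last by rewrite !mulr0.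
rewrite /mvnormal_pdf detZ.
rewrite (_ : (2 * pi) ^+ n * (x ^+ n * \det V) = x ^+ n * ((2 * pi) ^+ n * \det V)); last by ring.
rewrite sqrtrM ?exprn_ge0 ?(ltW x0)//.
have -> : Num.sqrt (x ^+ n) = expR (n%:R / 2 * ln x).
  have -> : x ^+ n = expR (n%:R / 2 * ln x) ^+ 2.
    have xE : expR (ln x) = x by rewrite lnK// posrE.
    by rewrite -[in LHS]xE -!expRM_natl; congr expR; field.
  by rewrite sqrtr_sqr ger0_norm ?expR_ge0.
rewrite invmxZ ?unitmxZ ?unitfE ?gt_eqF// -scalemxAr -scalemxAl mxE -/q.
rewrite invfM -expRN /powR !(gt_eqF x0).
set k := (Num.sqrt _)^-1; set l := _ / Gamma a.
rewrite (_ : _ * k * _ * _ = k * l * (expR (- (n%:R / 2 * ln x)) *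
   expR (- (x^-1 * q) / 2) * expR ((- a - 1) * ln x) * expR (- (b / x)))); last by ring.
congr (_ * _); rewrite -!expRD; congr expR; field.
by rewrite gt_eqF.
Qed.

(** [rho] and [A] are chosen before [n], [V] and [y], so that they serve the whole sequence of
    posteriors. *)
Lemma posterior_tail (m eps eta : R) : 0 < m -> 0 < eps -> 0 < eta ->
  exists rho A : R, 0 < rho /\
  forall n (V : 'M[R]_n) (a b : R) (y : 'cV[R]_n),
    V \in unitmx -> 0 < \det V -> 0 < a -> 0 < b -> A <= a + n%:R / 2 ->
    `|(b + (y^T *m invmx V *m y) 0 0 / 2) / (a + n%:R / 2) - m| <= rho ->
    (posterior_sigma2 V a b y (far m eps) <= eta%:E)%E.
Proof.
move=> m0 eps0 eta0; have [rho [A [rho0 H]]] := igfun_concentration m0 eps0 eta0.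
exists rho, A; split=> // n V a b y uV dV a0 b0 An close.
have [K K0 jE] := joint_pdf_igfun y uV dV a0 b0.
set al := a + n%:R / 2 in An close jE; set be := b + _ / 2 in close jE.
have al0 : 0 < al by rewrite ltr_wpDr// divr_ge0.
have [r0 Z0 Zy Bl] := H al (be / al) An close.
rewrite mulrC divfK ?gt_eqF// in Z0 Zy Bl.
have jm (B : set R) : measurable B ->
    joint_measure V a b y B = (K%:E * \int[mu]_(x in B) (igfun al be x)%:E)%E.
  move=> mB; rewrite /joint_measure; under eq_integral do rewrite jE EFinM.
  rewrite ge0_integralZl//.
  - by apply/measurable_EFinP/measurable_funTS; exact: measurable_igfun.
  - by move=> x _; rewrite lee_fin igfun_ge0.
  - by rewrite lee_fin ltW.
set Z := (\int[mu]_x (igfun al be x)%:E)%E in Z0 Zy Bl jm.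
have Zf : Z \is a fin_num by rewrite ge0_fin_numE ?ltW.
have mf := measurable_far m eps.
have -> : posterior_sigma2 V a b y (far m eps) =
    if (joint_measure V a b y setT == 0%E) || (joint_measure V a b y setT == +oo%E)
    then \d_(1%R : R) (far m eps)
    else (joint_measure V a b y (far m eps) *
          ((fine (joint_measure V a b y setT))^-1)%:E)%E.
  by rewrite /posterior_sigma2/= /mnormalize; case: ifP.
rewrite jm// jm// -/Z.
(* The evidence is a positive real, which excludes the default value of [mnormalize]. *)
have KZ : (K%:E * Z)%E = (K * fine Z)%:E by rewrite EFinM fineK.
have fZ0 : 0 < fine Z by rewrite fine_gt0// Z0.
have KZ0 : 0 < K * fine Z by rewrite mulr_gt0.
rewrite KZ eqe gt_eqF//=.
apply: (@le_trans _ _ (K%:E * (eta%:E * Z) * ((K * fine Z)^-1)%:E)%E).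
  rewrite lee_wpmul2r ?lee_fin ?invr_ge0 ?(ltW KZ0)//.
  by rewrite lee_wpmul2l ?lee_fin ?(ltW K0).
rewrite -(fineK Zf) -!EFinM lee_fin le_eqVlt; apply/orP; left; apply/eqP.
by field; rewrite !gt_eqF.
Qed.

End posterior_concentration.

(** * Eigenvalues of the Matern matrix and exponential tails *)

Section cells.
Context {R : realType} {d : nat}.

Lemma bounded_cells (D : set 'rV[R]_d) (B r : R) : 0 < r ->
  (forall s k, D s -> `|s 0 k| <= B) ->
  exists (N : nat) (c : 'rV[R]_d -> 'I_N), forall s t, D s -> D t -> c s = c t ->
    sqdist s t <= r.
Proof.
move=> r0 DB; pose h := Num.min 1 (r / d.+1%:R).
have h0 : 0 < h by rewrite lt_min ltr01 divr_gt0.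
have h1 : h <= 1 by rewrite ge_min lexx.
have h2 : d%:R * h <= r.
  apply: (@le_trans _ _ (d.+1%:R * h)); first by rewrite ler_wpM2r ?ler_nat ?(ltW h0).
  by rewrite mulrC -ler_pdivlMr// ge_min lexx orbT.
pose M := Num.truncn ((2 * B) / h).
pose f (s : 'rV[R]_d) k := Num.truncn ((s 0 k + B) / h).
pose C := {ffun 'I_d -> 'I_M.+1}.
exists #|C|, (fun s => enum_rank ([ffun k => inord (f s k)] : C)) => s t Ds Dt.
move=> /enum_rank_inj/ffunP E.
have pos u k : D u -> 0 <= (u 0 k + B) / h.
  move=> /(DB _ k); rewrite ler_norml => /andP[u1 _].
  by rewrite divr_ge0 ?(ltW h0)// -lerBlDr sub0r.
have fM u k : D u -> (f u k < M.+1)%N.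
  move=> Du; rewrite ltnS /f /M; apply: le_truncn.
  rewrite ler_pM2r ?invr_gt0//.
  by have := DB u k Du; rewrite ler_norml => /andP[_]; lra.
have close k : (s 0 k - t 0 k) ^+ 2 <= h.
  have := E k; rewrite !ffunE => /(congr1 val)/=; rewrite !inordK ?fM// => fst.
  have /andP[s1 s2] := truncn_itv (pos s k Ds).
  have /andP[t1 t2] := truncn_itv (pos t k Dt).
  rewrite -!/(f _ _) fst in s1 s2 t1 t2.
  move: s1 s2 t1 t2; rewrite !ler_pdivlMr// !ltr_pdivrMr// -natr1 mulrDl mul1r => s1 s2 t1 t2.
  have : `|s 0 k - t 0 k| <= h by rewrite ler_norml; apply/andP; split; lra.
  move=> H; rewrite -real_normK ?num_real//; have := normr_ge0 (s 0 k - t 0 k); nra.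
apply: (le_trans _ h2); rewrite /sqdist.
apply: (@le_trans _ _ (\sum_(k < d) h)); first by apply: ler_sum.
by rewrite sumr_const card_ord mulr_natl.
Qed.

(** The case n = 1 is enough: there [fill_distance] is the supremum of the distances to one point,
    and the positive lower bound excludes the value 0 that [sup] takes on an unbounded set. *)
Lemma infill_bounded (D : set 'rV[R]_d) (s : forall n, 'I_n -> 'rV[R]_d) :
  asymp (fun n => fill_distance D (s n)) (fun n => n%:R `^ (- d%:R^-1)) ->
  exists B : R, forall t k, D t -> `|t 0 k| <= B.
Proof.
move=> [c [C [c0 C0 H]]]; have /andP[H1 _] := H 1%N isT.
pose E := [set inf [set dist t (s 1%N i) | i in [set: 'I_1]] | t in D].
have supE : sup E != 0.
  apply: contraTneq H1 => e; rewrite /fill_distance -/E e mul0r -ltNge//.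
have [y Ey] : has_ubound E.
  apply: contrapT => nE; move/eqP: supE; apply.
  by apply: sup_out => -[_].
pose p := s 1%N ord0.
exists (y + \sum_k `|p 0 k|) => t k Dt.
have dy : dist t p <= y.
  have : inf [set dist t (s 1%N i) | i in [set: 'I_1]] <= y by apply: Ey; exists t.
  rewrite (_ : [set dist t (s 1%N i) | i in _] = [set dist t p]) ?inf1//.
  apply/seteqP; split => [_ [i _ <-]|_ ->]; last by exists ord0.
  by rewrite (ord1 i).
have tp : `|t 0 k - p 0 k| <= dist t p.
  rewrite -sqrtr_sqr /dist ler_wsqrtr// (bigD1 k)//= lerDl sumr_ge0// => j _.
  exact: sqr_ge0.
have pk : `|p 0 k| <= \sum_k `|p 0 k|.
  by rewrite (bigD1 k)//= lerDl sumr_ge0.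
rewrite (_ : t 0 k = (t 0 k - p 0 k) + p 0 k); last by rewrite subrK.
by apply: (le_trans (ler_normD _ _)); apply: lerD => //; exact: le_trans dy.
Qed.

Lemma matern_eigen_small (D : set 'rV[R]_d) (B nu phi k eta : R) :
  (forall t i, D t -> `|t 0 i| <= B) -> 0 < nu -> 0 < phi -> 0 < k -> 0 < eta ->
  exists n0 : nat, forall n, (n0 <= n)%N ->
  forall (s : 'I_n -> 'rV[R]_d) (U : 'M[R]_n) (m : 'rV[R]_n),
    (forall i, D (s i)) -> orthogonal U ->
    matern_mx nu phi s = U *m diag_mx m *m U^T -> (forall i, 0 <= m 0 i) ->
    \sum_i m 0 i / (m 0 i + k) <= eta * n%:R.
Proof.
move=> DB nu0 p0 k0 eta0.
(* With this kernel accuracy [cell_trace_bound] gives N + n eta / 2, and [n0] makes the fixed number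
   [N] of cells at most n eta / 2. *)
have e0 : 0 < eta * k / 2 by rewrite divr_gt0 ?mulr_gt0.
have [r r0 near1] := @matern_near1 R d nu phi _ nu0 p0 e0.
have [N [c cP]] := bounded_cells r0 DB.
exists (Num.bound (2 * N%:R / eta)) => n nn s U m Ds oU E m0.
have NN : N%:R <= eta / 2 * n%:R.
  have := archi_boundP (divr_ge0 (mulr_ge0 (ler0n R 2) (ler0n R N)) (ltW eta0)).
  move=> /ltW/le_trans/(_ (_ : _ <= n%:R)).
  rewrite ler_nat => /(_ nn); rewrite ler_pdivrMr//; lra.
have := @cell_trace_bound R n N (matern_mx nu phi s) U m (fun i => c (s i))
  (eta * k / 2) k oU E m0 k0.
move=> /(_ _ _)/le_trans; apply.
- by move=> i; rewrite mxE /matern eqxx.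
- by move=> i j cij; rewrite mxE; apply: near1; exact: cP.
rewrite (_ : n%:R * (eta * k / 2) / k = eta / 2 * n%:R); last by field; rewrite gt_eqF.
by rewrite (_ : eta * n%:R = eta / 2 * n%:R + eta / 2 * n%:R); [exact: lerD|field].
Qed.

End cells.

(** * Exponential tail bounds and almost sure convergence *)

Section tails.
Context {R : realType} {disp : measure_display} {T : measurableType disp}
  (P : probability T R).

Lemma measurable_geset (Y : T -> R) (t : R) : measurable_fun setT Y ->
  measurable [set w | (t <= Y w)%R].
Proof.
move=> mY; have -> : [set w | t <= Y w] = setT `&` Y @^-1` `[t, +oo[%classic.
  by rewrite setTI; apply/seteqP; split => w /=; rewrite in_itv/= andbT.
exact: mY.
Qed.

Lemma chernoff (Y : T -> R) (t b : R) : measurable_fun setT Y ->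
  (\int[P]_w (expR (Y w))%:E <= (expR b)%:E)%E ->
  (P [set w | (t <= Y w)%R] <= (expR (b - t))%:E)%E.
Proof.
move=> mY H.
have mA := measurable_geset t mY.
rewrite expRD expRN EFinM -[leLHS]mul1e -(_ : (expR t)%:E * ((expR t)^-1)%:E = 1)%E; last first.
  by rewrite -EFinM divff// gt_eqF// expR_gt0.
rewrite muleAC lee_wpmul2r ?lee_fin ?invr_ge0 ?expR_ge0//.
apply: le_trans H; rewrite -integral_cst//.
apply: (@le_trans _ _ (\int[P]_(w in [set w | (t <= Y w)%R]) (expR (Y w))%:E)%E).
  apply: ge0_le_integral => //.
  - by move=> w _; rewrite lee_fin expR_ge0.
  - by apply/measurable_EFinP/measurable_funTS; exact: measurableT_comp.
  - by move=> w /= tY; rewrite lee_fin ler_expR.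
apply: ge0_subset_integral => //.
by apply/measurable_EFinP; exact: measurableT_comp.
Qed.

Lemma borel_cantelli_exp (F : nat -> set T) (g : R) (n0 : nat) : 0 < g ->
  (forall n, measurable (F n)) ->
  (forall n, (n0 <= n)%N -> (P (F n) <= (expR (- (g * n%:R)))%:E)%E) ->
  {ae P, forall w, exists N, forall n, (N <= n)%N -> ~ F n w}.
Proof.
move=> g0 mF PF; pose G n := if (n0 <= n)%N then F n else set0.
have mG n : measurable (G n) by rewrite /G; case: ifP.
pose q := expR (- g).
have q1 : q < 1 by rewrite /q -expR0 ltr_expR oppr_lt0.
have q0 : 0 < q by exact: expR_gt0.
have PG n : (P (G n) <= (q ^+ n)%:E)%E.
  rewrite /G /q -expRM_natl; case: ifP => [n0n|_].
    by apply: (le_trans (PF _ n0n)); rewrite lee_fin ler_expR; lra.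
  by rewrite measure0 lee_fin expR_ge0.
have S : (\sum_(n <oo) P (G n) < +oo)%E.
  apply: (@le_lt_trans _ _ ((1 - q)^-1)%:E); last exact: ltry.
  apply: lime_le; first exact: is_cvg_nneseries.
  apply: nearW => n; apply: (@le_trans _ _ (\sum_(0 <= i < n) (q ^+ i)%:E)%E).
    exact: lee_sum.
  rewrite sumEFin lee_fin big_mkord; have := subrX1 q n.
  rewrite -[(1 - q)^-1]mul1r ler_pdivlMr ?subr_gt0// => Sq.
  by have := exprn_ge0 n (ltW q0); nra.
have N0 := lim_sup_set_cvg0 mG S.
exists (lim_sup_set G); split=> //.
  apply: bigcap_measurable => [|k _]; first by exists 0%N.
  exact: bigcup_measurable.
move=> w /= /forallNP H k _.
have /existsNP[n /not_implyP[nk /contrapT Fn]] := H (maxn k n0).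
exists n; first by rewrite /= (leq_trans _ nk)// leq_maxl.
by rewrite /G (leq_trans _ nk)// leq_maxr.
Qed.

Lemma ae_cvg0_exp (Z : nat -> T -> R) :
  (forall n, measurable_fun setT (Z n)) ->
  (forall t : R, 0 < t -> exists (g : R) (n0 : nat), 0 < g /\
    forall n, (n0 <= n)%N ->
      (P [set w | (t <= `|Z n w|)%R] <= (expR (- (g * n%:R)))%:E)%E) ->
  {ae P, forall w, Z n w @[n --> \oo] --> (0 : R)}.
Proof.
move=> mZ H.
have A k : {ae P, forall w, exists N, forall n, (N <= n)%N ->
    ~ [set w | k.+1%:R^-1 <= `|Z n w|] w}.
  have [g [n0 [g0 Hg]]] := H k.+1%:R^-1 ltac:(by rewrite invr_gt0).
  apply: (borel_cantelli_exp g0 _ Hg) => n; apply: measurable_geset.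
  exact: measurableT_comp.
have := ae_foralln A.
apply: filterS => w Hw; apply/cvgrPdist_lt => e e0.
have [k ke] : exists k : nat, k.+1%:R^-1 < e.
  exists (Num.bound e^-1); rewrite invf_plt ?posrE//.
  apply: lt_trans (archi_boundP _) _; first by rewrite invr_ge0 ltW.
  by rewrite ltr_nat.
have [N HN] := Hw k; exists N => // n /= /HN /negP; rewrite -ltNge => Zk.
by rewrite sub0r normrN (lt_trans Zk).
Qed.

(** After squaring: 1 / (1 - x) <= 1 + x + 2 x^2 <= exp(x + 2 x^2), where the first step is x^2 (1 -
    2 x) >= 0. *)
Lemma inv_sqrt_le_expR (x : R) : x <= 2^-1 ->
  (Num.sqrt (1 - x))^-1 <= expR (x / 2 + x ^+ 2).
Proof.
move=> x1; have x0 : 0 < 1 - x by lra.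
rewrite -(ler_pXn2r (ltn0Sn 1)) ?nnegrE ?invr_ge0 ?sqrtr_ge0 ?expR_ge0//.
rewrite exprVn sqr_sqrtr ?(ltW x0)// -expRM_natl.
apply: (@le_trans _ _ (1 + (x + 2 * x ^+ 2))); last first.
  by rewrite (_ : 2 * (x / 2 + x ^+ 2) = x + 2 * x ^+ 2) ?expR_ge1Dx//; field.
rewrite -div1r ler_pdivrMr// -subr_ge0.
rewrite (_ : _ - 1 = x ^+ 2 * (1 - 2 * x)); last by ring.
by rewrite mulr_ge0 ?sqr_ge0//; lra.
Qed.

(** The rotated coordinates have the moment generating function of independent normals of variances
    m_i, and [quadratic_mgf] applies at exponent 1/2. The sum of [w i * m 0 i] in the bound is the
    mean of the form. *)
Lemma rotated_quadratic_tail n (X : 'I_n -> T -> R) (S U : 'M[R]_n) (m : 'rV[R]_n)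
    (w : 'I_n -> R) (t : R) :
  (forall i, measurable_fun setT (X i)) ->
  orthogonal U -> S = U *m diag_mx m *m U^T ->
  (forall a : 'I_n -> R, (\int[P]_w (expR (\sum_i a i * X i w))%:E =
     (expR (quadform (fun i j => S i j) a / 2))%:E)%E) ->
  (forall i, 0 <= m 0 i) -> (forall i, 0 <= w i) -> (forall i, w i * m 0 i <= 2^-1) ->
  (P [set o | (t <= \sum_i w i * (\sum_k U k i * X k o) ^+ 2)%R] <=
   (expR (\sum_i w i * m 0 i - t / 2))%:E)%E.
Proof.
move=> mX oU SE mgf m0 w0 wm.
pose X' i o := \sum_k U k i * X k o.
have mX' i : measurable_fun setT (X' i).
  by apply: measurable_sum => k; exact: measurable_funM.
have mgf' (c : 'I_n -> R) : (\int[P]_o (expR (\sum_i c i * X' i o))%:E =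
   (expR ((\sum_i m 0 i * c i ^+ 2) / 2))%:E)%E.
  pose x : 'cV[R]_n := \col_i c i.
  pose a i := (U *m x) i 0.
  have -> : \sum_i m 0 i * c i ^+ 2 = quadform (fun i j => S i j) a.
    rewrite -quadform_mx SE diagonalized_quad; apply: eq_bigr => i _.
    by rewrite mulmxA oU.2 mul1mx mxE.
  rewrite -mgf; apply: eq_integral => o _; congr (expR _)%:E.
  rewrite /X' /a; under eq_bigr do rewrite mulr_sumr.
  rewrite exchange_big/=; apply: eq_bigr => k _; rewrite mxE mulr_suml.
  by apply: eq_bigr => i _; rewrite mxE; ring.
have := @quadratic_mgf R _ _ P n X' (fun i => m 0 i) w mX' w0.
have wm1 i : w i * m 0 i < 1 by apply: le_lt_trans (wm i) _; lra.
move=> /(_ wm1 mgf') E.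
have := @chernoff (fun o => (\sum_i w i * X' i o ^+ 2) / 2) (t / 2) (\sum_i w i * m 0 i).
rewrite (_ : [set o | t / 2 <= _] = [set o | t <= \sum_i w i * X' i o ^+ 2]); last first.
  by apply/seteqP; split => o /=; rewrite ler_pM2r// invr_gt0.
apply.
  apply: measurable_funM => //; apply: measurable_sum => i.
  by apply: measurable_funM => //; exact: measurable_funX.
rewrite E lee_fin expR_sum; apply: ler_prod => i _.
rewrite invr_ge0 sqrtr_ge0/=.
apply: (le_trans (inv_sqrt_le_expR (wm i))); rewrite ler_expR.
have : 0 <= w i * m 0 i by rewrite mulr_ge0.
(* x / 2 + x^2 <= x for 0 <= x <= 1/2. *)
have := wm i; nra.
Qed.

(** [c] may have either sign, which covers both tails. The sum is centred, so only a term quadratic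
    in [c] competes with [t]. *)
Lemma sum_sq_tail n (X : 'I_n -> T -> R) (v c t : R) :
  (forall i, measurable_fun setT (X i)) -> 0 < v ->
  (forall i A, measurable A -> P (X i @^-1` A) = gauss v A) ->
  (forall A : 'I_n -> set R, (forall i, measurable (A i)) ->
    P (\bigcap_i (X i @^-1` A i)) = (\prod_(i < n) P (X i @^-1` A i))%E) ->
  `|2 * c * v| <= 2^-1 ->
  (P [set o | (t <= c * (\sum_i X i o ^+ 2 - n%:R * v))%R] <=
   (expR (n%:R * (2 * c * v) ^+ 2 - t))%:E)%E.
Proof.
move=> mX v0 lX ind cv.
have cv1 : 2 * c * v <= 2^-1 by apply: le_trans cv; exact: ler_norm.
have cv2 : 2 * c * v < 1 by apply: le_lt_trans cv1 _; lra.
apply: chernoff.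
  apply: measurable_funM => //; apply: measurable_funB => //.
  by apply: measurable_sum => i; exact: measurable_funX.
have mh : measurable_fun setT (fun x : R => expR (c * x ^+ 2)).
  by apply: measurableT_comp => //; apply: measurable_funM => //; exact: measurable_funX.
have := @independent_prod_integral R _ _ P n X (fun _ x => expR (c * x ^+ 2))
  (fun _ => (Num.sqrt (1 - 2 * c * v))^-1) mX ind (fun _ => mh)
  (fun _ _ => expR_ge0 _) (fun i => gauss_sq_mgf (mX i) (lX i) v0 cv2).
rewrite prodr_const card_ord => E.
rewrite (eq_integral (fun o => ((expR (- (c * n%:R * v)))%:E *
   (\prod_i expR (c * X i o ^+ 2))%:E)%E)); last first.
  move=> o _; rewrite -EFinM -expR_sum -expRD; congr (expR _)%:E.
  by rewrite -mulr_sumr; ring.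
rewrite ge0_integralZl//; last 2 first.
- apply/measurable_EFinP; under eq_fun do rewrite -expR_sum.
  apply: measurableT_comp => //; apply: measurable_sum => i.
  by apply: measurable_funM => //; exact: measurable_funX.
- by move=> o _; rewrite lee_fin prodr_ge0// => i _; exact: expR_ge0.
rewrite E -EFinM lee_fin.
have -> : expR (n%:R * (2 * c * v) ^+ 2) =
    expR (- (c * n%:R * v)) * expR (2 * c * v / 2 + (2 * c * v) ^+ 2) ^+ n.
  by rewrite -expRM_natl -expRD; congr expR; field.
rewrite ler_wpM2l ?expR_ge0// lerXn2r ?nnegrE ?invr_ge0 ?sqrtr_ge0 ?expR_ge0//.
exact: inv_sqrt_le_expR.
Qed.

End tails.

(** * From the limit of the quadratic form to the limit of the posterior *)

Section limits.
Context {R : realType}.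

Lemma inv_shift_perturb n (S : 'M[R]_n) (k t : R) (q : 'cV[R]_n -> R) z e :
  S^T = S -> psd (fun i j => S i j) -> 0 < k -> 0 < t ->
  (forall x, q x = (x^T *m invmx (S + k%:M) *m x) 0 0) ->
  `|q (z + e) - q e| <= (1 + t^-1) * q z + t * q e.
Proof.
move=> sS pS k0 t0 qdef.
have [U [m [oU E]]] := symmetric_spectral sS.
have m0 i : 0 <= m 0 i by apply: (diagonalized_psd_ge0 oU); rewrite -E.
have qE x : q x = \sum_i (U^T *m x) i 0 ^+ 2 / (m 0 i + k).
  by rewrite qdef E; exact: (inv_shift_quad x oU k0 m0).2.
rewrite !qE -sumrB !mulr_sumr -big_split/=.
apply: (le_trans (ler_norm_sum _ _ _)); apply: ler_sum => i _.
rewrite mulmxDr mxE; set a := (U^T *m z) i 0; set b := (U^T *m e) i 0.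
have u0 : 0 <= (m 0 i + k)^-1 by rewrite invr_ge0 addr_ge0 ?(ltW k0).
rewrite -mulrBl normrM (ger0_norm u0) !mulrA -mulrDl ler_wpM2r//.
have -> : (a + b) ^+ 2 - b ^+ 2 = a ^+ 2 + 2 * (a * b) by ring.
have h1 : 2 * (a * b) <= t^-1 * a ^+ 2 + t * b ^+ 2.
  rewrite -subr_ge0 (_ : _ - _ = t^-1 * (a - t * b) ^+ 2); last by field; rewrite gt_eqF.
  by rewrite mulr_ge0 ?sqr_ge0 ?invr_ge0 ?(ltW t0).
have h2 : - (2 * (a * b)) <= t^-1 * a ^+ 2 + t * b ^+ 2.
  rewrite -subr_ge0 (_ : _ - _ = t^-1 * (a + t * b) ^+ 2); last by field; rewrite gt_eqF.
  by rewrite mulr_ge0 ?sqr_ge0 ?invr_ge0 ?(ltW t0).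
have a2 := sqr_ge0 a.
by rewrite ler_norml mulrDl mul1r; apply/andP; split; lra.
Qed.

Lemma cvg_perturb (qy qz qe : nat -> R) (L : R) : 0 <= L ->
  (forall n t, 0 < t -> `|qy n - qe n| <= (1 + t^-1) * qz n + t * qe n) ->
  qz n @[n --> \oo] --> (0 : R) -> qe n @[n --> \oo] --> L ->
  qy n @[n --> \oo] --> L.
Proof.
move=> L0 H cz ce; apply/cvgrPdist_le => e e0.
(* [qe] is eventually at most L + 1, so t qe <= e / 4; with [t] now fixed, the vanishing [qz]
   absorbs the factor 1 + 1/t. *)
pose t := e / (4 * (L + 1)).
have L1 : 0 < L + 1 by rewrite ltr_wpDl.
have t0 : 0 < t by rewrite divr_gt0 ?mulr_gt0.
have K0 : 0 < 1 + t^-1 by rewrite addr_gt0 ?invr_gt0.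
have d0 : 0 < e / 4 / (1 + t^-1) by rewrite !divr_gt0.
have e20 : 0 < Num.min (e / 2) 1 by rewrite lt_min ltr01 divr_gt0.
have [N1 _ HN1] := (cvgrPdist_le _ _).1 cz _ d0.
have [N2 _ HN2] := (cvgrPdist_le _ _).1 ce _ e20.
exists (maxn N1 N2) => // n /= nN.
have := HN1 n (leq_trans (leq_maxl _ _) nN); rewrite /= sub0r normrN => Hz.
have := HN2 n (leq_trans (leq_maxr _ _) nN); rewrite /= le_min => /andP[He1 He2].
have Hq := H n t t0.
have Hz' : (1 + t^-1) * qz n <= e / 4.
  rewrite mulrC -ler_pdivlMr//; apply: le_trans Hz; exact: ler_norm.
have He' : t * qe n <= e / 4.
  have qL : qe n <= L + 1 by move: He2; rewrite ler_norml => /andP[]; lra.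
  apply: (@le_trans _ _ (t * (L + 1))); first by rewrite ler_wpM2l ?(ltW t0).
  by rewrite /t le_eqVlt; apply/orP; left; apply/eqP; field; rewrite gt_eqF.
rewrite (_ : L - qy n = (L - qe n) - (qy n - qe n)); last by ring.
by apply: (le_trans (ler_normB _ _)); lra.
Qed.

Lemma diagonalized_det n (U : 'M[R]_n) (m : 'rV[R]_n) : orthogonal U ->
  \det (U *m diag_mx m *m U^T) = \prod_i m 0 i.
Proof.
move=> oU; rewrite !det_mulmx mulrAC -det_mulmx oU.1 det1 mul1r det_diag.
by [].
Qed.

Lemma det_shift_gt0 n (S : 'M[R]_n) (k : R) : S^T = S -> psd (fun i j => S i j) ->
  0 < k -> (S + k%:M) \in unitmx /\ 0 < \det (S + k%:M).
Proof.
move=> sS pS k0; have [U [m [oU E]]] := symmetric_spectral sS.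
have m0 i : 0 <= m 0 i by apply: (diagonalized_psd_ge0 oU); rewrite -E.
split; first by have [] := inv_shift_quad 0 oU k0 m0; rewrite -E.
rewrite E diagonalizedD// diagonalized_det//; apply: prodr_gt0 => i _.
by rewrite !mxE ltr_wpDl.
Qed.

Lemma weak_cvg_dirac (p : nat -> probability R R) (m : R) :
  (forall eps eta : R, 0 < eps -> 0 < eta -> exists N : nat, forall n, (N <= n)%N ->
     (p n (far m eps) <= eta%:E)%E) ->
  weak_cvg p \d_m.
Proof.
move=> H f cf [M fM].
have mf : measurable_fun setT f by exact: continuous_measurable_fun.
have mfE : measurable_fun setT (EFin \o f) by exact/measurable_EFinP.
rewrite integral_dirac// diracT mul1e.
have M0 : 0 <= M by apply: le_trans (fM 0).
have fin (q : probability R R) (g : R -> R) (K : R) : measurable_fun setT g ->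
    (forall x, `|g x| <= K) -> q.-integrable setT (EFin \o g).
  move=> mg gK.
  apply: (le_integrable measurableT _ _ (finite_measure_integrable_cst q K measurableT)).
    exact/measurable_EFinP.
  move=> x _ /=; rewrite lee_fin; apply: (le_trans (gK x)); exact: ler_norm.
apply/fine_cvgP; split.
  by apply: nearW => n; apply: integrable_fin_num => //; exact: fin.
apply/cvgrPdist_le => e e0.
have e20 : 0 < e / 2 by rewrite divr_gt0.
have [eps /= eps0 He] := (cvgrPdist_le _ _).1 (cf m) _ e20.
(* [f] moves by at most e / 2 near [m] and by at most 2 M on the far set; the added 1 keeps the
   divisor positive when M = 0. *)
have eta0 : 0 < e / 2 / (2 * M + 1) by rewrite !divr_gt0// ltr_wpDl ?mulr_ge0.
have [N HN] := H eps _ eps0 eta0.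
exists N => // n /= Nn.
have cstE (c : R) : (\int[p n]__ c%:E = c%:E)%E.
  rewrite integral_cst// -[RHS]mule1; congr (_ * _)%E; exact: probability_setT.
pose g x := f m - f x.
have mg : measurable_fun setT g by exact: measurable_funB.
have gM x : `|g x| <= 2 * M.
  by apply: (le_trans (ler_normB _ _)); have := fM m; have := fM x; lra.
have ig := fin (p n) g _ mg gM.
have iff := fin (p n) f _ mf fM.
have -> : f m - fine (\int[p n]_x (f x)%:E)%E = \int[p n]_x g x.
  rewrite /g RintegralB//; last exact: finite_measure_integrable_cst.
  by rewrite [X in _ = X - _]/Rintegral cstE.
apply: (le_trans (le_normr_Rintegral _ _)) => //.
rewrite -lee_fin fineK; last first.
  apply: integrable_fin_num => //.
  by apply: (fin _ _ (2 * M)) => [|x]; [exact: measurableT_comp|rewrite normr_id].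
have mfar := measurable_far m eps.
apply: (@le_trans _ _ (\int[p n]_x ((e / 2)%:E + (2 * M)%:E * (\1_(far m eps) x)%:E))%E).
  apply: ge0_le_integral => //.
  - by apply/measurable_EFinP; exact: measurableT_comp.
  - apply: emeasurable_funD => //; apply: emeasurable_funM => //.
    by apply/measurable_EFinP; exact: measurable_indic.
  - move=> x _; rewrite -EFinM -EFinD lee_fin indicE.
    have [xf|xf] := boolP (x \in far m eps).
      by rewrite mulr1; have := gM x; lra.
    rewrite mulr0 addr0; apply: He => /=; rewrite distrC ltNge; apply/negP => mx.
    by move/negP: xf; apply; rewrite inE.
rewrite ge0_integralD//; last 3 first.
- by move=> x _; rewrite lee_fin (ltW e20).
- by move=> x _; rewrite mule_ge0 ?lee_fin ?mulr_ge0.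
- apply: emeasurable_funM => //.
  by apply/measurable_EFinP; exact: measurable_indic.
rewrite cstE ge0_integralZl//; last 2 first.
- by apply/measurable_EFinP; exact: measurable_indic.
- by rewrite lee_fin mulr_ge0.
rewrite integral_indic// setIT.
apply: (@le_trans _ _ ((e / 2)%:E + (2 * M)%:E * (e / 2 / (2 * M + 1))%:E)%E).
  by rewrite leeD2l// lee_wpmul2l ?lee_fin ?mulr_ge0// HN.
rewrite -EFinM -EFinD lee_fin.
have M1 : 0 < 2 * M + 1 by rewrite ltr_wpDl ?mulr_ge0.
have : 2 * M * (e / 2 / (2 * M + 1)) <= e / 2.
  by rewrite mulrA ler_pdivrMr//; nra.
lra.
Qed.

Lemma posterior_far_cvg (V : forall n, 'M[R]_n) (y : forall n, 'cV[R]_n) (a b L : R) :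
  0 < a -> 0 < b -> 0 < L ->
  (forall n, V n \in unitmx /\ 0 < \det (V n)) ->
  ((y n)^T *m invmx (V n) *m y n) 0 0 / n%:R @[n --> \oo] --> L ->
  forall eps eta : R, 0 < eps -> 0 < eta -> exists N : nat, forall n, (N <= n)%N ->
    (posterior_sigma2 (V n) a b (y n) (far L eps) <= eta%:E)%E.
Proof.
move=> a0 b0 L0 HV cQ eps eta eps0 eta0.
have [rho [A [rho0 H]]] := posterior_tail L0 eps0 eta0.
have r20 : 0 < rho / 2 by rewrite divr_gt0.
have [N1 _ HN1] := (cvgrPdist_le _ _).1 cQ _ r20.
(* Beyond [B] the shape exceeds [A] and the contribution b - L a of the prior is below n rho / 4; B
   >= 0 also forces n > 0. *)
pose B := Num.max (2 * `|A|) (4 * `|b - L * a| / rho).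
have B0 : 0 <= B by rewrite le_max mulr_ge0.
exists (maxn N1 (Num.bound B).+1) => n nN.
have n1 := HN1 n (leq_trans (leq_maxl _ _) nN).
have n2 : B < n%:R.
  apply: lt_le_trans (archi_boundP B0) _.
  by rewrite ler_nat; apply: leq_trans nN; rewrite leq_max leqnSn orbT.
have n0 : 0 < n%:R :> R by exact: le_lt_trans n2.
have al0 : 0 < a + n%:R / 2 by rewrite addr_gt0 ?divr_gt0.
have [n3 n4] : 2 * `|A| < n%:R /\ 4 * `|b - L * a| / rho < n%:R.
  by split; apply: le_lt_trans n2; rewrite le_max lexx ?orbT.
have [uV dV] := HV n.
apply: H => //.
  by have := ler_norm A; lra.
move: n1; rewrite /=; set q := _ 0 0 => n1.
have -> : (b + q / 2) / (a + n%:R / 2) - L =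
   ((b - L * a) - n%:R / 2 * (L - q / n%:R)) / (a + n%:R / 2).
  by field; rewrite !gt_eqF//; lra.
rewrite normrM normfV (gtr0_norm al0) ler_pdivrMr//.
apply: (le_trans (ler_normB _ _)).
rewrite normrM (@ger0_norm _ (n%:R / 2)) ?divr_ge0//.
have h1 : n%:R / 2 * `|L - q / n%:R| <= n%:R / 2 * (rho / 2).
  by rewrite ler_wpM2l// divr_ge0.
have h2 : `|b - L * a| <= n%:R / 2 * (rho / 2).
  by move: n4; rewrite ltr_pdivrMr//; lra.
have h3 : 0 <= rho * a by rewrite mulr_ge0 ?ltW.
nra.
Qed.

End limits.

(** * Quadratic forms of the Matern model *)

Section model.
Context {R : realType} {d : nat} {disp : measure_display}
  {T : measurableType disp} (P : probability T R).

Lemma measurable_quad n (M : 'M[R]_n) (X : 'I_n -> T -> R) :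
  (forall i, measurable_fun setT (X i)) ->
  measurable_fun setT (fun w => ((\col_i X i w)^T *m M *m \col_i X i w) 0 0).
Proof.
move=> mX; rewrite (_ : (fun w => _) = fun w => \sum_i \sum_j X i w * X j w * M i j).
  apply: measurable_sum => i; apply: measurable_sum => j.
  by apply: measurable_funM => //; exact: measurable_funM.
apply/funext => w; rewrite quadform_mx; apply: eq_bigr => i _; apply: eq_bigr => j _.
by rewrite !mxE.
Qed.

Lemma matern_sym (nu phi : R) (s t : 'rV[R]_d) : matern nu phi s t = matern nu phi t s.
Proof.
have dC : dist s t = dist t s.
  by rewrite /dist; congr Num.sqrt; apply: eq_bigr => k _; rewrite -sqrrN opprB.
by rewrite /matern dC eq_sym.
Qed.

Lemma matern_mx_sym n (nu phi : R) (s : 'I_n -> 'rV[R]_d) :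
  (matern_mx nu phi s)^T = matern_mx nu phi s.
Proof. by apply/matrixP => i j; rewrite !mxE matern_sym. Qed.

Lemma matern_mx_quadform n (nu phi : R) (s : 'I_n -> 'rV[R]_d) a :
  quadform (fun i j => matern_mx nu phi s i j) a =
  quadform (fun i j => matern nu phi (s i) (s j)) a.
Proof. by apply: eq_quadform => i j; rewrite mxE. Qed.

Lemma matern_mx_psd n (nu phi : R) (s : 'I_n -> 'rV[R]_d) : 0 < nu -> 0 < phi ->
  psd (fun i j => matern_mx nu phi s i j).
Proof.
by move=> nu0 p0 a; rewrite matern_mx_quadform; exact: matern_psd.
Qed.

Lemma gaussian_process_mgf (D : set 'rV[R]_d) (z : 'rV[R]_d -> {RV P >-> R})
    (sigma2 nu phi : R) n (s : 'I_n -> 'rV[R]_d) (a : 'I_n -> R) :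
  gaussian_process D z (fun s t => sigma2 * matern nu phi s t) ->
  0 <= sigma2 -> 0 < nu -> 0 < phi -> (forall i, D (s i)) ->
  (\int[P]_w (expR (\sum_i a i * z (s i) w))%:E =
   (expR (quadform (fun i j => (sigma2 *: matern_mx nu phi s) i j) a / 2))%:E)%E.
Proof.
move=> gp s20 nu0 p0 Ds.
have mz i : measurable_fun setT (z (s i)) by [].
have E : quadform (fun i j => (sigma2 *: matern_mx nu phi s) i j) a =
    \sum_(i < n) \sum_(j < n) a i * a j * (sigma2 * matern nu phi (s i) (s j)).
  by apply: eq_bigr => i _; apply: eq_bigr => j _; rewrite !mxE.
have v0 : 0 <= quadform (fun i j => (sigma2 *: matern_mx nu phi s) i j) a.
  rewrite (eq_quadform a (N := fun i j => sigma2 * matern_mx nu phi s i j)).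
    by rewrite quadformZ mulr_ge0// matern_mx_psd.
  by move=> i j; rewrite mxE.
have mS : measurable_fun setT (fun w => \sum_i a i * z (s i) w).
  by apply: measurable_sum => i; exact: measurable_funM.
have := gauss_mgf 1 mS (fun A mA => gp n s a Ds A mA); rewrite -E => /(_ v0).
rewrite expr1n mul1r => <-; apply: eq_integral => w _.
by rewrite mul1r.
Qed.

Lemma white_noise_mgf (D : set 'rV[R]_d) (eps : 'rV[R]_d -> {RV P >-> R}) (tau2 : R)
    n (s : 'I_n -> 'rV[R]_d) (a : 'I_n -> R) :
  white_noise D eps tau2 -> 0 < tau2 -> (forall i, D (s i)) -> injective s ->
  (\int[P]_w (expR (\sum_i a i * eps (s i) w))%:E =
   (expR (quadform (fun i j => (tau2%:M : 'M[R]_n) i j) a / 2))%:E)%E.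
Proof.
move=> [law ind] t0 Ds sI.
have me i : measurable_fun setT (eps (s i)) by [].
have mh i : measurable_fun setT (fun x : R => expR (a i * x)).
  by apply: measurableT_comp => //; exact: measurable_funM.
have := @independent_prod_integral R _ _ P n (fun i => eps (s i))
  (fun i x => expR (a i * x)) (fun i => expR (a i ^+ 2 * tau2 / 2)) me
  (fun A mA => ind n s A Ds sI mA) mh (fun _ _ => expR_ge0 _)
  (fun i => gauss_mgf (a i) (me i) (law (s i) (Ds i)) (ltW t0)).
rewrite -expR_sum => E.
rewrite (eq_integral (fun w => (\prod_i expR (a i * eps (s i) w))%:E)); last first.
  by move=> w _; rewrite expR_sum.
rewrite E; congr (expR _)%:E; rewrite -mulr_suml; congr (_ / 2).
rewrite /quadform; apply: eq_bigr => i _; rewrite (bigD1 i)//= big1 ?addr0.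
  by rewrite mxE eqxx mulr1n expr2.
by move=> j ji; rewrite mxE eq_sym (negbTE ji) mulr0n mulr0.
Qed.

Lemma inv_shift_ge0 n (S : 'M[R]_n) (k : R) (x : 'cV[R]_n) :
  S^T = S -> psd (fun i j => S i j) -> 0 < k ->
  0 <= (x^T *m invmx (S + k%:M) *m x) 0 0.
Proof.
move=> sS pS k0; have [U [m [oU E]]] := symmetric_spectral sS.
have m0 i : 0 <= m 0 i by apply: (diagonalized_psd_ge0 oU); rewrite -E.
rewrite E (inv_shift_quad x oU k0 m0).2; apply: sumr_ge0 => i _.
by rewrite divr_ge0 ?sqr_ge0// addr_ge0 ?(ltW k0).
Qed.

(** * Almost sure limits of the normalized quadratic forms along the design *)

Section quadratic_limit.
Variables (D : set 'rV[R]_d) (B : R).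
Hypothesis DB : forall t i, D t -> `|t 0 i| <= B.
Variable s : forall n, 'I_n -> 'rV[R]_d.
Arguments s : clear implicits.
Hypothesis s_D : forall n i, D (s n i).
Hypothesis s_inj : forall n, injective (s n).
Arguments s_D : clear implicits.
Arguments s_inj : clear implicits.
Variables (nu phi k : R).
Hypotheses (nu0 : 0 < nu) (p0 : 0 < phi) (k0 : 0 < k).

Lemma white_noise_sumsq_ae (eps : 'rV[R]_d -> {RV P >-> R}) (tau2 : R) :
  white_noise D eps tau2 -> 0 < tau2 ->
  {ae P, forall w,
    (\sum_(i < n) eps (s n i) w ^+ 2) / n%:R - tau2 @[n --> \oo] --> (0 : R)}.
Proof.
move=> [law ind] t0; apply: ae_cvg0_exp.
  move=> n; apply: measurable_funB => //; apply: measurable_funM => //.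
  by apply: measurable_sum => i; exact: measurable_funX.
move=> t tt0.
(* The first bound makes the quadratic term of [sum_sq_tail] at most half of the linear gain c t;
   the second meets its smallness condition. *)
pose c := Num.min (t / (8 * tau2 ^+ 2)) (4 * tau2)^-1.
have c0 : 0 < c.
  by rewrite lt_min divr_gt0 ?invr_gt0 ?mulr_gt0 ?exprn_gt0.
have c1 : c * tau2 <= 4^-1.
  apply: (@le_trans _ _ ((4 * tau2)^-1 * tau2)).
    by rewrite ler_wpM2r ?(ltW t0)// ge_min lexx orbT.
  by rewrite le_eqVlt; apply/orP; left; apply/eqP; field; rewrite gt_eqF.
have c2 : (2 * c * tau2) ^+ 2 <= c * t / 2.
  have : c * (8 * tau2 ^+ 2) <= t.
    by rewrite -ler_pdivlMr ?mulr_gt0 ?exprn_gt0// ge_min lexx.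
  move=> /(ler_wpM2l (ltW c0)); lra.
have cb : `|2 * c * tau2| <= 2^-1.
  by rewrite ger0_norm ?mulr_ge0 ?(ltW c0) ?(ltW t0)//; lra.
have cbN : `|2 * (- c) * tau2| <= 2^-1 by rewrite mulrN mulNr normrN.
pose g := c * t / 4.
have g0 : 0 < g by rewrite divr_gt0 ?mulr_gt0.
(* Each tail is at most exp(-2 g n); from g n >= 1 on, one factor exp(-g n) absorbs the 2 of the
   union bound. *)
exists g, (Num.bound g^-1).+1; split=> // n nn.
have n0 : 0 < n%:R :> R by rewrite ltr0n (leq_trans _ nn).
have gn : 1 <= g * n%:R.
  rewrite mulrC -ler_pdivrMr// mul1r ltW//; apply: lt_le_trans (archi_boundP _) _.
    by rewrite invr_ge0 ltW.
  by rewrite ler_nat ltnW.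
pose X i := eps (s n i) : T -> R.
have mX i : measurable_fun setT (X i) by [].
have lX i A : measurable A -> P (X i @^-1` A) = gauss tau2 A by move=> mA; exact: law.
have iX A : (forall i, measurable (A i)) ->
    P (\bigcap_i (X i @^-1` A i)) = (\prod_(i < n) P (X i @^-1` A i))%E.
  by move=> mA; exact: (ind n (s n)).
have T1 := sum_sq_tail (n%:R * (c * t)) mX t0 lX iX cb.
have T2 := sum_sq_tail (n%:R * (c * t)) mX t0 lX iX cbN.
pose Y o := \sum_i X i o ^+ 2 - n%:R * tau2.
have mY : measurable_fun setT Y.
  apply: measurable_funB => //.
  by apply: measurable_sum => i; exact: measurable_funX.
have mcY (e : R) : measurable [set o | (n%:R * (c * t) <= e * Y o)%R].
  by apply: measurable_geset; exact: measurable_funM.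
apply: (@le_trans _ _ (P ([set o | (n%:R * (c * t) <= c * Y o)%R] `|`
    [set o | (n%:R * (c * t) <= - c * Y o)%R]))).
  apply: le_measure; rewrite ?inE.
  - apply: measurable_geset; apply: measurableT_comp => //.
    apply: measurable_funB => //; apply: measurable_funM => //.
    by apply: measurable_sum => i; exact: measurable_funX.
  - exact: measurableU.
  - move=> o /=.
    have -> : (\sum_(i < n) eps (s n i) o ^+ 2) / n%:R - tau2 = Y o / n%:R.
      by rewrite /Y /X; field; rewrite gt_eqF.
    rewrite normrM normfV (gtr0_norm n0) ler_pdivlMr// => tY.
    have [Y0|Y0] := leP 0 (Y o); [left|right]; rewrite /=.
      by rewrite mulrCA ler_pM2l// mulrC; move: tY; rewrite ger0_norm.
    by rewrite mulrCA mulNr -mulrN ler_pM2l// mulrC; move: tY; rewrite ltr0_norm.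
apply: (le_trans (measureU2 _ _ _)) => //.
apply: (@le_trans _ _ ((expR (- (2 * g * n%:R)))%:E + (expR (- (2 * g * n%:R)))%:E)%E).
  apply: leeD.
    apply: (le_trans T1); rewrite lee_fin ler_expR.
    have := ler_wpM2l (ltW n0) c2; rewrite /g; lra.
  apply: (le_trans T2); rewrite lee_fin ler_expR.
  have -> : (2 * - c * tau2) ^+ 2 = (2 * c * tau2) ^+ 2 by ring.
  have := ler_wpM2l (ltW n0) c2; rewrite /g; lra.
rewrite -EFinD lee_fin.
have -> : expR (- (2 * g * n%:R)) = expR (- (g * n%:R)) * expR (- (g * n%:R)).
  by rewrite -expRD; congr expR; ring.
rewrite -mulrDl ler_piMl ?expR_ge0// expRN.
have := expR_ge1Dx (g * n%:R) => H.
have H2 : 2 <= expR (g * n%:R) by lra.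
have E0 := expR_gt0 (g * n%:R).
have : (expR (g * n%:R))^-1 <= 2^-1 by rewrite lef_pV2 ?posrE.
lra.
Qed.

Lemma white_noise_quad_ae (eps : 'rV[R]_d -> {RV P >-> R}) (tau2 : R) :
  white_noise D eps tau2 -> 0 < tau2 ->
  {ae P, forall w,
    (k^-1 * \sum_(i < n) eps (s n i) w ^+ 2 -
     ((\col_i eps (s n i) w)^T *m invmx (matern_mx nu phi (s n) + k%:M) *m
      \col_i eps (s n i) w) 0 0) / n%:R @[n --> \oo] --> (0 : R)}.
Proof.
move=> wn t0; apply: ae_cvg0_exp.
  move=> n; apply: measurable_funM => //; apply: measurable_funB.
    apply: measurable_funM => //.
    by apply: measurable_sum => i; exact: measurable_funX.
  exact: measurable_quad.
move=> t tt0; pose la := (2 * tau2)^-1.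
have la0 : 0 < la by rewrite invr_gt0 mulr_gt0.
(* The threshold t becomes 4 g n for the rescaled form, whose mean is at most g n by [small];
   Chernoff leaves g n - 2 g n = - g n. *)
pose g := la * t * k / 4.
have g0 : 0 < g by rewrite divr_gt0 ?mulr_gt0.
have eta0 : 0 < 2 * g by rewrite mulr_gt0.
have [n0 Hn0] := @matern_eigen_small R d D B nu phi k (2 * g) DB nu0 p0 k0 eta0.
exists g, n0.+1; split=> // n nn.
have nR : 0 < n%:R :> R by rewrite ltr0n (leq_trans _ nn).
have [U [m [oU SE]]] := symmetric_spectral (matern_mx_sym nu phi (s n)).
have m0 i : 0 <= m 0 i.
  by apply: (diagonalized_psd_ge0 oU); rewrite -SE; exact: matern_mx_psd.
have small := Hn0 n (ltnW nn) (s n) U m (s_D n) oU SE m0.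
have mk i : 0 < m 0 i + k by rewrite ltr_wpDl.
pose w' i := la * (m 0 i / (m 0 i + k)).
have w'0 i : 0 <= w' i by rewrite mulr_ge0 ?(ltW la0)// divr_ge0 ?(ltW (mk i)).
have lat : la * tau2 = 2^-1 by rewrite /la; field; rewrite gt_eqF.
have wv i : w' i * (const_mx tau2 : 'rV[R]_n) 0 i = 2^-1 * (m 0 i / (m 0 i + k)).
  by rewrite mxE /w' mulrAC lat.
have frac i : m 0 i / (m 0 i + k) <= 1 by rewrite ler_pdivrMr// mul1r lerDl ltW.
(* A scalar covariance is diagonal in every orthonormal basis, in particular in the eigenbasis of
   the Matern matrix. *)
have tauE : (tau2%:M : 'M[R]_n) = U *m diag_mx (const_mx tau2) *m U^T.
  by rewrite diag_const_mx mul_mx_scalar -scalemxAl oU.1 scalemx1.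
have := @rotated_quadratic_tail R _ _ P n (fun i => eps (s n i)) tau2%:M U
  (const_mx tau2) w' (4 * g * n%:R).
move=> /(_ (fun i => @measurable_funPT _ _ _ _ (eps (s n i))) oU tauE
  (fun a => white_noise_mgf a wn t0 (s_D n) (s_inj n))).
move=> /(_ _ w'0 _) H.
have -> : [set o | t <= `|(k^-1 * \sum_(i < n) eps (s n i) o ^+ 2 -
     ((\col_i eps (s n i) o)^T *m invmx (matern_mx nu phi (s n) + k%:M) *m
      \col_i eps (s n i) o) 0 0) / n%:R| ] =
   [set o | 4 * g * n%:R <= \sum_i w' i * (\sum_j U j i * eps (s n j) o) ^+ 2].
  apply/seteqP.
  suff E o : (k^-1 * \sum_(i < n) eps (s n i) o ^+ 2 -
     ((\col_i eps (s n i) o)^T *m invmx (matern_mx nu phi (s n) + k%:M) *m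
      \col_i eps (s n i) o) 0 0) / n%:R =
      (\sum_i w' i * (\sum_j U j i * eps (s n j) o) ^+ 2) / (la * k * n%:R).
    have e0 o : 0 <= (\sum_i w' i * (\sum_j U j i * eps (s n j) o) ^+ 2) / (la * k * n%:R).
      rewrite divr_ge0 ?mulr_ge0 ?(ltW la0) ?(ltW k0)//.
      by apply: sumr_ge0 => i _; rewrite mulr_ge0 ?sqr_ge0.
    have gE : 4 * g * n%:R = t * (la * k * n%:R) by rewrite /g; field.
    by split=> o /=; rewrite E ger0_norm// gE ler_pdivlMr ?mulr_gt0.
  have [_ qE] := inv_shift_quad (\col_i eps (s n i) o) oU k0 m0.
  rewrite SE qE.
  have -> : \sum_(i < n) eps (s n i) o ^+ 2 =
      \sum_i ((U^T *m \col_i eps (s n i) o) i 0) ^+ 2.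
    by rewrite orthogonal_normsq//; apply: eq_bigr => i _; rewrite mxE.
  have cE i : (U^T *m \col_i eps (s n i) o) i 0 = \sum_j U j i * eps (s n j) o.
    by rewrite mxE; apply: eq_bigr => j _; rewrite !mxE.
  rewrite mulr_sumr -sumrB !mulr_suml; apply: eq_bigr => i _; rewrite cE /w'.
  by field; rewrite !gt_eqF.
apply: (le_trans (H _ _)) => [i|i|]; first by rewrite mxE ltW.
  by rewrite wv ler_piMr ?invr_ge0.
rewrite lee_fin ler_expR; under eq_bigr do rewrite wv.
by rewrite -mulr_sumr; lra.
Qed.

Lemma gaussian_process_quad_ae (z : 'rV[R]_d -> {RV P >-> R}) (sigma2 phi0 : R) :
  gaussian_process D z (fun t u => sigma2 * matern nu phi0 t u) ->
  0 < sigma2 -> 0 < phi0 ->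
  {ae P, forall w,
    ((\col_i z (s n i) w)^T *m invmx (matern_mx nu phi (s n) + k%:M) *m
      \col_i z (s n i) w) 0 0 / n%:R @[n --> \oo] --> (0 : R)}.
Proof.
move=> gp s20 p00; apply: ae_cvg0_exp.
  by move=> n; apply: measurable_funM => //; exact: measurable_quad.
move=> t tt0; pose C := (phi / phi0) ^+ d + (phi0 / phi) `^ (2 * nu).
have C0 : 0 < C by rewrite addr_gt0 ?exprn_gt0 ?powR_gt0 ?divr_gt0.
have [ka kaE] : exists ka, ka = C * k by eexists.
have ka0 : 0 < ka by rewrite kaE mulr_gt0.
have [la laE] : exists la, la = (2 * sigma2)^-1 by eexists.
have la0 : 0 < la by rewrite laE invr_gt0 mulr_gt0.
have las : la * sigma2 = 2^-1 by rewrite laE; field; rewrite gt_eqF.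
have [g gE] : exists g, g = la * t / C / 4 by eexists.
have g0 : 0 < g by rewrite gE !divr_gt0 ?mulr_gt0.
have eta0 : 0 < 2 * g by rewrite mulr_gt0.
have [n0 Hn0] := @matern_eigen_small R d D B nu phi0 ka (2 * g) DB nu0 p00 ka0 eta0.
exists g, n0.+1; split=> // n nn.
have nR : 0 < n%:R :> R by rewrite ltr0n (leq_trans _ nn).
(* The eigenbasis is that of the data-generating matrix, where the covariance of [z] is diagonal;
   the fitted matrix has to be exchanged for it by [inv_shift_antitone]. *)
have [U [m [oU SE]]] := symmetric_spectral (matern_mx_sym nu phi0 (s n)).
have m0 i : 0 <= m 0 i.
  by apply: (diagonalized_psd_ge0 oU); rewrite -SE; exact: matern_mx_psd.
have small := Hn0 n (ltnW nn) (s n) U m (s_D n) oU SE m0.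
have mk i : 0 < m 0 i + ka by rewrite ltr_wpDl.
pose w' i := la / (m 0 i + ka).
have w'0 i : 0 <= w' i by rewrite divr_ge0 ?(ltW la0) ?(ltW (mk i)).
have wv i : w' i * (sigma2 *: m) 0 i = 2^-1 * (m 0 i / (m 0 i + ka)).
  by rewrite mxE /w' mulrA (mulrAC la) las; ring.
have frac i : m 0 i / (m 0 i + ka) <= 1 by rewrite ler_pdivrMr// mul1r lerDl ltW.
have SE' : sigma2 *: matern_mx nu phi0 (s n) = U *m diag_mx (sigma2 *: m) *m U^T.
  by rewrite SE linearZ/= -scalemxAr -scalemxAl.
have := @rotated_quadratic_tail R _ _ P n (fun i => z (s n i))
  (sigma2 *: matern_mx nu phi0 (s n)) U
  (sigma2 *: m) w' (4 * g * n%:R).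
move=> /(_ (fun i => @measurable_funPT _ _ _ _ (z (s n i))) oU SE'
  (fun a => gaussian_process_mgf a gp (ltW s20) nu0 p00 (s_D n))).
move=> /(_ _ w'0 _) H.
have mq := measurable_quad (invmx (matern_mx nu phi (s n) + k%:M))
  (fun i => @measurable_funPT _ _ _ _ (z (s n i))).
(* Only an inclusion of events holds here, since the Loewner comparison bounds the form from one
   side. *)
apply: (@le_trans _ _ (P [set o | (4 * g * n%:R <=
    \sum_i w' i * (\sum_j U j i * z (s n j) o) ^+ 2)%R])).
  apply: le_measure; rewrite ?inE.
  - by apply: measurable_geset; apply: measurableT_comp => //; exact: measurable_funM.
  - apply: measurable_geset; apply: measurable_sum => i; apply: measurable_funM => //.
    by apply: measurable_funX; apply: measurable_sum => j; exact: measurable_funM.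
  - move=> o /=; set x := \col_i z (s n i) o.
    have q0 : 0 <= (x^T *m invmx (matern_mx nu phi (s n) + k%:M) *m x) 0 0.
      exact: inv_shift_ge0 (matern_mx_sym _ _ _) (matern_mx_psd _ nu0 p0) k0.
    have le0 a : quadform (fun i j => matern_mx nu phi0 (s n) i j) a <=
        C * quadform (fun i j => matern_mx nu phi (s n) i j) a.
      by rewrite (matern_mx_quadform nu phi0) (matern_mx_quadform nu phi);
        exact: (matern_le (s n) a nu0 p00 p0).
    have := inv_shift_antitone x (matern_mx_sym _ _ _) (matern_mx_sym _ _ _)
      (matern_mx_psd _ nu0 p00) (matern_mx_psd _ nu0 p0) C0 k0 le0.
    rewrite -kaE SE (inv_shift_quad x oU ka0 m0).2 => qle.
    rewrite ger0_norm ?divr_ge0// ler_pdivlMr// => tq.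
    have xE i : (U^T *m x) i 0 = \sum_j U j i * z (s n j) o.
      by rewrite mxE; apply: eq_bigr => j _; rewrite !mxE.
    have -> : \sum_i w' i * (\sum_j U j i * z (s n j) o) ^+ 2 =
        la * \sum_i (U^T *m x) i 0 ^+ 2 / (m 0 i + ka).
      by rewrite mulr_sumr; apply: eq_bigr => i _; rewrite xE /w'; ring.
    have -> : 4 * g * n%:R = la * (C^-1 * (t * n%:R)).
      by rewrite gE; field; rewrite gt_eqF.
    rewrite ler_pM2l// mulrC ler_pdivrMr// (mulrC _ C); exact: le_trans qle.
apply: (le_trans (H _ _)) => [i|i|].
- by rewrite mxE mulr_ge0 ?(ltW s20).
- by rewrite wv ler_piMr ?invr_ge0.
rewrite lee_fin ler_expR; under eq_bigr do rewrite wv.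
by rewrite -mulr_sumr; lra.
Qed.

Lemma matern_model_quad_ae (y : 'rV[R]_d -> {RV P >-> R}) (sigma2 phi0 tau2 : R) :
  matern_model D nu sigma2 phi0 tau2 y -> 0 < sigma2 -> 0 < phi0 -> 0 < tau2 ->
  {ae P, forall w,
    ((\col_i y (s n i) w)^T *m invmx (matern_mx nu phi (s n) + k%:M) *m
      \col_i y (s n i) w) 0 0 / n%:R @[n --> \oo] --> tau2 / k}.
Proof.
move=> [z [eps [gp wn _ yE]]] s20 p00 t0.
have Az := gaussian_process_quad_ae gp s20 p00.
have A1 := white_noise_sumsq_ae wn t0.
have A2 := white_noise_quad_ae wn t0.
apply: filterS3 Az A1 A2 => w Cz C1 C2.
pose q n (x : 'cV[R]_n) := (x^T *m invmx (matern_mx nu phi (s n) + k%:M) *m x) 0 0.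
pose zn n : 'cV[R]_n := \col_i z (s n i) w.
pose en n : 'cV[R]_n := \col_i eps (s n i) w.
have yzE n : \col_i y (s n i) w = zn n + en n.
  by apply/matrixP => i j; rewrite !mxE yE.
apply: (@cvg_perturb R _ (fun n => q n (zn n) / n%:R) (fun n => q n (en n) / n%:R)).
- by rewrite divr_ge0 ?ltW.
- move=> n t tt0; rewrite yzE -mulrBl normrM (@ger0_norm _ (n%:R^-1)) ?invr_ge0//.
  rewrite !mulrA -mulrDl ler_wpM2r ?invr_ge0//.
  exact: (@inv_shift_perturb R n (matern_mx nu phi (s n)) k t (q n) (zn n) (en n)
    (matern_mx_sym nu phi (s n)) (matern_mx_psd (s n) nu0 p0) k0 tt0 (fun=> erefl)).
- exact: Cz.
(* The noise form is |eps|^2 / k minus the remainder that [white_noise_quad_ae] shows to be o(n). *)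
have H : k^-1 * ((\sum_(i < n) eps (s n i) w ^+ 2) / n%:R - tau2 + tau2) -
    (k^-1 * \sum_(i < n) eps (s n i) w ^+ 2 - q n (en n)) / n%:R
    @[n --> \oo] --> tau2 / k.
  rewrite (_ : tau2 / k = k^-1 * (0 + tau2) - 0); last by ring.
  apply: cvgB; last exact: C2.
  by apply: cvgMl_tmp; apply: cvgD; [exact: C1|exact: cvg_cst].
apply: cvg_trans H; apply: near_eq_cvg; apply: nearW => n.
by ring.
Qed.

End quadratic_limit.
End model.

Theorem theorem3p1 (R : realType) (d : nat) (d_gt0 : (0 < d)%N)
  (D : set 'rV[R]_d)
  (s : forall n, 'I_n -> 'rV[R]_d)
  (s_D : forall n i, D (s n i))
  (s_inj : forall n, injective (s n))
  (infill : asymp (fun n => fill_distance D (s n))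
                  (fun n => n%:R `^ (- d%:R^-1)))
  (nu : R) (nu_gt0 : 0 < nu)
  (sigma02 phi0 tau02 : R)
  (sigma02_gt0 : 0 < sigma02) (phi0_gt0 : 0 < phi0) (tau02_gt0 : 0 < tau02)
  (disp : measure_display) (T : measurableType disp) (P0 : probability T R)
  (y : 'rV[R]_d -> {RV P0 >-> R})
  (y_model : matern_model D nu sigma02 phi0 tau02 y)
  (phi delta2 : R) (phi_gt0 : 0 < phi) (delta2_gt0 : 0 < delta2)
  (a_sigma b_sigma : R) (a_sigma_gt0 : 0 < a_sigma) (b_sigma_gt0 : 0 < b_sigma) :
  let data n w : 'cV[R]_n := \col_i y (s n i) w in
  let V n : 'M[R]_n := matern_mx nu phi (s n) + delta2%:M in
  {ae P0, forall w,
    weak_cvg (fun n => posterior_sigma2 (V n) a_sigma b_sigma (data n w))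
             \d_(tau02 / delta2) /\
    weak_cvg (fun n => posterior_tau2 (V n) a_sigma b_sigma (data n w) delta2)
             \d_tau02}.
Proof.
move=> data V.
have [B DB] := infill_bounded infill.
have L0 : 0 < tau02 / delta2 by rewrite divr_gt0.
have HV n : V n \in unitmx /\ 0 < \det (V n).
  apply: det_shift_gt0 delta2_gt0; first exact: matern_mx_sym.
  exact: matern_mx_psd.
have := @matern_model_quad_ae R d disp T P0 D B DB s s_D s_inj nu phi delta2
  nu_gt0 phi_gt0 delta2_gt0 y sigma02 phi0 tau02 y_model sigma02_gt0 phi0_gt0 tau02_gt0.
apply: filterS => w cQ.
have far_cvg := @posterior_far_cvg R V (data ^~ w) _ _ _
  a_sigma_gt0 b_sigma_gt0 L0 HV cQ.
split; first exact: weak_cvg_dirac.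
apply: weak_cvg_dirac => eps eta eps0 eta0.
(* Scaling by [delta2] pulls the far set of tau0^2 at [eps] back to the far set of tau0^2 / delta2
   at [eps / delta2]. *)
have [N HN] := far_cvg (eps / delta2) eta (divr_gt0 eps0 delta2_gt0) eta0.
exists N => n /HN; congr (_ <= _)%E; congr (posterior_sigma2 _ _ _ _ _).
have scaleE x : `|scale_by delta2 x - tau02| = `|x - tau02 / delta2| * delta2.
  rewrite -[X in _ = _ * X](gtr0_norm delta2_gt0) -normrM mulrBl divfK ?gt_eqF//.
  by rewrite mulrC.
by apply/seteqP; split=> x; rewrite /far/= scaleE ler_pdivrMr.
Qed.
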